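(* Let $\Lambda=\Lambda(Q,f,m_\bullet,c_\bullet)$ be a weighted surface algebra which is not isomorphic to any of the algebras $D(\lambda)$, $D(\lambda)^{(1)}$, $D(\lambda)^{(2)}$, $T(\lambda)$, $S(\lambda)$, $\Lambda(\lambda)$ with $\lambda\in K^*$. Then the string algebra $\Gamma=\Gamma(Q,f,m_\bullet,c_\bullet)$ is of non-polynomial growth. In particular, $\Lambda$ is of non-polynomial growth.
   Context: $K$ is an algebraically closed field; paths composed left to right. A triangulation quiver is a pair $(Q,f)$ where $Q$ is a finite connected quiver with at least two vertices such that at each vertex exactly two arrows start and exactly two end, and $f$ is a permutation of the arrows with $s(f(\alpha))=t(\alpha)$ and $f^3=\mathrm{id}$. $\bar\alpha$ is the other arrow with source $s(\alpha)$; $g(\alpha)=\overline{f(\alpha)}$; $n_\alpha$ the $g$-orbit length. Weights $m_\alpha\ge1$ and parameters $c_\alpha\in K^*$ constant on $g$-orbits; $A_\alpha=\alpha g(\alpha)\cdots g^{m_\alpha n_\alpha-2}(\alpha)$. $\alpha$ is virtual if $m_\alpha n_\alpha=2$. Assume $m_\alpha n_\alpha\ge2$ for all $\alpha$, $m_\alpha n_\alpha\ge3$ if $\bar\alpha$ is virtual and not a loop, $m_\alpha n_\alpha\ge 4$ if $\bar\alpha$ is a virtual loop. $\Lambda(Q,f,m_\bullet,c_\bullet)=KQ/I$, $I$ generated by $\alpha f(\alpha)-c_{\bar\alpha}A_{\bar\alpha}$ (all $\alpha$), $\alpha f(\alpha)g(f(\alpha))$ ($f^2(\alpha)$ not virtual),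 $\alpha g(\alpha)f(g(\alpha))$ ($f(\alpha)$ not virtual). The string algebra is $\Gamma(Q,f,m_\bullet,c_\bullet)=KQ/L$, where $L$ is the ideal generated by $\alpha f(\alpha)$ and $A_\alpha$ for all arrows $\alpha$. Special algebras ($\lambda\in K^*$), all weighted surface algebras: $D(\lambda)$: vertices $1,2$, arrows $\alpha:1\to1,\beta:1\to2,\gamma:2\to1,\sigma:2\to2$, $f=(\alpha\,\beta\,\gamma)(\sigma)$, weights $3$ on $g$-orbit $(\alpha)$ and $1$ on $(\beta\,\sigma\,\gamma)$, parameters $\lambda,1$. $D(\lambda)^{(2)}$: vertices $1,2,3,4$, arrows $\alpha:3\to1,\beta:1\to4,\xi:1\to2,\eta:2\to1,\delta:2\to3,\varrho:3\to3,\gamma:4\to4,\nu:4\to2$, $f=(\alpha\,\xi\,\delta)(\beta\,\nu\,\eta)(\varrho)(\gamma)$, all weights $1$, parameter $\lambda$ on $g$-orbit $(\alpha\,\beta\,\gamma\,\nu\,\delta\,\varrho)$, $1$ on $(\xi\,\eta)$. $D(\lambda)^{(1)}$: vertices $1,3$, arrows $\xi:1\to1,\beta:1\to3,\alpha:3\to1,\gamma:3\to3$, $f=(\xi\,\beta\,\alpha)(\gamma)$, weights $2$ on both $g$-orbits $(\xi),(\beta\,\gamma\,\alpha)$, parameter $\lambda$ on $(\beta\,\gamma\,\alpha)$, $1$ on $(\xi)$. $T(\lambda)$: vertices $1,2,3$, arrows $\alpha_1:1\to2,\alpha_2:2\to3,\alpha_3:3\to1,\beta_1:2\to1,\beta_2:3\to2,\beta_3:1\to3$,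 $f=(\alpha_1\,\alpha_2\,\alpha_3)(\beta_1\,\beta_3\,\beta_2)$, weights $2,2,1$ and parameters $\lambda,1,1$ on $(\alpha_1\,\beta_1),(\alpha_2\,\beta_2),(\alpha_3\,\beta_3)$. $S(\lambda)$: vertices $1..6$, arrows $\alpha:1\to2,\beta:2\to3,\gamma:3\to4,\sigma:4\to1,\varrho:1\to6,\omega:6\to3,\nu:3\to5,\delta:5\to1,\xi:2\to5,\eta:5\to2,\mu:4\to6,\varepsilon:6\to4$, $f=(\alpha\,\xi\,\delta)(\beta\,\nu\,\eta)(\gamma\,\mu\,\omega)(\varrho\,\varepsilon\,\sigma)$, weights $1$, parameter $\lambda$ on $(\alpha\,\beta\,\gamma\,\sigma)$, $1$ otherwise. $\Lambda(\lambda)$: vertices $1..6$, arrows $\alpha:4\to2,\beta:3\to2,\gamma:4\to1,\delta:1\to5,\varepsilon:2\to5,\eta:5\to4,\xi:5\to3,\mu:6\to3,\nu:1\to6,\varrho:2\to6,\sigma:3\to1,\omega:6\to4$, $f=(\gamma\,\delta\,\eta)(\alpha\,\varrho\,\omega)(\beta\,\varepsilon\,\xi)(\nu\,\mu\,\sigma)$, weights $1$, parameter $\lambda$ on $(\alpha\,\varepsilon\,\eta)$, $1$ otherwise. *)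

(* Defs.v *)
From HB Require Import structures.
From mathcomp Require Import all_boot all_order all_algebra.
Set Implicit Arguments. Unset Strict Implicit. Unset Printing Implicit Defensive.
Import GRing.Theory.
Local Open Scope ring_scope.

(* Paths are composed left to right.  A path is a pair (start vertex,   *)
(* list of arrows); it is valid when consecutive arrows compose.        *)
(* Elements of KQ are formal linear combinations (lists of             *)
(* (coefficient, path)); invalid paths are identified with 0.          *)
Section PathAlgebra.
Variables (K : fieldType) (V A : finType).

Definition qpath := (V * seq A)%type.
Definition kq := seq (K * qpath).

Variables (s t : A -> V).

Definition ptarget (p : qpath) : V := last p.1 (map t p.2).
Fixpoint walk (v : V) (l : seq A) : bool :=
  if l is a :: l' then (s a == v) && walk (t a) l' else true.
Definition pvalid (p : qpath) : bool := walk p.1 p.2.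

Definition kq_coef (x : kq) (p : qpath) : K := \sum_(u <- x | u.2 == p) u.1.
Definition kq_eq (x y : kq) : Prop :=
  forall p, pvalid p -> kq_coef x p = kq_coef y p.

Definition kq_add (x y : kq) : kq := x ++ y.
Definition kq_scale (c : K) (x : kq) : kq := [seq (c * u.1, u.2) | u <- x].
Definition kq_sub (x y : kq) : kq := kq_add x (kq_scale (-1) y).
Definition kq_mul (x y : kq) : kq :=
  flatten [seq [seq (u.1 * w.1, (u.2.1, u.2.2 ++ w.2.2)) | w <- y & ptarget u.2 == w.2.1]
          | u <- x].
Definition kq_path (p : qpath) : kq := [:: (1, p)].
Definition kq_one : kq := [seq (1, (v, [::])) | v <- enum V].

Definition in_ideal (R : seq kq) (x : kq) : Prop :=
  exists l : seq (K * qpath * nat * qpath),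
    kq_eq x (flatten [seq kq_scale u.1.1.1
                        (kq_mul (kq_mul (kq_path u.1.1.2) (nth [::] R u.1.2))
                                (kq_path u.2)) | u <- l]).
End PathAlgebra.
Arguments kq_path {K V A} p.

(* A bound quiver presentation KQ/I, I generated by the list prels. *)
Record pres (K : fieldType) := Pres {
  pV : finType; pA : finType; ps : pA -> pV; pt : pA -> pV;
  prels : seq (kq K pV pA) }.
Arguments ps {K} p _.
Arguments pt {K} p _.
Arguments prels {K} p.

Section Iso.
Variable K : fieldType.

(* K-algebra isomorphism KQ/I ~= KQ'/I'.  A unital algebra homomorphism *)
(* KQ -> KQ'/I' is given by the images e v of the trivial paths and x a *)
(* of the arrows (complete set of orthogonal idempotents, x a in        *)
(* e(s a) _ e(t a)); it descends to KQ/I when the relations go into I', *)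
(* and is then an isomorphism iff it is injective and surjective.       *)
Definition alg_iso (P P' : pres K) : Prop :=
  exists (e : pV P -> kq K (pV P') (pA P')) (x : pA P -> kq K (pV P') (pA P')),
    let I' := in_ideal (ps P') (pt P') (prels P') in
    let eqI' a b := I' (kq_sub a b) in
    let mul' := kq_mul (pt P') in
    let phip (p : qpath (pV P) (pA P)) : kq K (pV P') (pA P') :=
      if pvalid (ps P) (pt P) p then foldl mul' (e p.1) (map x p.2) else [::] in
    let phi (y : kq K (pV P) (pA P)) : kq K (pV P') (pA P') :=
      flatten [seq kq_scale u.1 (phip u.2) | u <- y] in
    [/\ [/\ (forall v w, eqI' (mul' (e v) (e w)) (if v == w then e v else [::])),
        eqI' (flatten [seq e v | v <- enum (pV P)]) (kq_one K (pV P') (pA P'))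
      & (forall a, eqI' (x a) (mul' (mul' (e (ps P a)) (x a)) (e (pt P a))))],
        (forall r, r \in prels P -> I' (phi r)),
        (forall y, I' (phi y) -> in_ideal (ps P) (pt P) (prels P) y)
      & (forall z, exists y, eqI' (phi y) z)].
End Iso.

(* Modules of dimension d (right modules on row vectors = unital        *)
(* algebra homomorphisms KQ/I -> M_d), over K or over K[x] (one-        *)
(* parameter families = K[x]-free bimodules of rank d).                 *)
Record rep (R : Type) (V A : Type) (d : nat) := Rep {
  rE : V -> 'M[R]_d; rX : A -> 'M[R]_d }.

Section Modules.
Variables (K : fieldType) (P : pres K).
Let V := pV P. Let A := pA P.

Section Gen.
Variables (R : comNzRingType) (iota : K -> R) (d : nat).

Definition rep_path (M : rep R V A d) (p : qpath V A) : 'M[R]_d :=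
  if pvalid (ps P) (pt P) p then foldl mulmx (rE M p.1) (map (rX M) p.2) else 0.
Definition rep_eval (M : rep R V A d) (x : kq K V A) : 'M[R]_d :=
  \sum_(u <- x) iota u.1 *: rep_path M u.2.

Definition is_module (M : rep R V A d) : Prop :=
  [/\ (forall v w, rE M v *m rE M w = if v == w then rE M v else 0),
      \sum_(v : V) rE M v = 1%:M,
      (forall a, rX M a = rE M (ps P a) *m rX M a *m rE M (pt P a))
    & (forall r, r \in prels P -> rep_eval M r = 0)].
End Gen.

Definition specialize d (F : rep {poly K} V A d) (lam : K) : rep K V A d :=
  Rep (fun v => map_mx (fun q : {poly K} => q.[lam]) (rE F v))
      (fun a => map_mx (fun q : {poly K} => q.[lam]) (rX F a)).

Definition mod_iso d (M N : rep K V A d) : Prop :=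
  exists Q : 'M[K]_d, [/\ Q \in unitmx,
    (forall v, rE M v *m Q = Q *m rE N v) & (forall a, rX M a *m Q = Q *m rX N a)].

Definition indecomposable d (M : rep K V A d) : Prop :=
  (0 < d)%N /\
  forall Q : 'M[K]_d,
    (forall v, rE M v *m Q = Q *m rE M v) -> (forall a, rX M a *m Q = Q *m rX M a) ->
    Q *m Q = Q -> Q = 0 \/ Q = 1%:M.

(* polynomial growth: exists m, mu(d) <= d^m for all d >= 1, where mu(d) *)
(* is the least number of one-parameter families covering all but      *)
(* finitely many isoclasses of indecomposable modules of dimension d.   *)
Definition poly_growth : Prop :=
  exists m : nat, forall d : nat, (0 < d)%N ->
    exists (k r : nat) (F : 'I_k -> rep {poly K} V A d) (E : 'I_r -> rep K V A d),
      [/\ (k <= d ^ m)%N,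
          (forall i, is_module (@polyC K) (F i)),
          (forall j, is_module id (E j))
        & forall N : rep K V A d, is_module id N -> indecomposable N ->
            (exists j, mod_iso N (E j)) \/
            (exists i (lam : K), mod_iso N (specialize (F i) lam))].
End Modules.

Record tqdata (K : Type) := TQ {
  tV : finType; tA : finType; ts : tA -> tV; tt : tA -> tV;
  tf : tA -> tA; tm : tA -> nat; tc : tA -> K }.
Arguments ts {K} _ _.
Arguments tt {K} _ _.
Arguments tf {K} _ _.
Arguments tm {K} _ _.
Arguments tc {K} _ _.

Section WSA.
Variables (K : fieldType) (Q : tqdata K).
Let V := tV Q. Let A := tA Q. Let s := ts Q. Let t := tt Q. Let f := tf Q.
Let m := tm Q. Let c := tc Q.

Definition tbar (a : A) : A := odflt a [pick b | (b != a) && (s b == s a)].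
Definition tg (a : A) : A := tbar (f a).
Definition tn (a : A) : nat := order tg a.
Definition tvirtual (a : A) : bool := (m a * tn a == 2)%N.
Definition Apath (a : A) : qpath V A := (s a, [seq iter i tg a | i <- iota 0 (m a * tn a).-1]).

Definition is_wsa : Prop :=
  [/\ (2 <= #|V|)%N /\
      (forall v w : V, connect [rel x y | [exists a : A, ((s a == x) && (t a == y)) ||
                                                      ((t a == x) && (s a == y))]] v w),
      (forall v : V, #|[pred a : A | s a == v]| = 2 /\ #|[pred a : A | t a == v]| = 2),
      [/\ injective f, (forall a, s (f a) = t a) & (forall a, f (f (f a)) = a)],
      (forall a, [/\ (1 <= m a)%N, c a != 0, m (tg a) = m a & c (tg a) = c a])
    & (forall a, [/\ (2 <= m a * tn a)%N,
                     tvirtual (tbar a) -> s (tbar a) != t (tbar a) -> (3 <= m a * tn a)%N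
                   & tvirtual (tbar a) -> s (tbar a) = t (tbar a) -> (4 <= m a * tn a)%N])].

Definition Lam_rels : seq (kq K V A) :=
  [seq kq_sub (kq_path (s a, [:: a; f a])) (kq_scale (c (tbar a)) (kq_path (Apath (tbar a))))
  | a <- enum A]
  ++ [seq kq_path (s a, [:: a; f a; tg (f a)]) | a <- enum A & ~~ tvirtual (f (f a))]
  ++ [seq kq_path (s a, [:: a; tg a; f (tg a)]) | a <- enum A & ~~ tvirtual (f a)].

Definition Gam_rels : seq (kq K V A) :=
  [seq kq_path (s a, [:: a; f a]) | a <- enum A] ++ [seq kq_path (Apath a) | a <- enum A].

Definition LamP : pres K := @Pres K V A s t Lam_rels.
Definition GamP : pres K := @Pres K V A s t Gam_rels.
End WSA.

(* The exceptional algebras; vertices and arrows numbered from 0.      *)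
Definition mkTQ (K : Type) (nv na : nat) (sl tl fl ml : seq nat) (cl : seq K) (c0 : K)
  : tqdata K :=
  @TQ K 'I_nv.+1 'I_na.+1
      (fun a => inord (nth 0 sl a)) (fun a => inord (nth 0 tl a))
      (fun a => inord (nth 0 fl a)) (fun a => nth 0 ml a) (fun a => nth c0 cl a).

Section Special.
Variables (K : fieldType) (lam : K).
(* D(lam): alpha=0, beta=1, gamma=2, sigma=3 *)
Definition D_alg : tqdata K :=
  mkTQ 1 3 [:: 0; 0; 1; 1] [:: 0; 1; 0; 1] [:: 1; 2; 0; 3] [:: 3; 1; 1; 1]
       [:: lam; 1; 1; 1] 1.
(* D(lam)^(2): alpha beta xi eta delta rho gamma nu = 0..7 *)
Definition D2_alg : tqdata K :=
  mkTQ 3 7 [:: 2; 0; 0; 1; 1; 2; 3; 3] [:: 0; 3; 1; 0; 2; 2; 3; 1]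
       [:: 2; 7; 4; 1; 0; 5; 6; 3] [:: 1; 1; 1; 1; 1; 1; 1; 1]
       [:: lam; lam; 1; 1; lam; lam; lam; lam] 1.
(* D(lam)^(1): xi beta alpha gamma = 0..3; vertices 1,3 -> 0,1 *)
Definition D1_alg : tqdata K :=
  mkTQ 1 3 [:: 0; 0; 1; 1] [:: 0; 1; 0; 1] [:: 1; 2; 0; 3] [:: 2; 2; 2; 2]
       [:: 1; lam; lam; lam] 1.
(* T(lam): alpha1 alpha2 alpha3 beta1 beta2 beta3 = 0..5 *)
Definition T_alg : tqdata K :=
  mkTQ 2 5 [:: 0; 1; 2; 1; 2; 0] [:: 1; 2; 0; 0; 1; 2] [:: 1; 2; 0; 5; 3; 4]
       [:: 2; 2; 1; 2; 2; 1] [:: lam; 1; 1; lam; 1; 1] 1.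
(* S(lam): alpha beta gamma sigma rho omega nu delta xi eta mu eps = 0..11 *)
Definition S_alg : tqdata K :=
  mkTQ 5 11 [:: 0; 1; 2; 3; 0; 5; 2; 4; 1; 4; 3; 5]
       [:: 1; 2; 3; 0; 5; 2; 4; 0; 4; 1; 5; 3]
       [:: 8; 6; 10; 4; 11; 2; 9; 0; 7; 1; 5; 3]
       [:: 1; 1; 1; 1; 1; 1; 1; 1; 1; 1; 1; 1]
       [:: lam; lam; lam; lam; 1; 1; 1; 1; 1; 1; 1; 1] 1.
(* Lambda(lam): alpha beta gamma delta eps eta xi mu nu rho sigma omega = 0..11 *)
Definition L_alg : tqdata K :=
  mkTQ 5 11 [:: 3; 2; 3; 0; 1; 4; 4; 5; 0; 1; 2; 5]
       [:: 1; 1; 0; 4; 4; 3; 2; 2; 5; 5; 0; 3]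
       [:: 9; 4; 3; 5; 6; 2; 1; 10; 7; 11; 8; 0]
       [:: 1; 1; 1; 1; 1; 1; 1; 1; 1; 1; 1; 1]
       [:: lam; 1; 1; 1; lam; lam; 1; 1; 1; 1; 1; 1] 1.
End Special.

(* Main.v *)
Require Import Defs.
From mathcomp Require Import all_boot all_order all_algebra.
From mathcomp Require Import fraction generic_quotient zify ring.
From Stdlib Require Import Classical.
Set Implicit Arguments. Unset Strict Implicit. Unset Printing Implicit Defensive.
Import GRing.Theory.

(** The arrows of [Q] are the states of an automaton: from [a] one may read [a] forwards and go to
    [g a], or read [f^-1 a] backwards.  A primitive cyclic walk without too long runs is a band of the
    string algebra, hence a one-parameter family of indecomposable modules, over [Gamma] and over its
    cover [Lambda].  If some state carries two interchangeable closed walks ("branching"), the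
    [2^n] concatenations give exponentially many bands.  A family over [K[x]] cannot contain
    infinitely many modules of two bands that differ in the dimensions of their walk spaces, since
    these dimensions are generically constant; so growth is not polynomial.

    An automaton without branching is rigid.  Either all [m n] equal 3, and [f], [bar] generate a
    quotient of the alternating group on four letters; or there is an arrow [x] with [m n = 4] at a
    vertex without virtual arrows and [f x] virtual, and [bar] and [g^2] generate a Klein four-group on
    the arrows of this kind.  The orbits of these groups leave only [D], [Lambda], [S], [T] and a
    quiver with two virtual loops; the latter gives [T(lam)] again, by an isomorphism that sends some
    arrows to paths of length two. *)

(** Reachability between states is one-way a priori: runs of equal letters are bounded, so a walk
    need not be retraceable. Return walks are therefore hardly ever built by hand. A basic move is
    arranged to be an injective self-map of a finite set of states, and then some power of it
    inverts it; a move that is admissible only on part of the states is returned by comparing the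
    sizes of two sets. Where a virtual arrow makes a basic move too long ([broken]), a detour along
    a [g]-orbit with [N] at least five restores a permutation.

    The count of bands has its own obstacle: the band read off from a code word may be a proper root
    of that word, and several codes may give rotations or reversals of one band. So bands are not
    counted up to isomorphism. The dimensions of the walk spaces determine which words of a given
    length occur in a band, and a band with $p$ positions offers at most $2p$ such words.

    Both presentations are handled at once: a representation killed by all $\alpha f(\alpha)$ and
    all $A_\alpha$ satisfies the relations of $\Gamma$ and of $\Lambda$. *)

Local Open Scope ring_scope.

(** * Generic rank of polynomial matrices *)

Section GenericRank.
Variable K : fieldType.
Notation tofrac := (@FracField.tofrac {poly K}).
Notation spec mu := (map_mx (fun q : {poly K} => q.[mu])).

Lemma fraction_quotient (R : idomainType) (x : {fraction R}) :
  exists n d : R, d != 0 /\ FracField.tofrac d * x = FracField.tofrac n.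
Proof.
elim/quotW: x => r; exists \n_r, \d_r; split; first exact: denom_ratioP.
unlock FracField.tofrac; rewrite -[LHS]FracField.pi_mul; apply/eqmodP.
rewrite /= FracField.equivfE /FracField.mulf !numden_Ratio ?mul1r ?mulr1 ?oner_eq0 //.
all: exact: denom_ratioP.
Qed.

Lemma clear_denominators m n (M : 'M[{fraction {poly K}}]_(m, n)) :
  exists2 d : {poly K}, d != 0 &
    exists N : 'M[{poly K}]_(m, n), map_mx tofrac N = tofrac d *: M.
Proof.
have /fin_all_exists2 [d d0 dP] (ij : 'I_m * 'I_n) :
  exists2 d : {poly K}, d != 0 & exists p, tofrac p = tofrac d * M ij.1 ij.2.
  by have [p [d [d0 dP]]] := fraction_quotient (M ij.1 ij.2); exists d => //; exists p.
have /fin_all_exists [p pP] := dP.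
exists (\prod_ij d ij); first by apply/prodf_neq0 => ij _; apply: d0.
exists (\matrix_(i, j) (p (i, j) * \prod_(ij | ij != (i, j)) d ij)).
apply/matrixP => i j; rewrite !mxE [in RHS](bigD1 (i, j)) //= !tofracM pP /=.
by rewrite mulrAC.
Qed.

(* Gaussian elimination over K(x), with denominators cleared. *)
Lemma generic_gauss m n (P : 'M[{poly K}]_(m, n)) :
  exists (r : nat) (D : {poly K}) (L : 'M[{poly K}]_m) (U : 'M[{poly K}]_n),
  [/\ (r <= m)%N, (r <= n)%N, D != 0 & forall mu, D.[mu] != 0 ->
      [/\ spec mu L \in unitmx, spec mu U \in unitmx &
       exists2 c : K, c != 0 &
         spec mu L *m spec mu P *m spec mu U = c *: pid_mx r]].
Proof.
set F := map_mx tofrac P.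
(* The base changes are cleared together with their inverses: [L1 *m L2] and [U2 *m U1] become
   nonzero scalars, so [L1] and [U1] stay invertible wherever the denominators do not vanish. *)
have [d1 d10 [L1 L1E]] := clear_denominators (invmx (col_ebase F)).
have [d2 d20 [L2 L2E]] := clear_denominators (col_ebase F).
have [e1 e10 [U1 U1E]] := clear_denominators (invmx (row_ebase F)).
have [e2 e20 [U2 U2E]] := clear_denominators (row_ebase F).
exists (\rank F), (d1 * d2 * e1 * e2), L1, U1.
split; rewrite ?rank_leq_row ?rank_leq_col ?mulf_neq0 // => mu.
rewrite !hornerM !mulf_eq0 !negb_or -!andbA => /and4P[d1mu d2mu e1mu e2mu].
have inj m' n' : injective (@map_mx _ _ tofrac m' n').
  by move=> A B /matrixP AB; apply/matrixP => i j; have := AB i j; rewrite !mxE => /eqP; rewrite tofrac_eq => /eqP.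
have EL : L1 *m L2 = (d1 * d2)%:M.
  apply: inj; rewrite map_mxM /= L1E L2E -scalemxAl -scalemxAr mulVmx ?col_ebase_unit //.
  by rewrite map_scalar_mx /= tofracM scalerA scalemx1.
have EU : U2 *m U1 = (e1 * e2)%:M.
  apply: inj; rewrite map_mxM /= U1E U2E -scalemxAl -scalemxAr mulmxV ?row_ebase_unit //.
  by rewrite map_scalar_mx /= tofracM scalerA scalemx1 mulrC.
have EP : L1 *m P *m U1 = (d1 * e1) *: pid_mx (\rank F).
  apply: inj; rewrite !map_mxM /= L1E U1E -/F map_mxZ map_pid_mx /=.
  rewrite -[X in _ *m X *m _](mulmx_ebase F) -!scalemxAl -scalemxAr scalerA mulrC -tofracM; congr (_ *: _); first by rewrite mulrC.
  by rewrite !mulmxA mulVmx ?col_ebase_unit // mul1mx -mulmxA mulmxV ?row_ebase_unit // mulmx1.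
have hM m' n' p' (A : 'M[{poly K}]_(m', n')) (B : 'M_(n', p')) :
    spec mu (A *m B) = spec mu A *m spec mu B := map_mxM (horner_eval mu) A B.
split.
- have := congr1 (spec mu) EL; rewrite hM (map_scalar_mx (horner_eval mu)) /= => E.
  have: spec mu L1 *m ((horner_eval mu (d1 * d2))^-1 *: spec mu L2) = 1%:M.
    rewrite -scalemxAr E scale_scalar_mx mulVf //.
    by rewrite /horner_eval hornerM mulf_neq0.
  by case/mulmx1_unit.
- have := congr1 (spec mu) EU; rewrite hM (map_scalar_mx (horner_eval mu)) /= => E.
  have: ((horner_eval mu (e1 * e2))^-1 *: spec mu U2) *m spec mu U1 = 1%:M.
    rewrite -scalemxAl E scale_scalar_mx mulVf //.
    by rewrite /horner_eval hornerM mulf_neq0.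
  by case/mulmx1_unit.
exists (d1.[mu] * e1.[mu]); first by rewrite mulf_neq0.
rewrite -!hM EP (map_mxZ (horner_eval mu)) (map_pid_mx (horner_eval mu)).
congr (_ *: _); exact: hornerM.
Qed.

Lemma generic_rank m n (P : 'M[{poly K}]_(m, n)) :
  exists (r : nat) (D : {poly K}), D != 0 /\
    forall mu, D.[mu] != 0 -> \rank (spec mu P) = r.
Proof.
have [r [D [L [U [rm rn D0 H]]]]] := generic_gauss P.
exists r, D; split=> // mu /H [Lu Uu [c c0 E]].
have := congr1 mxrank E; rewrite mxrank_scale_nz // rank_pid_mx // => <-.
rewrite mxrankMfree ?row_free_unit //.
by rewrite -[RHS]mxrank_tr trmx_mul mxrankMfree ?mxrank_tr // row_free_unit unitmx_tr.
Qed.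

(** In the normal form [c *: pid_mx r] the kernel is spanned by the last unit vectors, and [L]
    carries them back; so outside the zeros of [D] the kernel is spanned by rows that are polynomial
    in the parameter. *)
Lemma generic_kernel m n (P : 'M[{poly K}]_(m, n)) :
  exists (k : 'M[{poly K}]_m) (D : {poly K}), D != 0 /\
    forall mu, D.[mu] != 0 -> (kermx (spec mu P) :=: spec mu k)%MS.
Proof.
have [r [D [L [U [rm rn D0 H]]]]] := generic_gauss P.
exists (copid_mx r *m L), D; split=> // mu /H [Lu Uu [c c0 E]].
rewrite (map_mxM (horner_eval mu)) (map_copid_mx (horner_eval mu)) /=.
apply/eqmxP/rV_eqP => u; apply/sub_kermxP/idP => [uP|].
  have uL : u *m invmx (spec mu L) *m pid_mx r = 0 :> 'rV_n.
    apply: (scalerI c0); rewrite scaler0 scalemxAr -E !mulmxA mulmxKV //.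
    by rewrite uP mul0mx.
  rewrite -(mulmxKV Lu u) submxMr //; set v := u *m _ in uL *.
  have -> : v = v *m copid_mx r.
    rewrite mulmxBr mulmx1 -(@pid_mx_id _ m n m r rn) mulmxA uL mul0mx.
    by rewrite subr0.
  exact: submxMl.
case/submxP => v ->; apply: (can_inj (mulmxK Uu)).
rewrite mul0mx -!mulmxA (mulmxA _ _ (spec mu U)) E -scalemxAr mul_copid_mx_pid //.
by rewrite scaler0 mulmx0.
Qed.
End GenericRank.

(** * Words, cyclic bands and their intertwiners *)

(** On words of equal length this encodes the lexicographic order with [false] below [true], the
    order in which intertwiners of band modules become triangular. *)
Fixpoint wval (w : seq bool) : nat :=
  if w is b :: w' then (b * 2 ^ size w' + wval w')%N else 0%N.

Lemma wval_lt w : (wval w < 2 ^ size w)%N.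
Proof. by elim: w => //= -[] w IH; rewrite expnS; lia. Qed.

Lemma wval_inj w w' : size w = size w' -> wval w = wval w' -> w = w'.
Proof.
elim: w w' => [|b w IH] [|b' w'] //= [sz]; rewrite sz => E.
have := wval_lt w; have := wval_lt w'; rewrite sz => l l'.
have bb : b = b' by case: b b' E => [] [] //= E; lia.
by rewrite bb in E *; rewrite (IH w' sz) //; lia.
Qed.

Lemma wval_surj L n : (n < 2 ^ L)%N -> exists2 w, size w = L & wval w = n.
Proof.
elim: L n => [|L IH] n; first by rewrite ltnS leqn0 => /eqP->; exists [::].
rewrite expnS => nL; have [nl|nl] := ltnP n (2 ^ L).
  by have [w sz <-] := IH _ nl; exists (false :: w); rewrite /= ?sz.
have [|w sz E] := IH (n - 2 ^ L)%N; first by lia.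
by exists (true :: w); rewrite /= ?sz // E; lia.
Qed.

(** * Rotation of cyclic positions *)

Section CyclicOrdinals.
Variable n : nat.
Implicit Types i j : 'I_n.

Lemma val_iter_ordS k i : val (iter k (@ordS n) i) = ((i + k) %% n)%N.
Proof.
elim: k => [|k IH] /=; first by rewrite addn0 modn_small.
by rewrite IH -addn1 modnDml addn1 addnS.
Qed.

Lemma iter_ordS_id i : iter n (@ordS n) i = i.
Proof. by apply: val_inj; rewrite val_iter_ordS modnDr modn_small. Qed.

Lemma iter_ord_predK k i : iter k (@ordS n) (iter k (@ord_pred n) i) = i.
Proof. by elim: k i => // k IH i; rewrite iterS iterSr IH ord_predK. Qed.

Lemma iter_ordSK k i : iter k (@ord_pred n) (iter k (@ordS n) i) = i.
Proof. by elim: k i => // k IH i; rewrite iterS iterSr IH ordSK. Qed.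

Lemma iter_ord_pred_id i : iter n (@ord_pred n) i = i.
Proof. by rewrite -[in LHS](iter_ordS_id i) iter_ordSK. Qed.

Lemma iter_ordS_reach i j : exists k, iter k (@ordS n) i = j.
Proof.
exists (n - i + j)%N; apply: val_inj.
rewrite val_iter_ordS addnA subnKC; last exact: ltnW.
by rewrite modnDl modn_small.
Qed.
End CyclicOrdinals.

Lemma iter_mul_id (T : Type) (h : T -> T) n m x :
  (forall y, iter n h y = y) -> iter (m * n) h x = x.
Proof. by move=> H; elim: m => // m IH; rewrite mulSn iterD IH H. Qed.

(* A state of the automaton is an arrow [a]: bit [true] traverses [a] forwards,
   bit [false] traverses backwards the other arrow [f^-1 a] on the same side of
   the vertex [s a] (the one with [f^-1 a * a = 0]). *)
Definition step (A : Type) (bar f : A -> A) (b : bool) (a : A) : A :=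
  if b then bar (f a) else bar (f (f a)).
(** $A_\alpha$ has [N - 1] arrows and is zero in the string algebra; a letter [false] at state [a]
    reads $f^{-1}a$, which is [f (f a)]. Hence a window of [(run_bound f N b a).-1] letters from [a]
    must not consist of [b] only. *)
Definition run_bound (A : Type) (f : A -> A) (N : A -> nat) (b : bool) (a : A) : nat :=
  if b then N a else N (f (f a)).

Section Band.
Variables (K : fieldType) (V A : finType) (s t : A -> V) (bar f : A -> A) (N : A -> nat).
Hypothesis barK : involutive bar.
Hypothesis bar_neq : forall a, bar a != a.
Hypothesis sE : forall a b, (s a == s b) = (b == a) || (b == bar a).
Hypothesis f3 : forall a, f (f (f a)) = a.
Hypothesis sf : forall a, s (f a) = t a.

Local Notation stp := (step bar f).

Variable n : nat.
Variables (st : 'I_n -> A) (bt : 'I_n -> bool).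

Definition band_walk := forall j, st (ordS j) = stp (bt j) (st j).
Definition band_primitive := forall i j,
  (forall k, st (iter k (@ordS n) i) = st (iter k (@ordS n) j) /\
             bt (iter k (@ordS n) i) = bt (iter k (@ordS n) j)) -> i = j.
Definition band_runs := forall j b,
  exists2 k, (k < (run_bound f N b (st j)).-1)%N & bt (iter k (@ordS n) j) = ~~ b.

Hypothesis bandW : band_walk.

(* Oriented positions: the flag is [true] for the forward reading of the band *)
Local Notation opos := (bool * 'I_n)%type.
Implicit Types (o : opos) (i j : 'I_n).
Definition onext o : opos := (o.1, if o.1 then ordS o.2 else ord_pred o.2).
(** In the reversed reading a position carries the other state at the same vertex, and the next
    letter is the negated letter of the preceding edge. [oedge] is the edge crossed by the next
    step, in either direction. *)
Definition ostate o : A := if o.1 then st o.2 else bar (st o.2).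
Definition obit o : bool := if o.1 then bt o.2 else ~~ bt (ord_pred o.2).
Definition oedge o : 'I_n := if o.1 then o.2 else ord_pred o.2.
Definition orev o : opos := (~~ o.1, o.2).
(** The two states at a vertex are an arrow and its [bar]; for a position at the source of [a] this
    picks the reading whose state is [a]. *)
Definition orient (a : A) i : opos := (st i == a, i).

Lemma bar_inj : injective bar. Proof. exact: inv_inj. Qed.
Lemma ostate_next o : ostate (onext o) = stp (obit o) (ostate o).
Proof.
case: o => -[] i; rewrite /ostate /obit /onext /=; first exact: bandW.
have := bandW (ord_pred i); rewrite ord_predK => ->; rewrite /step.
by case: (bt _) => /=; rewrite barK f3.
Qed.

Lemma ostate_rev o : ostate (orev o) = bar (ostate o).
Proof. by case: o => -[] i //=; rewrite /ostate /= barK. Qed.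

Lemma obit_rev_next o : obit (orev (onext o)) = ~~ obit o.
Proof. by case: o => -[] i //=; rewrite /obit /= ?ordSK ?negbK. Qed.

Lemma onext_rev_next o : onext (orev (onext o)) = orev o.
Proof. by case: o => -[] i //=; rewrite /onext /orev /= ?ordSK ?ord_predK. Qed.

Lemma oedge_rev_next o : oedge (orev (onext o)) = oedge o.
Proof. by case: o => -[] i //=; rewrite /oedge /= ?ordSK. Qed.

Lemma onext_inj : injective onext.
Proof.
case=> b i [b' j] E; have eb : b = b' by case: E.
have := congr1 snd E; rewrite {}eb /onext; cbv [fst snd]; case: b' {E} => E; congr (_, _).
  exact: ordS_inj E.
exact: ord_pred_inj E.
Qed.

Lemma opos_eq o o' : o.2 = o'.2 -> ostate o = ostate o' -> o = o'.
Proof.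
case: o o' => b i [b' j] /= <-; rewrite /ostate /=.
have := bar_neq (st i); case: b b' => [] [] //= ne E; move: ne; first by rewrite -E eqxx.
by rewrite E eqxx.
Qed.

Lemma ostate_orient a i : s (st i) = s a -> ostate (orient a i) = a.
Proof.
move/eqP; rewrite sE /ostate /orient /=; case: (eqVneq (st i) a) => //= ne.
by move/eqP->.
Qed.

Lemma orient_ostate o : orient (ostate o) o.2 = o.
Proof.
apply: opos_eq => //; apply: ostate_orient.
by apply/eqP; rewrite sE /ostate; case: o => -[] i /=; rewrite eqxx ?orbT.
Qed.

Lemma s_ostate o : s (st o.2) = s (ostate o).
Proof. by apply/eqP; rewrite sE /ostate; case: o => -[] i /=; rewrite eqxx ?orbT. Qed.

Definition weight (lam : K) i : K := if val i == 0%N then lam else 1.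
Definition bandE (v : V) : 'M[K]_n := \matrix_(i, j) ((i == j) && (s (st i) == v))%:R.
(** The basis vector of a position lies at the vertex of its state. The arrow [a] moves it one step
    along the reading with state [a], provided the next letter there is forward; the parameter sits
    on the edge [0] alone. *)
Definition bandX (lam : K) (a : A) : 'M[K]_n := \matrix_(i, j)
  if [&& s (st i) == s a, obit (orient a i) & (onext (orient a i)).2 == j]
  then weight lam (oedge (orient a i)) else 0.

Lemma bandX_row lam o j : bandX lam (ostate o) o.2 j =
  if obit o && ((onext o).2 == j) then weight lam (oedge o) else 0.
Proof. by rewrite mxE s_ostate eqxx orient_ostate. Qed.

Lemma bandX_col lam o k : obit o ->
  bandX lam (ostate o) k (onext o).2 = if k == o.2 then weight lam (oedge o) else 0.
Proof.
move=> bo; rewrite mxE; case: ifP => [/and3P[/eqP sk bk /eqP ek]|].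
  have eo : orient (ostate o) k = o.
    apply: onext_inj; apply: opos_eq => //.
    by rewrite !ostate_next ostate_orient // bo bk.
  have ko : k = o.2 by rewrite -eo.
  by rewrite eo ko eqxx.
case: (k =P o.2) => // -> /negP[]; rewrite s_ostate eqxx orient_ostate bo /=; exact/eqP.
Qed.

(** * Intertwiners between two modules of one band *)

Section Intertwiner.
Variables (lam lam' : K) (Q : 'M[K]_n).
Hypotheses (lam0 : lam != 0) (lam'0 : lam' != 0).
Hypothesis QE : forall v, bandE v *m Q = Q *m bandE v.
Hypothesis QX : forall a, bandX lam a *m Q = Q *m bandX lam' a.

Lemma weight_neq0 (l : K) i : l != 0 -> weight l i != 0.
Proof. by rewrite /weight; case: ifP => // _; rewrite oner_eq0. Qed.

Lemma intertwiner_vertex i j : Q i j != 0 -> s (st i) = s (st j).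
Proof.
apply: contra_neq_eq => ne; have /matrixP/(_ i j) := QE (s (st i)).
rewrite !mxE (bigD1 i) //= big1 ?addr0 => [|k ki]; last first.
  by rewrite mxE eq_sym (negPf ki) mul0r.
rewrite (bigD1 j) //= big1 ?addr0 => [|k kj]; last by rewrite mxE (negPf kj) mulr0.
by rewrite !mxE !eqxx /= mul1r [s _ == _]eq_sym (negPf ne) mulr0.
Qed.

(** Each row of [bandX] has at most one nonzero entry, and so has the relevant column by
    [bandX_col]; both matrix products reduce to a single term. *)
Lemma intertwiner_link o o' : ostate o = ostate o' -> obit o' ->
  (if obit o then weight lam (oedge o) * Q (onext o).2 (onext o').2 else 0) =
  Q o.2 o'.2 * weight lam' (oedge o').
Proof.
move=> eo bo'; have /matrixP/(_ o.2 (onext o').2) := QX (ostate o).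
rewrite !mxE (bigD1 (onext o).2) //= big1 ?addr0 => [|k ki]; last first.
  by rewrite bandX_row [_ == k]eq_sym (negPf ki) andbF mul0r.
rewrite bandX_row eqxx andbT (bigD1 o'.2) //= big1 ?addr0 => [|k ki]; last first.
  by rewrite eo bandX_col // (negPf ki) mulr0.
by rewrite eo bandX_col // eqxx => <-; case: ifP => // _; rewrite mul0r.
Qed.

(** A backward letter is a forward letter of the reversed reading, so [intertwiner_link] serves for
    both letters. On the diagonal the two scalars can differ only at the edge that carries the
    parameter. *)
Lemma intertwiner_link_eq o o' : ostate o = ostate o' -> obit o = obit o' ->
  exists c c' : K, [/\ c != 0, c' != 0,
    c * Q (onext o).2 (onext o').2 = c' * Q o.2 o'.2 &
    o = o' -> (c == c') = (val (oedge o) != 0%N) || (lam == lam')].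
Proof.
move=> eo bo; case b': (obit o').
  exists (weight lam (oedge o)), (weight lam' (oedge o')); split; try exact: weight_neq0.
    by have := intertwiner_link eo b'; rewrite bo b' [Q _ _ * _]mulrC.
  by move=> <-; rewrite /weight; case: (val _ == _) => //=; rewrite eqxx.
exists (weight lam' (oedge o')), (weight lam (oedge o)); split; try exact: weight_neq0.
  have := @intertwiner_link (orev (onext o)) (orev (onext o')).
  rewrite !ostate_rev !ostate_next eo bo => /(_ erefl).
  rewrite !obit_rev_next bo b' => /(_ isT).
  by rewrite !onext_rev_next !oedge_rev_next /orev [RHS]mulrC => ->.
by move=> <-; rewrite /weight; case: (val _ == _) => //=; rewrite ?eqxx // eq_sym.
Qed.

Fixpoint word L o : seq bool :=
  if L is L'.+1 then obit o :: word L' (onext o) else [::].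

Lemma size_word L o : size (word L o) = L.
Proof. by elim: L o => //= L IH o; rewrite IH. Qed.

(** A nonzero entry is carried along as long as the two words agree. At the first difference, a
    backward letter at [o] against a forward one at [o'] would force the entry to be zero. *)
Lemma intertwiner_word_le L o o' : ostate o = ostate o' -> Q o.2 o'.2 != 0 ->
  (wval (word L o') <= wval (word L o))%N.
Proof.
elim: L o o' => //= L IH o o' eo Q0; rewrite !size_word.
case: (eqVneq (obit o) (obit o')) => [eb|].
  have [c [c' [c0 c'0 E _]]] := intertwiner_link_eq eo eb.
  rewrite eb leq_add2l; apply: IH; first by rewrite !ostate_next eo eb.
  by have := mulf_neq0 c'0 Q0; rewrite -E mulf_eq0 negb_or => /andP[].
case bo: (obit o); case bo': (obit o') => //= _.
  by have := wval_lt (word L (onext o')); rewrite size_word; lia.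
have := intertwiner_link eo bo'; rewrite bo => /esym/eqP.
by rewrite mulf_eq0 (negPf Q0) (negPf (weight_neq0 _ lam'0)).
Qed.
End Intertwiner.

Lemma word_nth L o k : (k < L)%N -> nth false (word L o) k = obit (iter k onext o).
Proof. by elim: L o k => // L IH o [|k] //= kL; rewrite IH // -iterSr iterS. Qed.

Lemma iter_onext k o :
  iter k onext o = (o.1, if o.1 then iter k (@ordS n) o.2 else iter k (@ord_pred n) o.2).
Proof. by elim: k => [|k IH]; [case: o => -[] | rewrite /= IH /onext /=; case: o.1]. Qed.

(** For two readings in the same direction this is primitivity. For opposite directions it says that
    no band is its own inverse: the two readings meet half-way, in an edge or a position that would
    equal its own reverse. *)
Lemma word_inj o o' : band_primitive -> ostate o = ostate o' -> word n o = word n o' -> o = o'.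
Proof.
move=> prim eo ew.
have per m o1 : iter (m * n) onext o1 = o1.
  apply: iter_mul_id => o2; rewrite iter_onext; case: o2 => -[] i /=.
    by rewrite iter_ordS_id.
  by rewrite iter_ord_pred_id.
have ebk k : obit (iter k onext o) = obit (iter k onext o').
  have n0 : (0 < n)%N by case: (o) => _ i; apply: leq_ltn_trans (ltn_ord i).
  rewrite (divn_eq k n) addnC !iterD !per.
  by rewrite -!(@word_nth n) ?ew // ltn_mod.
have esk k : ostate (iter k onext o) = ostate (iter k onext o').
  by elim: k => //= k IH; rewrite !ostate_next IH ebk.
have parity i j : ostate (true, i) = ostate (false, j) ->
   (forall k, obit (iter k onext (true, i)) = obit (iter k onext (false, j))) ->
   (forall k, ostate (iter k onext (true, i)) = ostate (iter k onext (false, j))) -> False.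
  move=> _ eb es; have [D Dj] := iter_ordS_reach i j.
  have ek k : (k <= D)%N -> iter k (@ord_pred n) j = iter (D - k) (@ordS n) i.
    by move=> kD; rewrite -Dj -{1}(subnKC kD) iterD iter_ordSK.
  (* Odd distance: after [h] steps both readings cross one edge, with opposite letters. Even
     distance: they stand at one position, with states exchanged by [bar]. *)
  have := odd_double_half D; rewrite -addnn; move: (D./2) => h; case: (odd D) => /= Dh.
    have := eb h; rewrite !iter_onext /obit /= -[ord_pred _]iterS.
    rewrite ek -?Dh; last by lia.
    by rewrite (_ : (1 + (h + h) - h.+1)%N = h); [case: (bt _) | lia].
  have := es h; rewrite !iter_onext /ostate /= ek -?Dh; last by lia.
  rewrite (_ : (0 + (h + h) - h)%N = h); last by lia.
  by move/esym/eqP; apply/negP.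
case: o o' eo {ew} ebk esk => -[] i [] [] j eo eb es.
- congr (_, _); apply: prim => k; have := eb k; have := es k.
  by rewrite !iter_onext.
- by case: (parity i j).
- by case: (parity j i).
congr (_, _).
have bk k : (0 < k)%N -> st (iter k (@ord_pred n) i) = st (iter k (@ord_pred n) j) /\
                 bt (iter k (@ord_pred n) i) = bt (iter k (@ord_pred n) j).
  case: k => // k _; have := eb k; have := es k.+1.
  by rewrite !iter_onext /ostate /obit /= => /bar_inj -> /negb_inj.
have n0 : (0 < n)%N by apply: leq_ltn_trans (ltn_ord i).
(* A forward shift by [k] is a backward shift by [k.+1 * n - k], which is positive, as [bk]
   requires. *)
have ordS_pred k i' : iter k (@ordS n) i' = iter (k.+1 * n - k) (@ord_pred n) i'.
  have le : (k <= k.+1 * n)%N by apply: leq_trans (leq_pmulr _ n0).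
  apply: (can_inj (@iter_ord_predK n k)); rewrite iter_ordSK -iterD subnKC //.
  by rewrite iter_mul_id // => y; apply: iter_ord_pred_id.
by apply: prim => k; rewrite !ordS_pred; apply: bk; rewrite subn_gt0; apply: leq_pmulr.
Qed.

(** The picked arrow depends on the vertex only, so positions at one vertex are compared by words
    read from a common state. *)
Definition band_rank i : nat :=
  if [pick a | s a == s (st i)] is Some a then wval (word n (orient a i)) else 0.

Section Triangular.
Variables (lam lam' : K) (Q : 'M[K]_n).
Hypotheses (prim : band_primitive) (lam0 : lam != 0) (lam'0 : lam' != 0).
Hypothesis QE : forall v, bandE v *m Q = Q *m bandE v.
Hypothesis QX : forall a, bandX lam a *m Q = Q *m bandX lam' a.

Lemma intertwiner_triangular i j : Q i j != 0 -> i != j -> (band_rank j < band_rank i)%N.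
Proof.
move=> Q0 ij; have sij := intertwiner_vertex QE Q0.
rewrite /band_rank sij; case: pickP => [a /eqP sa|]; last by move/(_ (st j)); rewrite eqxx.
have eo : ostate (orient a i) = ostate (orient a j) by rewrite !ostate_orient ?sij.
have le := @intertwiner_word_le _ _ _ lam0 lam'0 QX n _ _ eo Q0.
rewrite ltn_neqAle le andbT; apply: contra ij => /eqP/wval_inj.
by rewrite !size_word => /(_ erefl) /esym/(word_inj prim eo) [_ ->].
Qed.

Lemma intertwiner_diag i j : lam = lam' -> Q i i = Q j j.
Proof.
move=> el; have [k <-] := iter_ordS_reach i j; elim: k => //= k ->.
have [c [c' [c0 _ /= E]]] := intertwiner_link_eq lam0 lam'0 QX (erefl (ostate (true, iter k (@ordS n) i))) erefl.
move=> /(_ erefl); rewrite el eqxx orbT => /eqP ec.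
by rewrite -ec in E; apply: (mulfI c0).
Qed.

(** Away from edge [0] consecutive diagonal entries agree; crossing that edge gives $\lambda
    q=\lambda' q$ for their common value $q$. *)
Lemma intertwiner_diag0 i : lam != lam' -> Q i i = 0.
Proof.
move=> nel; have n0 : (0 < n)%N by apply: leq_ltn_trans (ltn_ord i).
pose i0 := Ordinal n0.
have base j : (val j != 0)%N -> Q (ordS j) (ordS j) = Q j j.
  move=> j0; have [c [c' [c0 _ /= E]]] :=
    intertwiner_link_eq lam0 lam'0 QX (erefl (ostate (true, j))) erefl.
  by move=> /(_ erefl) /=; rewrite /oedge /= j0 => /eqP ec; rewrite -ec in E; apply: (mulfI c0).
have toz k j : (j + k = n)%N -> Q j j = Q i0 i0.
  elim: k j => [|k IH] j jk; first by have := ltn_ord j; lia.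
  case: (eqVneq (val j) 0%N) => [j0|j0].
    by congr (Q _ _); apply: val_inj.
  rewrite -base //; case: k IH jk => [|k] IH jk.
    by congr (Q _ _); apply: val_inj; rewrite /= -[j.+1]addn1 jk modnn.
  by apply: IH; rewrite /= modn_small; lia.
have all0 j : Q j j = Q i0 i0 by apply: (toz (n - j)%N); have := ltn_ord j; lia.
have [c [c' [c0 _ /= E]]] :=
    intertwiner_link_eq lam0 lam'0 QX (erefl (ostate (true, i0))) erefl.
move=> /(_ erefl) /=; rewrite (negPf nel) => ec.
rewrite all0; apply/eqP; move/eqP: E; rewrite all0 -subr_eq0 -mulrBl mulf_eq0 subr_eq0.
by rewrite ec.
Qed.
End Triangular.

Lemma strictly_triangular_idempotent (R : 'M[K]_n) (r : 'I_n -> nat) :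
  (forall i j, R i j != 0 -> (r j < r i)%N) -> R *m R = R -> R = 0.
Proof.
move=> tri id; apply/matrixP => i j; rewrite mxE.
have [k] := ubnP (r i); elim: k i j => // k IH i j ri.
rewrite -id mxE big1 // => l _; case: (eqVneq (R i l) 0) => [->|]; first by rewrite mul0r.
by move/tri => rl; rewrite (IH l j) ?mulr0 // -ltnS; apply: leq_ltn_trans rl ri.
Qed.

Lemma strictly_triangular_nonunit (R : 'M[K]_n) (r : 'I_n -> nat) : 'I_n ->
  (forall i j, R i j != 0 -> (r j < r i)%N) -> R \notin unitmx.
Proof.
move=> i0 tri; apply/negP => Ru.
case: (arg_minnP r (erefl true : xpredT i0)) => i _ min.
have : row i R = 0.
  apply/matrixP => k j; rewrite !mxE; apply/eqP; apply/negPn/negP => /tri.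
  by rewrite ltnNge min.
rewrite rowE => /(congr1 (mulmx^~ (invmx R))); rewrite mulmxK // mul0mx.
by move/matrixP/(_ 0 i)/eqP; rewrite !mxE !eqxx oner_eq0.
Qed.

(** An endomorphism is a scalar plus a strictly triangular part. For an idempotent the scalar is 0
    or 1, and [Q] or [1 - Q] is then a strictly triangular idempotent, hence zero. *)
Lemma band_endo lam Q : band_primitive -> lam != 0 ->
  (forall v, bandE v *m Q = Q *m bandE v) ->
  (forall a, bandX lam a *m Q = Q *m bandX lam a) ->
  Q *m Q = Q -> Q = 0 \/ Q = 1%:M.
Proof.
move=> prim lam0 QE QX id.
have tri := intertwiner_triangular prim lam0 lam0 QE QX.
have dg i j := intertwiner_diag lam0 lam0 QX i j erefl.
have [n0|n0] := posnP n.
  by left; apply/matrixP => i; exfalso; have := ltn_ord i; lia.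
pose i0 := Ordinal n0.
have [c0|c0] := eqVneq (Q i0 i0) 0.
  left; apply: (strictly_triangular_idempotent (r := band_rank)) => // i j Q0.
  by apply: tri => //; apply: contraNneq Q0 => <-; rewrite (dg i i0) c0.
have c1 : Q i0 i0 = 1.
  have := congr1 (fun M : 'M_n => M i0 i0) id; rewrite mxE (bigD1 i0) //= big1 ?addr0.
    by move=> E; apply: (mulfI c0); rewrite mulr1.
  move=> k ki; apply/eqP; rewrite mulf_eq0; apply/norP => -[/tri q1 /tri q2].
  by move: (q2 ki); rewrite ltnNge ltnW // q1 // eq_sym.
right; apply/eqP; rewrite eq_sym -subr_eq0; apply/eqP.
apply: (strictly_triangular_idempotent (r := band_rank)) => [i j|].
  rewrite !mxE; case: (eqVneq i j) => [->|ne]; first by rewrite (dg j i0) c1 subrr eqxx.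
  by rewrite sub0r oppr_eq0 => /tri /(_ ne).
by rewrite mulmxBl mul1mx mulmxBr mulmx1 id subrr subr0.
Qed.

(** For different parameters the diagonal of an intertwiner vanishes too, and a strictly triangular
    matrix is not invertible. *)
Lemma band_iso lam lam' Q : (0 < n)%N -> band_primitive -> lam != 0 -> lam' != 0 ->
  (forall v, bandE v *m Q = Q *m bandE v) ->
  (forall a, bandX lam a *m Q = Q *m bandX lam' a) ->
  Q \in unitmx -> lam = lam'.
Proof.
move=> n0 prim lam0 lam'0 QE QX Qu; apply/eqP; apply: contraTT Qu => ne.
apply: (strictly_triangular_nonunit (r := band_rank) (Ordinal n0)) => i j Q0.
apply: (intertwiner_triangular prim lam0 lam'0 QE QX) => //.
by apply: contraNneq Q0 => <-; rewrite (intertwiner_diag0 lam0 lam'0 QX).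
Qed.

End Band.

(** * Walk invariants of representations *)

Section CoordinateSubspaces.
Variables (K : fieldType) (n : nat).
Implicit Types C D : pred 'I_n.

Definition coord_mx C : 'M[K]_n := \matrix_(i, j) ((i == j) && C i)%:R.

Lemma sub_coord_mx (u : 'rV_n) C :
  reflect (forall j, ~~ C j -> u 0 j = 0) (u <= coord_mx C)%MS.
Proof.
apply: (iffP submxP) => [[v ->] j nC|u0].
  by rewrite mxE big1 // => k _; rewrite mxE; case: eqP => [->|]; rewrite ?(negPf nC) mulr0.
exists u; apply/matrixP => i j; rewrite mxE (bigD1 j) //= big1 ?addr0 => [|k kj].
  rewrite mxE eqxx /=; case Cj: (C j); first by rewrite mulr1.
  by rewrite mulr0 ord1 u0 // Cj.
by rewrite mxE (negPf kj) mulr0.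
Qed.

Lemma mul_coord_mx C D : coord_mx C *m coord_mx D = coord_mx (predI C D).
Proof.
apply/matrixP => i j; rewrite mxE (bigD1 i) //= big1 ?addr0 => [|k ki]; last first.
  by rewrite mxE eq_sym (negPf ki) mul0r.
rewrite !mxE eqxx /=; case: (eqVneq i j) => [_|] /=; last by rewrite mulr0.
by rewrite -natrM mulnb.
Qed.

(** The upper bounds for [C] and for its complement suffice, since the two matrices add up to the
    identity. *)
Lemma rank_coord_mx C : \rank (coord_mx C) = #|C|.
Proof.
have le D : (\rank (coord_mx D) <= #|D|)%N.
  pose B : 'M[K]_(n, #|D|) := \matrix_(i, k) (i == enum_val k)%:R.
  suff -> : coord_mx D = B *m B^T by apply: mulmx_max_rank.
  apply/matrixP => i j; rewrite !mxE; case Di: (D i); last first.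
    rewrite andbF big1 // => k _; rewrite !mxE; case: eqP => [E|]; last by rewrite mul0r.
    by have := enum_valP k; rewrite -E -topredE /= Di.
  rewrite (bigD1 (enum_rank_in Di i)) //= big1 ?addr0 => [|k ki]; last first.
    rewrite !mxE; case: eqP => [E|]; last by rewrite mul0r.
    by case/eqP: ki; apply: enum_val_inj; rewrite enum_rankK_in.
  by rewrite !mxE enum_rankK_in // eqxx mul1r andbT eq_sym.
apply/eqP; rewrite eqn_leq le /=.
have : (n <= \rank (coord_mx C) + #|predC C|)%N.
  apply: leq_trans (leq_add (leqnn _) (le _)); apply: leq_trans (mxrank_add _ _).
  suff -> : coord_mx C + coord_mx (predC C) = 1%:M by rewrite mxrank1.
  apply/matrixP => i j; rewrite !mxE /=; case: (i == j); case: (C i); rewrite /= ?addr0 ?add0r //.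
by rewrite -[X in (X <= _)%N -> _](card_ord n) -(cardC C) leq_add2r.
Qed.
End CoordinateSubspaces.

Section Filtration.
Variables (K : fieldType) (V A : finType) (s : A -> V) (bar f : A -> A).

(** Generates the preimage under [X] of the row space of [B]: the kernel of [col_mx X B] consists of
    the pairs $(u,v)$ with $uX+vB=0$. *)
Definition preimmx (R : fieldType) d e (X : 'M[R]_d) (B : 'M[R]_(e, d)) : 'M[R]_(d + e, d) :=
  lsubmx (kermx (col_mx X B)).

Lemma sub_preimmx d e (X : 'M[K]_d) (B : 'M_(e, d)) (u : 'rV_d) :
  (u <= preimmx X B)%MS = (u *m X <= B)%MS.
Proof.
apply/idP/idP => [/submxP[v ->]|/submxP[v uX]].
  have := mulmx_ker (col_mx X B); rewrite /preimmx; move: (kermx _) => k.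
  rewrite -{1}(hsubmxK k) mul_row_col => /eqP; rewrite addr_eq0 => /eqP kE.
  by rewrite -mulmxA kE -mulNmx mulmxA submxMl.
have /submxP[w E] : (row_mx u (- v) <= kermx (col_mx X B))%MS.
  by apply/sub_kermxP; rewrite mul_row_col uX mulNmx subrr.
rewrite -(row_mxKl u (- v)) E /preimmx.
suff -> : lsubmx (w *m kermx (col_mx X B)) = w *m lsubmx (kermx (col_mx X B)) by apply: submxMl.
by rewrite -[in LHS](hsubmxK (kermx _)) mul_mx_row row_mxKl.
Qed.

(* The subspace of the [x] at [s a] from which the walk [w] can be followed in the
   representation, in the sense of composing the linear relations of its letters. *)
Fixpoint walk_space (R : fieldType) d (E : V -> 'M[R]_d) (X : A -> 'M[R]_d) (w : seq bool) (a : A)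
  : {e & 'M[R]_(e, d)} :=
  match w with
  | [::] => existT _ d (E (s a))
  | true :: w' => existT _ _ (preimmx (X a) (projT2 (walk_space E X w' (step bar f true a))) *m E (s a))
  | false :: w' => existT _ _ (projT2 (walk_space E X w' (step bar f false a)) *m X (f (f a)))
  end.

Definition walk_dim (R : fieldType) d (E : V -> 'M[R]_d) (X : A -> 'M[R]_d) w a :=
  \rank (projT2 (walk_space E X w a)).

Lemma walk_dim_iso d (E E' : V -> 'M[K]_d) (X X' : A -> 'M[K]_d) (Q : 'M[K]_d) w a :
  Q \in unitmx -> (forall v, E v *m Q = Q *m E' v) -> (forall b, X b *m Q = Q *m X' b) ->
  walk_dim E X w a = walk_dim E' X' w a.
Proof.
move=> Qu QE QX.
suff H : (projT2 (walk_space E X w a) *m Q :=: projT2 (walk_space E' X' w a))%MS.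
  by rewrite /walk_dim -H mxrankMfree // row_free_unit.
elim: w a => [|[] w IH] a /=.
- rewrite QE; apply: eqmxMfull; by rewrite row_full_unit.
- rewrite -mulmxA QE mulmxA; apply: eqmxMr; apply/eqmxP/rV_eqP => u.
  rewrite sub_preimmx -(IH (step bar f true a)).
  rewrite -{1}(mulmxKV Qu u) submxMfree ?row_free_unit // sub_preimmx.
  by rewrite -(submxMfree _ _ (C := Q)) ?row_free_unit // -!mulmxA QX !mulmxA mulmxKV.
by rewrite -mulmxA QX mulmxA; apply: eqmxMr.
Qed.

Notation spec mu := (map_mx (fun q : {poly K} => q.[mu])).

(** Images and products commute with every specialisation, preimages with those outside the zeros of
    a polynomial; each forward letter of [w] contributes one factor to [D]. *)
Lemma walk_dim_generic d (E : V -> 'M[{poly K}]_d) (X : A -> 'M[{poly K}]_d) w a :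
  exists (r : nat) (D : {poly K}), D != 0 /\ forall mu, D.[mu] != 0 ->
    walk_dim (fun v => spec mu (E v)) (fun b => spec mu (X b)) w a = r.
Proof.
suff [e [P [D [D0 H]]]] : exists e (P : 'M[{poly K}]_(e, d)) (D : {poly K}), D != 0 /\
    forall mu, D.[mu] != 0 ->
    (projT2 (walk_space (fun v => spec mu (E v)) (fun b => spec mu (X b)) w a) :=: spec mu P)%MS.
  have [r [D' [D'0 H']]] := generic_rank P.
  exists r, (D * D'); rewrite mulf_neq0 //; split=> // mu.
  by rewrite hornerM mulf_eq0 negb_or => /andP[/H h /H' <-]; rewrite /walk_dim h.
elim: w a => [|[] w IH] a /=.
- by exists d, (E (s a)), 1; rewrite oner_neq0; split.
- have [e [P [D [D0 H]]]] := IH (step bar f true a).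
  have [k [D' [D'0 H']]] := generic_kernel (col_mx (X a) P).
  exists _, (lsubmx k *m E (s a)), (D * D'); rewrite mulf_neq0 //; split=> // mu.
  rewrite hornerM mulf_eq0 negb_or => /andP[/H h /H' h'].
  rewrite (map_mxM (horner_eval mu)); apply: eqmxMr.
  apply/eqmxP/rV_eqP => u; rewrite sub_preimmx h -sub_preimmx /preimmx map_lsubmx.
  rewrite -(map_col_mx (horner_eval mu)).
  have lsubE p q m (W : 'M[K]_(p, q + m)) : lsubmx W = W *m col_mx 1%:M 0.
    by rewrite -{2}(hsubmxK W) mul_row_col mulmx1 mulmx0 addr0.
  by rewrite !lsubE; apply/esym; rewrite -(eqmxMr _ h').
have [e [P [D [D0 H]]]] := IH (step bar f false a).
exists _, (P *m X (f (f a))), D; split=> // mu /H h.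
by rewrite (map_mxM (horner_eval mu)); apply: eqmxMr.
Qed.
End Filtration.

(** * Walk spaces of band modules *)

Section BandFiltration.
Variables (K : fieldType) (V A : finType) (s t : A -> V) (bar f : A -> A) (N : A -> nat).
Hypothesis barK : involutive bar.
Hypothesis bar_neq : forall a, bar a != a.
Hypothesis sE : forall a b, (s a == s b) = (b == a) || (b == bar a).
Hypothesis f3 : forall a, f (f (f a)) = a.
Hypothesis sf : forall a, s (f a) = t a.
Variable n : nat.
Variables (st : 'I_n -> A) (bt : 'I_n -> bool).
Hypothesis bandW : band_walk bar f st bt.
Variable lam : K.
Hypothesis lam0 : lam != 0.


Local Notation ost := (ostate bar st).
Local Notation obt := (obit bt).
Local Notation ori := (orient st).
Local Notation BE := (@bandE K V A s n st).
Local Notation BX := (bandX s st bt lam).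
Let X_row o j := bandX_row bar_neq sE st bt lam o j.
Let X_col o k := bandX_col barK bar_neq sE f3 bandW lam (o := o) k.
Let o_next o := ostate_next barK f3 bandW o.
Let o_orient a i := @ostate_orient V A s bar sE n st a i.
Let orient_o o := orient_ostate bar_neq sE st o.
Let w_neq0 (i : 'I_n) : weight lam i != 0 := weight_neq0 i lam0.

(** The positions whose basis vectors span the walk space: a forward letter takes a preimage and so
    admits vectors killed by the arrow, a backward letter takes an image. *)
Fixpoint walk_set (w : seq bool) (a : A) (i : 'I_n) : bool :=
  (s (st i) == s a) &&
  match w with
  | [::] => true
  | true :: w' => ~~ obt (ori a i) || walk_set w' (step bar f true a) (onext (ori a i)).2
  | false :: w' => ~~ obt (ori a i) && walk_set w' (step bar f false a) (onext (ori a i)).2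
  end.

Lemma walk_set_cons b w a i : walk_set (b :: w) a i = (s (st i) == s a) &&
  (let r := walk_set w (step bar f b a) (onext (ori a i)).2 in
   if b then ~~ obt (ori a i) || r else ~~ obt (ori a i) && r).
Proof. by case: b. Qed.

(** The two rules are those of lexicographic comparison: a forward letter of [w] admits every
    position that goes backward, a backward letter excludes every position that goes forward. The
    walk spaces are thus the functorial filtration of the vertex space. *)
Lemma walk_setE w a i :
  walk_set w a i = (s (st i) == s a) && (wval (word bt (size w) (ori a i)) <= wval w)%N.
Proof.
elim: w a i => [|b w IH] a i; first by rewrite /= andbT.
rewrite walk_set_cons; case: (eqVneq (s (st i)) (s a)) => // sa; rewrite 2!andTb.
have next bb : obt (ori a i) = bb -> walk_set w (step bar f bb a) (onext (ori a i)).2 =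
     (wval (word bt (size w) (onext (ori a i))) <= wval w)%N.
  move=> eb; have eo : ost (onext (ori a i)) = step bar f bb a by rewrite o_next eb o_orient.
  rewrite IH -eo orient_o (_ : s (st _) == _) //.
  by rewrite (s_ostate sE st) eqxx.
have := wval_lt w; have := wval_lt (word bt (size w) (onext (ori a i))).
rewrite size_word; cbn [wval word size]; rewrite size_word => l1 l2.
case eb: (obt _); have nx := next _ eb; case: b; cbv zeta; rewrite ?nx.
all: move: (wval _) (wval _) l1 l2 {nx next} => x y l1 l2; rewrite [~~ _]/= ?mul1n ?mul0n ?add0n ?orTb ?andTb ?andFb ?orFb; clear -l1 l2; lia.
Qed.

Lemma bandE_coord v : BE v = coord_mx K (fun i => s (st i) == v).
Proof. by []. Qed.

Lemma preim_coord a C : (preimmx (BX a) (coord_mx K C) :=: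
  coord_mx K (fun i => ~~ ((s (st i) == s a) && obt (ori a i)) || C (onext (ori a i)).2))%MS.
Proof.
apply/eqmxP/rV_eqP => u; rewrite sub_preimmx; apply/sub_coord_mx/sub_coord_mx => H i.
  rewrite negb_or negbK => /andP[/andP[/eqP sa bi] nC].
  have colE k := X_col k bi; rewrite (o_orient sa) in colE.
  have := H _ nC; rewrite mxE (bigD1 i) // big1 => [|k ki].
    rewrite Monoid.mulm1 colE eqxx => /eqP.
    by rewrite mulf_eq0 (negPf (w_neq0 _)) orbF => /eqP.
  by rewrite colE (negPf ki) mulr0.
move=> nC; rewrite mxE big1 // => k _; rewrite mxE.
case: ifP => [/and3P[sa bi /eqP e]|]; last by rewrite mulr0.
by rewrite H ?mul0r // sa bi e.
Qed.

(** A basis vector is hit by $f^{-1}a$ exactly when the reading with state [a] goes backward from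
    its position; that step, reversed, starts at the preimage. *)
Lemma image_coord a C : (coord_mx K C *m BX (f (f a)) :=:
  coord_mx K (fun i => [&& s (st i) == s a, ~~ obt (ori a i) & C (onext (ori a i)).2]))%MS.
Proof.
set C' := fun i => _.
have barff : bar (step bar f false a) = f (f a) by rewrite /step barK.
have rowL i : row i (coord_mx K C *m BX (f (f a))) = (C i)%:R *: row i (BX (f (f a))).
  apply/rowP => j; rewrite !mxE (bigD1 i) //= big1 ?addr0 ?mxE ?eqxx // => k ki.
  by rewrite mxE eq_sym (negPf ki) mul0r.
have rowC i : row i (coord_mx K C') = (C' i)%:R *: delta_mx 0 i.
  apply/rowP => j; rewrite !mxE eqxx /= eq_sym.
  by case: (C' i); case: (j == i); rewrite ?mulr0 ?mulr1.
apply/eqmxP/andP; split; apply/row_subP => i.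
  rewrite rowL; case Ci: (C i); last by rewrite scale0r sub0mx.
  rewrite scale1r; case: (boolP ((s (st i) == s (f (f a))) && obt (ori (f (f a)) i))); last first.
    move=> nb; rewrite (_ : row i _ = 0) ?sub0mx //.
    by apply/rowP => j; rewrite !mxE andbA (negPf nb).
  case/andP => /eqP sa bi; set o := ori (f (f a)) i in bi.
  have eo : ost o = f (f a) by rewrite o_orient.
  have er : ost (orev (onext o)) = a by rewrite (ostate_rev barK) o_next bi eo /step barK f3.
  have eor : ori a (onext o).2 = orev (onext o) by rewrite -{1}er -[(onext o).2]/(orev (onext o)).2 orient_o.
  have Cj : C' (onext o).2.
    rewrite /C' eor obit_rev_next bi onext_rev_next -[(onext o).2]/(orev (onext o)).2.
    by rewrite (s_ostate sE st) er eqxx [X in [&& _, _ & X]]Ci.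
  rewrite (_ : row i _ = weight lam (oedge o) *: row (onext o).2 (coord_mx K C')).
    by rewrite scalemx_sub // row_sub.
  rewrite rowC Cj scale1r; apply/rowP => j.
  rewrite !mxE eqxx /= sa eqxx -/o bi /= eq_sym; by case: (j == _); rewrite ?mulr1 ?mulr0.
rewrite rowC; case Ci: (C' i); last by rewrite scale0r sub0mx.
rewrite scale1r; case/and3P: Ci => /eqP sa nb Cn.
set o := ori a i in nb Cn; have eo : ost o = a by rewrite o_orient.
set o' := orev (onext o).
have eo' : ost o' = f (f a) by rewrite (ostate_rev barK) o_next eo (negPf nb) /step barK.
have bo' : obt o' by rewrite obit_rev_next.
have no' : (onext o').2 = i by rewrite onext_rev_next.
rewrite (_ : delta_mx 0 i = (weight lam (oedge o'))^-1 *: row o'.2 (coord_mx K C *m BX (f (f a)))).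
  by rewrite scalemx_sub // row_sub.
rewrite rowL [C _]Cn scale1r; apply/rowP => j.
rewrite [RHS]mxE [X in _ * X]mxE -eo' X_row bo' no' !mxE eqxx /= eq_sym.
by case: (i == j); rewrite ?mulr0 // mulVf.
Qed.

Lemma walk_space_band w a :
  (projT2 (walk_space s bar f BE BX w a) :=: coord_mx K (walk_set w a))%MS.
Proof.
have ext C D : C =1 D -> coord_mx K C = coord_mx K D.
  by move=> CD; apply/matrixP => i j; rewrite !mxE CD.
elim: w a => [|[] w IH] a /=.
- by rewrite bandE_coord; apply/eqmxP/rV_eqP => u; congr (_ <= _)%MS; apply: ext => i; rewrite andbT.
- rewrite bandE_coord.
  have e1 : (preimmx (BX a) (projT2 (walk_space s bar f BE BX w (step bar f true a))) :=:
             preimmx (BX a) (coord_mx K (walk_set w (step bar f true a))))%MS.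
    by apply/eqmxP/rV_eqP => u; rewrite !sub_preimmx IH.
  apply: (eqmx_trans (eqmxMr _ (eqmx_trans e1 (preim_coord _ _)))).
  rewrite mul_coord_mx; apply/eqmxP/rV_eqP => u; congr (_ <= _)%MS; apply: ext => i /=.
  by case: (s (st i) == s a); rewrite ?andbF ?andbT.
apply: (eqmx_trans (eqmxMr _ (IH _))); apply: (eqmx_trans (image_coord _ _)).
by apply/eqmxP/rV_eqP => u; congr (_ <= _)%MS; apply: ext => i.
Qed.

Lemma walk_dim_band w a : walk_dim s bar f BE BX w a = #|walk_set w a|.
Proof. by rewrite /walk_dim walk_space_band rank_coord_mx. Qed.
End BandFiltration.

(** * Band modules as string representations *)

Lemma closed_field_infinite (K : closedFieldType) (l : seq K) : exists x, x \notin l.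
Proof.
case: l => [|z l]; first by exists 0.
set p := \prod_(y <- z :: l) ('X - y%:P) + 1.
have [|x /rootP px] := closed_rootP p _.
  rewrite size_polyDl; first by rewrite size_prod_XsubC.
  by rewrite size_poly1 size_prod_XsubC.
exists x; apply/negP => xl; move: px; rewrite /p hornerD hornerC.
have /eqP -> : root (\prod_(y <- z :: l) ('X - y%:P)) x by rewrite root_prod_XsubC.
by rewrite add0r => /eqP; rewrite oner_eq0.
Qed.

(** Serves to discard parameters: a fixed module is isomorphic to the band module for at most one
    parameter, so finitely many modules exclude finitely many parameters. *)
Lemma subsingletons_finite (K : eqType) (T : finType) (P : T -> K -> Prop) :
  (forall x l l', P x l -> P x l' -> l = l') -> exists ls : seq K, forall x l, P x l -> l \in ls.
Proof.
move=> uP; have H x : exists ls : seq K, forall l, P x l -> l \in ls.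
  case: (classic (exists l, P x l)) => [[l Pl]|no].
    by exists [:: l] => l' Pl'; rewrite (uP _ _ _ Pl' Pl) mem_head.
  by exists [::] => l Pl; case: no; exists l.
have /fin_all_exists [ls lsP] := H.
exists (flatten [seq ls x | x <- enum T]) => x l Pl.
by apply/flatten_mapP; exists x; rewrite ?mem_enum //; apply: lsP.
Qed.

Lemma expn_beats_poly C e : exists2 n, (0 < n)%N & (C * n ^ e < 2 ^ n)%N.
Proof.
(* With $n=2^j$ and $C<2^C$ it suffices that $C+je\le 2^j$; for $j=2k$ one has $2^j\ge k^2\ge
   C+je$. *)
pose k := (C + 2 * e).+1; pose j := (2 * k)%N.
exists (2 ^ j)%N; first by rewrite expn_gt0.
apply: (@leq_trans (2 ^ (C + j * e))).
  rewrite expnD expnM ltn_mul2r expn_gt0 expn_gt0 /=.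
  exact: ltn_expl.
rewrite leq_exp2l // /j [X in (_ <= 2 ^ X)%N]mulnC expnM.
have := @ltn_expl 2 k isT; move: (2 ^ k)%N => x xk.
rewrite -mulnn; apply: (@leq_trans (k * k)); last by apply: leq_mul; lia.
by rewrite /k; nia.
Qed.

Section BandModule.
Variables (K : fieldType) (V A : finType) (s t : A -> V) (bar f : A -> A) (N : A -> nat).
Hypothesis barK : involutive bar.
Hypothesis bar_neq : forall a, bar a != a.
Hypothesis sE : forall a b, (s a == s b) = (b == a) || (b == bar a).
Hypothesis f3 : forall a, f (f (f a)) = a.
Hypothesis sf : forall a, s (f a) = t a.
Hypothesis Ng : forall a, N (bar (f a)) = N a.

(** The vanishing of all $\alpha f(\alpha)$ and all $A_\alpha$, stated without a presentation so
    that it can be used for both algebras. *)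
Definition string_rep d (M : rep K V A d) : Prop :=
  [/\ [/\ (forall v w, rE M v *m rE M w = if v == w then rE M v else 0),
      \sum_(v : V) rE M v = 1%:M &
      (forall a, rX M a = rE M (s a) *m rX M a *m rE M (t a))],
      (forall a, rX M a *m rX M (f a) = 0) &
      (forall a, foldl mulmx (rE M (s a))
         [seq rX M (iter k (fun b => bar (f b)) a) | k <- iota 0 (N a).-1] = 0)].

Variable n : nat.
Variables (st : 'I_n -> A) (bt : 'I_n -> bool).
Hypothesis bandW : band_walk bar f st bt.
Hypothesis bandR : band_runs f N st bt.
Variable lam : K.

Local Notation ost := (ostate bar st).
Local Notation obt := (obit bt).
Local Notation ori := (orient st).
Local Notation BE := (@bandE K V A s n st).
Local Notation BX := (bandX s st bt lam).
Let X_row o j := bandX_row bar_neq sE st bt lam o j.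
Let o_next o := ostate_next barK f3 bandW o.
Let o_orient a i := @ostate_orient V A s bar sE n st a i.
Let orient_o o := orient_ostate bar_neq sE st o.

Definition band_rep : rep K V A n := Rep BE BX.

Lemma coord_mulmx m C (M : 'M[K]_(n, m)) i j : (coord_mx K C *m M) i j = (C i)%:R * M i j.
Proof.
rewrite mxE (bigD1 i) //= big1 ?addr0 => [|k ki]; last by rewrite mxE eq_sym (negPf ki) mul0r.
by rewrite mxE eqxx.
Qed.

Lemma mulmx_coord m C (M : 'M[K]_(m, n)) i j : (M *m coord_mx K C) i j = M i j * (C j)%:R.
Proof.
rewrite mxE (bigD1 j) //= big1 ?addr0 => [|k ki]; last by rewrite mxE (negPf ki) mulr0.
by rewrite mxE eqxx.
Qed.

Lemma s_bar a : s (bar a) = s a.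
Proof. by apply/esym/eqP; rewrite sE eqxx orbT. Qed.

Lemma bandX_target a i j : BX a i j != 0 ->
  [/\ s (st i) = s a, obt (ori a i) & (onext (ori a i)).2 = j].
Proof. by rewrite mxE; case: ifP => [/and3P[/eqP -> -> /eqP ->] _|]; rewrite ?eqxx. Qed.

Lemma bandX_mul_f a : BX a *m BX (f a) = 0.
Proof.
apply/matrixP => i j; rewrite [RHS]mxE mxE big1 // => k _; apply/eqP.
rewrite mulf_eq0; apply/norP => -[/bandX_target[sa b1 e1] /bandX_target[sk b2 e2]].
set o := ori a i in b1 e1; have eo : ost o = a by rewrite o_orient.
have er : ost (orev (onext o)) = f a by rewrite (ostate_rev barK) o_next b1 eo /step barK.
move: b2; rewrite -er -e1 -[(onext o).2]/(orev (onext o)).2 orient_o obit_rev_next.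
by rewrite b1.
Qed.

Lemma bandX_cut a : BX a = BE (s a) *m BX a *m BE (t a).
Proof.
apply/matrixP => i j; rewrite mulmx_coord coord_mulmx.
case: (eqVneq (BX a i j) 0) => [->|X0]; first by rewrite mulr0 mul0r.
have [sa b e] := bandX_target X0.
have -> : s (st j) == t a.
  by rewrite -e (s_ostate sE st) o_next b (o_orient sa) /step s_bar sf.
by rewrite sa eqxx mul1r mulr1.
Qed.

(** The path $a\,g(a)\cdots$ moves a basis vector along the band while the letters are forward; a
    nonzero result therefore exhibits a forward run of [m] letters. *)
Lemma band_path a m i : s (st i) = s a -> exists2 c : K,
  row i (foldl mulmx (BE (s a)) [seq BX (iter k (fun b => bar (f b)) a) | k <- iota 0 m]) =
    c *: delta_mx 0 (iter m (@onext n) (ori a i)).2 &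
  c != 0 -> (forall k, (k < m)%N -> obt (iter k (@onext n) (ori a i))) /\
     ost (iter m (@onext n) (ori a i)) = iter m (fun b => bar (f b)) a.
Proof.
move=> sa; elim: m => [|m [c rE cP]].
  exists 1 => [|_]; last by split=> //; rewrite o_orient.
  by rewrite /= scale1r rowE bandE_coord; apply/rowP => j; rewrite mulmx_coord !mxE /=;
     case: (eqVneq j i) => [->|]; rewrite ?sa ?eqxx ?mulr1 ?mul0r.
have -> : iota 0 m.+1 = iota 0 m ++ [:: m] by rewrite -addn1 iotaD.
rewrite map_cat foldl_cat /foldl /= row_mul rE -scalemxAl -rowE.
set o := iter m _ _; set a' := iter m _ a.
case: (eqVneq c 0) => [->|c0].
  by exists 0; rewrite ?scale0r // eqxx.
have [bm om] := cP c0; rewrite -/o -/a' in om.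
case bo: (obt o); last first.
  exists 0; rewrite ?eqxx // scale0r; apply/rowP => j.
  by rewrite mxE [X in _ * X]mxE -om X_row bo mulr0 mxE.
exists (c * weight lam (oedge o)) => [|_].
  rewrite -scalerA; congr (_ *: _); apply/rowP => j.
  rewrite mxE -om X_row bo mxE [X in _ = _ * X]mxE -/o eqxx eq_sym.
  by case: (j == _); rewrite ?mulr1 ?mulr0.
split=> [k|].
  by rewrite ltnS leq_eqVlt => /orP[/eqP->|/bm].
by rewrite o_next bo om /step.
Qed.

Lemma iter_bar_f_N k a : N (iter k (fun b => bar (f b)) a) = N a.
Proof. by elim: k => //= k; rewrite Ng. Qed.

Lemma orun a i : s (st i) = s a ->
  exists2 k, (k < (N a).-1)%N & ~~ obt (iter k (@onext n) (ori a i)).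
Proof.
move=> sa; have eo := o_orient sa; move: eo; rewrite /orient; case: (st i == a) => eo.
  have [k kN bk] := bandR i true; exists k; first by rewrite /run_bound -eo in kN *.
  by rewrite iter_onext /obit /= bk.
apply: NNPP => no; set m := (N a).-1 in no.
have allb k : (k < m)%N -> bt (iter k.+1 (@ord_pred n) i) = false.
  move=> km; apply/negP => b; case: no; exists k => //.
  by rewrite iter_onext /obit /= b.
have sts k : (k <= m)%N -> ost (iter k (@onext n) (false, i)) = iter k (fun b => bar (f b)) a.
  elim: k => // k IH km; rewrite iterS o_next IH 1?ltnW // iter_onext /obit /=.
  by rewrite -[ord_pred _]iterS allb.
(* A forward run of the reversed reading is a run of [false] letters that ends at [i]; it is
   inspected from its far end, where the bound for [false] applies. *)
have [k] := bandR (iter m (@ord_pred n) i) false; rewrite /run_bound.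
have -> : N (f (f (st (iter m (@ord_pred n) i)))) = N a.
  have := sts m (leqnn m); rewrite iter_onext /ostate /= => /(congr1 bar); rewrite barK => ->.
  by rewrite -Ng f3 barK iter_bar_f_N.
rewrite -/m => km; rewrite -(subnKC (ltnW km)) iterD iter_ord_predK.
by rewrite -(prednK (n := (m - k)%N)) ?subn_gt0 // allb //; lia.
Qed.

Lemma band_string_rep : string_rep band_rep.
Proof.
split; [split | exact: bandX_mul_f |].
- move=> v w; rewrite /= !bandE_coord mul_coord_mx; apply/matrixP => i j.
  case: eqP => [->|ne]; rewrite !mxE /=; first by rewrite andbb.
  case: eqP => //= _; case: eqP => // -> /=; by case: eqP => // /ne.
- apply/matrixP => i j; rewrite summxE !mxE (bigD1 (s (st i))) //= big1 ?addr0 => [|v vi].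
    by rewrite mxE eqxx andbT.
  by rewrite mxE [s _ == _]eq_sym (negPf vi) andbF.
- exact: bandX_cut.
move=> a /=; apply/row_matrixP => i; rewrite row0.
case: (eqVneq (s (st i)) (s a)) => [sa|ne].
  have [c -> cP] := band_path (N a).-1 sa.
  case: (eqVneq c 0) => [->|/cP[bk _]]; first by rewrite scale0r.
  by have [k kN] := orun sa; rewrite bk.
have gen l (M : 'M[K]_n) : row i M = 0 -> row i (foldl mulmx M l) = 0.
  elim: l M => //= X l IH M M0; apply: IH; by rewrite row_mul M0 mul0mx.
by apply: gen; apply/rowP => j; rewrite !mxE (negPf ne) andbF.
Qed.
End BandModule.

(** * Growth from two interchangeable words *)

Section Growth.
Variables (K : closedFieldType) (V A : finType) (s t : A -> V) (bar f : A -> A) (N : A -> nat).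
Hypothesis barK : involutive bar.
Hypothesis bar_neq : forall a, bar a != a.
Hypothesis sE : forall a b, (s a == s b) = (b == a) || (b == bar a).
Hypothesis f3 : forall a, f (f (f a)) = a.
Hypothesis sf : forall a, s (f a) = t a.
Hypothesis Ng : forall a, N (bar (f a)) = N a.
Variable rels : seq (kq K V A).
Let P : pres K := @Pres K V A s t rels.
Hypothesis string_rels : forall d (M : rep K V A d), string_rep s t bar f N M ->
  forall r, r \in rels -> @rep_eval K P K id d M r = 0.

Definition is_band n (st : 'I_n -> A) (bt : 'I_n -> bool) : Prop :=
  [/\ band_walk bar f st bt, band_primitive st bt & band_runs f N st bt].

Lemma band_module n st bt lam : @is_band n st bt ->
  @is_module K P K id n (band_rep s st bt lam).
Proof.
case=> W _ R; have H := band_string_rep barK bar_neq sE f3 sf Ng W R lam.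
have Hr := string_rels H; case: H => -[h1 h2 h3] _ _.
by split.
Qed.

Lemma band_indecomposable n st bt lam : (0 < n)%N -> @is_band n st bt -> lam != 0 ->
  @indecomposable K P n (band_rep s st bt lam).
Proof.
move=> n0 [W pr R] lam0; split=> // Q QE QX QQ.
exact: (band_endo barK bar_neq sE f3 W pr lam0 QE QX QQ).
Qed.

Lemma band_common_iso n st bt lam lam' (M : rep K V A n) : (0 < n)%N -> @is_band n st bt ->
  lam != 0 -> lam' != 0 ->
  @mod_iso K P n (band_rep s st bt lam) M -> @mod_iso K P n (band_rep s st bt lam') M -> lam = lam'.
Proof.
move=> n0 [W pr R] l0 l'0 [Q [Qu QE QX]] [Q' [Qu' QE' QX']].
have conj (B B' C : 'M[K]_n) : B *m Q = Q *m C -> B' *m Q' = Q' *m C ->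
    B *m (Q *m invmx Q') = (Q *m invmx Q') *m B'.
  move=> e1 e2; rewrite mulmxA e1 -!mulmxA; congr (_ *m _).
  by rewrite -[RHS](mulmxK Qu') -(mulmxA _ B') e2 mulmxA mulVmx // mul1mx.
apply: (band_iso barK bar_neq sE f3 W n0 pr l0 l'0 (Q := Q *m invmx Q')).
- by move=> v; apply: conj (QE v) (QE' v).
- by move=> a; apply: conj (QX a) (QX' a).
by rewrite unitmx_mul Qu unitmx_inv.
Qed.

Definition band_count n (st : 'I_n -> A) bt a0 w := #|walk_set s bar f st bt w a0|.

(* Each one-parameter family has only one generic value of the invariant, while a band
   contributes infinitely many isoclasses with the same value. *)
Lemma band_count_families n k r (F : 'I_k -> rep {poly K} V A n) (E : 'I_r -> rep K V A n) a0 L :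
  (0 < n)%N ->
  (forall M : rep K V A n, @is_module K P K id n M -> @indecomposable K P n M ->
            (exists j, @mod_iso K P n M (E j)) \/
            (exists i (lam : K), @mod_iso K P n M (@specialize K P n (F i) lam))) ->
  exists inv : 'I_k -> L.-tuple bool -> nat,
    forall st bt, @is_band n st bt -> exists i, forall w : L.-tuple bool, band_count st bt a0 w = inv i w.
Proof.
move=> n0 cover.
pose dimF i mu w := walk_dim s bar f (rE (@specialize K P n (F i) mu)) (rX (@specialize K P n (F i) mu)) w a0.
have gen i : exists (inv : L.-tuple bool -> nat), exists2 D : {poly K}, D != 0 &
    forall mu, D.[mu] != 0 -> forall w : L.-tuple bool, dimF i mu w = inv w.
  have /fin_all_exists [inv H] (w : L.-tuple bool) :=
    walk_dim_generic s bar f (rE (F i)) (rX (F i)) w a0.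
  have /fin_all_exists [D DP] := H.
  (* There are finitely many words of length [L], so one polynomial serves for all of them. *)
  exists inv; exists (\prod_w D w); first by apply/prodf_neq0 => w _; have [] := DP w.
  move=> mu; rewrite horner_prod => /prodf_neq0 D0 w.
  by have [_] := DP w; apply; apply: D0.
have /fin_all_exists [inv invP] := gen; have /fin_all_exists2 [D D0 DP] := invP.
exists inv => st bt bnd.
pose M lam : rep K V A n := band_rep s st bt lam.
have [l1 l1P] : exists ls : seq K, forall (j : 'I_r) lam,
    (lam != 0 /\ @mod_iso K P n (M lam) (E j)) -> lam \in ls.
  apply: (@subsingletons_finite _ _ (fun j lam => lam != 0 /\ @mod_iso K P n (M lam) (E j))).
  by move=> j lam lam' [l0 h] [l0' h']; apply: band_common_iso bnd l0 l0' h h'.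
have root_list i : exists rs : seq K, forall mu, (D i).[mu] = 0 -> mu \in rs.
  have [rs E'] := closed_field_poly_normal (D i).
  exists rs => mu /rootP; rewrite E' rootZ ?lead_coef_eq0 // root_prod_XsubC.
  by [].
have /fin_all_exists [rs rsP] := root_list.
have bad i : exists ls : seq K, forall (j : 'I_(size (rs i))) lam,
    (lam != 0 /\ @mod_iso K P n (M lam) (@specialize K P n (F i) (nth 0 (rs i) j))) -> lam \in ls.
  apply: (@subsingletons_finite _ _ (fun (j : 'I_(size (rs i))) lam =>
    lam != 0 /\ @mod_iso K P n (M lam) (@specialize K P n (F i) (nth 0 (rs i) j)))).
  by move=> j lam lam' [l0 h] [l0' h']; apply: band_common_iso bnd l0 l0' h h'.
have /fin_all_exists [l2 l2P] := bad.
(* The parameter avoids 0, the finitely many exceptional modules [E j] and the non-generic members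
   of the families; the band module must then be a generic member of some family. *)
have [lam] := closed_field_infinite (0 :: l1 ++ flatten [seq l2 i | i <- enum 'I_k]).
rewrite inE mem_cat !negb_or => /and3P[lam0 nl1 nl2].
case: (cover (M lam) (band_module lam bnd) (band_indecomposable n0 bnd lam0)).
  by case=> j iso; case/negP: nl1; apply: (l1P j).
case=> i [mu iso]; exists i => w.
have Dmu : (D i).[mu] != 0.
  apply/negP => /eqP/rsP mur; case/negP: nl2; apply/flatten_mapP; exists i; first by rewrite mem_enum.
  have lt : (index mu (rs i) < size (rs i))%N by rewrite index_mem.
  by apply: (l2P i (Ordinal lt)); rewrite /= nth_index.
rewrite -(DP i mu Dmu w) /dimF.
case: iso => Q [Qu QE QX]; rewrite -(walk_dim_iso _ _ _ _ _ Qu QE QX).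
case: bnd => W _ _.
by rewrite /band_count -(@walk_dim_band K V A s bar f barK bar_neq sE f3 n st bt W lam lam0).
Qed.

(** The number of positions whose word is exactly [w] is the count at [w] minus the count at its
    lexicographic predecessor (for the least word, the count itself). Equal counts thus mean that
    the same words occur. *)
Lemma band_count_occurs n n' (st : 'I_n -> A) bt (st' : 'I_n' -> A) bt' a0 L w i :
  is_band st bt -> is_band st' bt' ->
  (forall w, size w = L -> band_count st bt a0 w = band_count st' bt' a0 w) ->
  s (st i) = s a0 -> word bt L (orient st a0 i) = w ->
  exists2 i', s (st' i') = s a0 & word bt' L (orient st' a0 i') = w.
Proof.
move=> [W _ _] [W' _ _] eqc si wi.
have szw : size w = L by rewrite -wi size_word.
apply: NNPP => no.
have setE := walk_setE barK bar_neq sE f3 W; have setE' := walk_setE barK bar_neq sE f3 W'.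
have no' i' : s (st' i') = s a0 -> wval (word bt' L (orient st' a0 i')) != wval w.
  move=> si'; apply/negP => /eqP e; case: no; exists i' => //.
  by apply: wval_inj; rewrite ?size_word.
have memi : walk_set s bar f st bt w a0 i by rewrite setE si eqxx szw wi leqnn.
have [z|pos] := posnP (wval w).
  have := eqc w szw; rewrite /band_count [RHS]eq_card0 => [e0|i'].
    by have := card0_eq e0 i; rewrite -topredE /= memi.
  rewrite -topredE /= setE' szw z leqn0; case: eqP => //= si'.
  by rewrite -z (negPf (no' i' si')).
have [|w1 sz1 v1] := @wval_surj L (wval w).-1.
  by have := wval_lt w; rewrite szw; lia.
have lt : (band_count st bt a0 w1 < band_count st bt a0 w)%N.
  apply: proper_card; apply/properP; split.
    apply/subsetP => j; rewrite -!topredE /= !setE szw sz1 v1 => /andP[-> /=]; lia.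
  exists i; rewrite -topredE //= setE si eqxx sz1 wi v1; lia.
have eq' : band_count st' bt' a0 w1 = band_count st' bt' a0 w.
  apply: eq_card => j; rewrite -!topredE /= !setE' szw sz1 v1.
  by case: eqP => //= /no'; lia.
by move: lt; rewrite !eqc // eq' ltnn.
Qed.

(** * Bands from code words *)

Section Words.
Variables (a0 : A) (U U' : seq bool) (l : nat).
Hypotheses (szU : size U = l) (szU' : size U' = l) (UU' : U != U') (l0 : (0 < l)%N).
Local Notation run := (foldl (fun a b => step bar f b a)).
Hypothesis clU : run a0 U = a0.
Hypothesis clU' : run a0 U' = a0.
Definition code (c : seq bool) : seq bool := flatten [seq if b then U else U' | b <- c].
Hypothesis runs_code : forall c j b, (j < size (code c))%N -> exists2 k,
   (k < (run_bound f N b (run a0 (take j (code c)))).-1)%N &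
   nth false (code c) ((j + k) %% size (code c)) = ~~ b.

Lemma size_code c : size (code c) = (size c * l)%N.
Proof.
by rewrite /code size_flatten /shape -map_comp; elim: c => //= b c ->; case: b; rewrite ?szU ?szU' mulSn.
Qed.

Lemma run_code c : run a0 (code c) = a0.
Proof.
rewrite /code; elim: c => //= b c IH; rewrite foldl_cat.
by case: b; rewrite ?clU ?clU' IH.
Qed.

Lemma code_inj c c' : size c = size c' -> code c = code c' -> c = c'.
Proof.
elim: c c' => [|b c IH] [|b' c'] //= [sz] /eqP; rewrite /code /= eqseq_cat; last first.
  by case: b b' => [] []; rewrite ?szU ?szU'.
case/andP => e /eqP /(IH _ sz) ->; congr (_ :: _).
by case: b b' e => [] [] //; rewrite 1?[U' == _]eq_sym (negPf UU').
Qed.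

Section OneWord.
Variable c : seq bool.
Hypothesis c0 : (0 < size c)%N.
Let d := size (code c).
Let d0 : (0 < d)%N. Proof. by rewrite /d size_code muln_gt0 c0. Qed.
(** The code word is continued periodically, and the band is cut at the least period of the pairs of
    state and letter. It is then primitive even if the word is a proper power. *)
Definition wstate k := run a0 (take (k %% size (code c)) (code c)).
Definition wbit k := nth false (code c) (k %% size (code c)).

Lemma wstateS k : wstate k.+1 = step bar f (wbit k) (wstate k).
Proof.
rewrite /wstate /wbit; have kd : (k %% d < d)%N by rewrite ltn_mod.
have -> : step bar f (nth false (code c) (k %% d)) (run a0 (take (k %% d) (code c))) =
          run a0 (take (k %% d).+1 (code c)).
  by rewrite (take_nth false) // -cats1 foldl_cat.
rewrite -addn1 -modnDml addn1 -/d; move: kd; rewrite leq_eqVlt => /orP[/eqP e|kd].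
  by rewrite e modnn take0 take_size run_code.
by rewrite modn_small.
Qed.

Definition wperiod p := (0 < p)%N &&
  [forall k : 'I_d, (wstate (k + p) == wstate k) && (wbit (k + p) == wbit k)].

Lemma wperiodP p : wperiod p -> forall k, wstate (k + p) = wstate k /\ wbit (k + p) = wbit k.
Proof.
case/andP => _ /forallP H k.
have kd : (k %% d < d)%N by rewrite ltn_mod.
have /andP[/eqP e1 /eqP e2] := H (Ordinal kd).
by move: e1 e2; rewrite /wstate /wbit /= -/d modnDml modn_mod => -> ->.
Qed.

Lemma wperiod_ex : exists p, wperiod p.
Proof.
exists d; rewrite /wperiod d0; apply/forallP => k.
by rewrite /wstate /wbit -/d modnDr !eqxx.
Qed.

Definition wper := ex_minn wperiod_ex.

Lemma wperP : wperiod wper. Proof. by rewrite /wper; case: ex_minnP. Qed.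
Lemma wper_min p : wperiod p -> (wper <= p)%N.
Proof. by rewrite /wper; case: ex_minnP => m _ H /H. Qed.
Lemma wper_gt0 : (0 < wper)%N. Proof. by case/andP: wperP. Qed.
Lemma wper_le : (wper <= d)%N.
Proof.
apply: wper_min; rewrite /wperiod d0; apply/forallP => k.
by rewrite /wstate /wbit -/d modnDr !eqxx.
Qed.

Lemma wper_mod k : wstate (k %% wper) = wstate k /\ wbit (k %% wper) = wbit k.
Proof.
rewrite {2 4}(divn_eq k wper); elim: (k %/ wper)%N => [|q [-> ->]]; first by rewrite mul0n.
rewrite mulSn [(wper + _)%N]addnC addnAC.
by have [-> ->] := wperiodP wperP (q * wper + k %% wper)%N.
Qed.

Definition bst (j : 'I_wper) := wstate j.
Definition bbt (j : 'I_wper) := wbit j.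

Lemma bst_iter k j : bst (iter k (@ordS wper) j) = wstate (j + k).
Proof. by rewrite /bst val_iter_ordS (wper_mod _).1. Qed.
Lemma bbt_iter k j : bbt (iter k (@ordS wper) j) = wbit (j + k).
Proof. by rewrite /bbt val_iter_ordS (wper_mod _).2. Qed.

Lemma code_is_band : is_band bst bbt.
Proof.
split.
- by move=> j; rewrite (bst_iter 1) addn1 wstateS.
- move=> i j H; apply: val_inj.
  wlog le : i j H / (i <= j)%N.
    by move=> hw; case/orP: (leq_total i j) => /hw; [| move=> /(_ _)/esym]; apply => // k; have [] := H k.
  apply/eqP; rewrite eqn_leq le leqNgt; apply/negP => lt.
  (* Shifting by [wper - i] carries the agreement at [i] and [j] to the positions [0] and [j - i],
     up to the period. *)
  have : wperiod (j - i).
    rewrite /wperiod subn_gt0 lt; apply/forallP => k.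
    have [e1 e2] := H (k + (wper - i))%N.
    move: e1 e2; rewrite !bst_iter !bbt_iter.
    have -> : (i + (k + (wper - i)) = k + wper)%N by have := ltn_ord i; lia.
    have -> : (j + (k + (wper - i)) = k + (j - i) + wper)%N by have := ltn_ord i; lia.
    by rewrite !(proj1 (wperiodP wperP _)) !(proj2 (wperiodP wperP _)) => -> ->; rewrite !eqxx.
  by move/wper_min; have := ltn_ord j; lia.
move=> j b; have [|k kb e] := @runs_code c j b; first exact: leq_trans (ltn_ord j) wper_le.
exists k; last by rewrite bbt_iter.
have jd : (j < d)%N by apply: leq_trans (ltn_ord j) wper_le.
by rewrite /bst /wstate -/d modn_small.
Qed.

(** The band may be shorter than the code word; reading [d] letters from position [0] winds around
    it and gives back the whole word. *)
Lemma word_code : word bbt d (orient bst a0 (Ordinal wper_gt0)) = code c.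
Proof.
have -> : orient bst a0 (Ordinal wper_gt0) = (true, Ordinal wper_gt0).
  by rewrite /orient /bst /wstate mod0n take0 /= eqxx.
apply: (@eq_from_nth _ false) => [|k]; rewrite size_word // => kd.
by rewrite word_nth // iter_onext /obit /= bbt_iter add0n /wbit modn_small.
Qed.
End OneWord.

(** The $2^n$ codes have bands with at most $d=nl$ positions. Bands with $q$ positions show at most
    $q^m\le d^m$ invariants, one for each family; bands with the same invariant contain the same
    words of length $d$, and a band has at most $2d$ of them, one for each oriented position. So
    $2^n\le(d+1)d^m\cdot 2d$, against the choice of $n$. *)
Theorem codes_not_poly_growth : ~ poly_growth P.
Proof.
case=> m pg.
(* As $(d+1)\cdot 2d\le 4d^2$, the bound to be exceeded is $4(nl)^{m+2}$. *)
have [n n0 bound] := expn_beats_poly (4 * l ^ m.+2) m.+2.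
pose d := (n * l)%N; have d0 : (0 < d)%N by rewrite muln_gt0 n0.
have posc (c : n.-tuple bool) : (0 < size c)%N by rewrite size_tuple.
have szc (c : n.-tuple bool) : size (code c) = d by rewrite size_code size_tuple.
pose p (c : n.-tuple bool) := wper (posc c).
pose st (c : n.-tuple bool) := @bst c (posc c); pose bt (c : n.-tuple bool) := @bbt c (posc c).
have bnd c : is_band (st c) (bt c) by apply: code_is_band.
have p_le c : (p c <= d)%N by rewrite -(szc c); apply: wper_le.
have p_gt0 c : (0 < p c)%N by apply: wper_gt0.
pose inv c : {ffun d.-tuple bool -> 'I_d.+1} := [ffun w : d.-tuple bool => inord (band_count (st c) (bt c) a0 w)].
have invE c (w : d.-tuple bool) : (inv c w : nat) = band_count (st c) (bt c) a0 w.
  rewrite ffunE inordK // ltnS; apply: leq_trans (p_le c).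
  by rewrite -[X in (_ <= X)%N]card_ord; apply: max_card.
pose S q := [set inv c | c : n.-tuple bool & p c == q].
have cardS q : (#|S q| <= d ^ m)%N.
  have [q0|q0] := leqP q 0.
    rewrite (_ : S q = set0) ?cards0 //; apply/setP => x; rewrite inE.
    apply/negbTE/imsetP => -[c]; rewrite inE => /eqP e _.
    by have := p_gt0 c; rewrite e ltnNge q0.
  case: (leqP q d) => [qd|dq]; last first.
    rewrite (_ : S q = set0) ?cards0 //; apply/setP => x; rewrite inE.
    apply/negbTE/imsetP => -[c]; rewrite inE => /eqP e _.
    by have := p_le c; rewrite e leqNgt dq.
  have [k [r [F [E [kq _ _ cover]]]]] := pg q q0.
  have [iv ivP] := band_count_families a0 d q0 cover.
  have H q' (st' : 'I_q' -> A) bt' : q' = q -> is_band st' bt' ->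
      exists i, forall w : d.-tuple bool, band_count st' bt' a0 w = iv i w.
    by move=> e; move: st' bt'; rewrite e => st' bt' /ivP.
  apply: (@leq_trans k); last by apply: leq_trans kq _; case: (m) => // m1; rewrite leq_exp2r.
  rewrite -[X in (_ <= X)%N]card_ord.
  apply: leq_trans (leq_imset_card (fun i : 'I_k => [ffun w : d.-tuple bool => inord (iv i w) : 'I_d.+1]) predT).
  apply: subset_leq_card; apply/subsetP => x /imsetP[c]; rewrite inE => /eqP e ->.
  have [i iP] := H _ _ _ e (bnd c).
  by apply/imsetP; exists i => //; apply/ffunP => w; rewrite !ffunE iP.
pose key c : 'I_d.+1 * {ffun d.-tuple bool -> 'I_d.+1} := (inord (p c), inv c).
have fibre c1 : (#|[set c | key c == key c1]| <= 2 * d)%N.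
  pose ws := [seq word (bt c1) d o | o <- enum {: bool * 'I_(p c1)}].
  apply: (@leq_trans (size ws)); last first.
    by rewrite size_map -cardE card_prod card_bool card_ord leq_mul2l p_le.
  rewrite cardE -(size_map (fun c : n.-tuple bool => code c)); apply: uniq_leq_size.
    rewrite map_inj_uniq ?enum_uniq // => c c' e; apply: val_inj.
    by apply: code_inj e; rewrite !size_tuple.
  move=> w /mapP[c]; rewrite mem_enum inE => /eqP[_ /ffunP ei] ->.
  have eqc w' : size w' = d -> band_count (st c) (bt c) a0 w' = band_count (st c1) (bt c1) a0 w'.
    by move=> /eqP szw'; have := congr1 (@nat_of_ord _) (ei (Tuple szw')); rewrite !invE.
  have wc := word_code (posc c); rewrite szc in wc.
  have [|i' _ <-] := band_count_occurs (bnd c) (bnd c1) eqc _ wc.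
    by rewrite /st /bst /wstate mod0n take0.
  by apply: map_f; rewrite mem_enum.
have cardk : (#|key @: [set: n.-tuple bool]| <= d.+1 * d ^ m)%N.
  rewrite -sum1_card (partition_big fst predT) //=.
  apply: leq_trans (_ : \sum_(q : 'I_d.+1) d ^ m <= _)%N; last by rewrite sum_nat_const card_ord.
  apply: leq_sum => q _; rewrite sum1_card.
  apply: leq_trans (cardS q); apply: leq_trans (leq_imset_card (fun x => (q, x)) (S q)).
  apply: subset_leq_card; apply/subsetP => x /andP[/imsetP[c _ ->]] /= /eqP <-.
  by apply/imsetP; exists (inv c) => //; apply/imsetP; exists c; rewrite ?inE ?inordK ?ltnS.
have : (2 ^ n <= d.+1 * d ^ m * (2 * d))%N.
  have -> : (2 ^ n = #|{: n.-tuple bool}|)%N by rewrite card_tuple card_bool.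
  rewrite -sum1_card (partition_big key (mem (key @: [set: n.-tuple bool]))) => [|c _]; last first.
    by apply: imset_f; rewrite inE.
  apply: leq_trans (_ : \sum_(k in key @: [set: n.-tuple bool]) (2 * d) <= _)%N.
    apply: leq_sum => k /imsetP[c1 _ ->]; rewrite sum1_card.
    by apply: leq_trans (fibre c1); apply: subset_leq_card; apply/subsetP => c; rewrite inE.
  by rewrite sum_nat_const leq_mul2r cardk orbT.
apply/negP; rewrite -ltnNge; apply: leq_ltn_trans bound.
rewrite -[(4 * _ * _)%N]mulnA -expnMn [(l * n)%N]mulnC -/d !expnS.
by rewrite !mulnA; move: (d ^ m)%N => x; nia.
Qed.
End Words.
End Growth.

(** * Walks with bounded runs *)

Local Close Scope ring_scope.

Lemma iter_cycle (T : finType) (h : T -> T) x : injective h -> exists k, iter k h (h x) = x.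
Proof.
move=> hi; exists (order h x).-1; rewrite -iterSr prednK ?order_gt0 //.
exact: iter_order.
Qed.

Section Runs.
Variables (A : finType) (bar f : A -> A) (N : A -> nat).
Hypothesis barK : involutive bar.
Hypothesis f3 : forall a, f (f (f a)) = a.
Hypothesis Ng : forall a, N (bar (f a)) = N a.
Hypothesis N2 : forall a, 1 < N a.

Local Notation stp := (step bar f).
Local Notation bound := (run_bound f N).
Local Notation run := (foldl (fun a b => stp b a)).

(* A walk is given by the lengths of its maximal runs of equal letters. *)
Fixpoint runs_ok (a : A) (b : bool) (ks : seq nat) : bool :=
  if ks is k :: ks' then
    [&& 0 < k, k.+1 < bound b a & runs_ok (iter k (stp b) a) (~~ b) ks']
  else true.
Fixpoint runs_end (a : A) (b : bool) (ks : seq nat) : A * bool :=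
  if ks is k :: ks' then runs_end (iter k (stp b) a) (~~ b) ks' else (a, b).
Fixpoint expand (b : bool) (ks : seq nat) : seq bool :=
  if ks is k :: ks' then nseq k b ++ expand (~~ b) ks' else [::].

Lemma runs_ok_cat a b ks ks' : runs_ok a b (ks ++ ks') =
  runs_ok a b ks && runs_ok (runs_end a b ks).1 (runs_end a b ks).2 ks'.
Proof. by elim: ks a b => //= k ks IH a b; rewrite IH !andbA. Qed.

Lemma runs_end_cat a b ks ks' : runs_end a b (ks ++ ks') =
  runs_end (runs_end a b ks).1 (runs_end a b ks).2 ks'.
Proof. by elim: ks a b => //= k ks IH a b; rewrite IH. Qed.

Lemma expand_cat a b ks ks' :
  expand b (ks ++ ks') = expand b ks ++ expand (runs_end a b ks).2 ks'.
Proof. by elim: ks a b => //= k ks IH a b; rewrite (IH (iter k (stp b) a)) catA. Qed.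

Lemma run_nseq k b a : run a (nseq k b) = iter k (stp b) a.
Proof. by elim: k a => //= k IH a; rewrite IH -iterSr. Qed.

Lemma run_expand a b ks : run a (expand b ks) = (runs_end a b ks).1.
Proof. by elim: ks a b => //= k ks IH a b; rewrite foldl_cat run_nseq IH. Qed.

Lemma bound_step b a : bound b (stp b a) = bound b a.
Proof.
case: b; rewrite /run_bound /step ?Ng //.
by rewrite -Ng f3 barK.
Qed.

Lemma bound_iter k b a : bound b (iter k (stp b) a) = bound b a.
Proof. by elim: k => //= k IH; rewrite bound_step. Qed.

Lemma run_bounded a b ks k' ks' j b' : runs_ok a b (ks ++ k' :: ks') -> j < size (expand b ks) ->
  exists2 t, t < (bound b' (run a (take j (expand b (ks ++ k' :: ks'))))).-1 &
    j + t < size (expand b (ks ++ k' :: ks')) /\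
    nth false (expand b (ks ++ k' :: ks')) (j + t) = ~~ b'.
Proof.
elim: ks a b j => //= k ks IH a b j /and3P[k0 kb ok]; rewrite size_cat size_nseq => jlt.
have [jk|kj] := ltnP j k.
  have hd : exists k1 l, ks ++ k' :: ks' = k1.+1 :: l.
    case: (ks) ok => [|[|k1] l] //=; last by move=> _; exists k1, (l ++ k' :: ks').
    by case: (k') => // k1 _; exists k1, ks'.
  case: (eqVneq b' b) => [->|].
    exists (k - j).
      rewrite take_cat size_nseq jk take_nseq ?run_nseq ?bound_iter; last exact: ltnW.
      by move: kb; lia.
    rewrite (subnKC (ltnW jk)) size_cat size_nseq nth_cat size_nseq ltnn subnn.
    by have [k1 [l ->]] := hd; rewrite /= addnS; split => //; lia.
  move=> nb; exists 0; rewrite ?addn0.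
    rewrite /run_bound; case: ifP => _; by rewrite -ltnS prednK // ltnW // N2.
  rewrite size_cat size_nseq nth_cat size_nseq jk nth_nseq jk; split; first by lia.
  by move: nb; clear; case: b b' => [] [].
have [|t tb [ts tn]] := IH (iter k (stp b) a) (~~ b) (j - k) ok; first by lia.
exists t; first by rewrite take_cat size_nseq [j < k]ltnNge kj foldl_cat run_nseq.
have ejt : j + t = k + (j - k + t) by lia.
rewrite size_cat size_nseq nth_cat size_nseq ejt ltn_add2l; split=> //.
by rewrite ltnNge leq_addr /= addKn.
Qed.

(** The Boolean is the letter of the next run. Walks are joined where the letter changes, so
    concatenation never merges two runs into a longer one. *)
Definition reach (x y : A * bool) : Prop :=
  exists2 ks, runs_ok x.1 x.2 ks & runs_end x.1 x.2 ks = y.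

Lemma reach_refl x : reach x x.
Proof. by exists [::]; case: x. Qed.

Lemma reach_trans y x z : reach x y -> reach y z -> reach x z.
Proof.
by move=> [ks ok e] [ks' ok' e']; exists (ks ++ ks'); rewrite ?runs_ok_cat ?runs_end_cat ?ok e.
Qed.

Lemma reach_run k a b : 0 < k -> k.+1 < bound b a -> reach (a, b) (iter k (stp b) a, ~~ b).
Proof. by move=> k0 kb; exists [:: k]; rewrite //= k0 kb. Qed.

(** The two runs open two closed walks at [a]. Their products in the two orders are different words
    of equal length, which are the two code letters. *)
Definition branching : Prop := exists a k1 k2,
  [/\ k1 < k2, 0 < k1, k2.+1 < N a,
      reach (iter k1 (stp true) a, false) (a, true) &
      reach (iter k2 (stp true) a, false) (a, true)].

Lemma branching_codes : branching -> exists (a : A) (U U' : seq bool),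
  [/\ size U = size U', U != U', 0 < size U, run a U = a /\ run a U' = a &
   forall c j b, j < size (code U U' c) -> exists2 k,
   k < (bound b (run a (take j (code U U' c)))).-1 &
   nth false (code U U' c) ((j + k) %% size (code U U' c)) = ~~ b].
Proof.
case=> a [k1 [k2 [k12 k10 k2N [ks1 ok1 e1] [ks2 ok2 e2]]]] /=.
pose l1 := k1 :: ks1; pose l2 := k2 :: ks2.
have okl1 : runs_ok a true l1 /\ runs_end a true l1 = (a, true).
  by rewrite /= k10 ok1 e1 andbT /run_bound; split=> //; lia.
have okl2 : runs_ok a true l2 /\ runs_end a true l2 = (a, true).
  by rewrite /= ok2 e2 andbT /run_bound; split=> //; lia.
have cl l l' : runs_ok a true l /\ runs_end a true l = (a, true) ->
    runs_ok a true l' /\ runs_end a true l' = (a, true) ->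
    runs_ok a true (l ++ l') /\ runs_end a true (l ++ l') = (a, true).
  by move=> [o e] [o' e']; rewrite runs_ok_cat runs_end_cat o e.
have cl12 := cl _ _ okl1 okl2; have cl21 := cl _ _ okl2 okl1.
have codeE c : exists2 l, code (expand true (l1 ++ l2)) (expand true (l2 ++ l1)) c = expand true l &
     runs_ok a true l /\ runs_end a true l = (a, true).
  elim: c => [|b c [l e ol]]; first by exists [::].
  exists ((if b then l1 ++ l2 else l2 ++ l1) ++ l).
    rewrite /code /= in e *; rewrite e; case: b.
      by rewrite (expand_cat a _ (l1 ++ l2)) cl12.2.
    by rewrite (expand_cat a _ (l2 ++ l1)) cl21.2.
  by case: b; apply: cl.
exists a, (expand true (l1 ++ l2)), (expand true (l2 ++ l1)).
have sz : size (expand true (l1 ++ l2)) = size (expand true (l2 ++ l1)).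
  by rewrite !(expand_cat a) okl1.2 okl2.2 !size_cat addnC.
split=> //.
(* At position [k1] one product has turned backward while the other is still in its first run, of
   length [k2]. The walk after [k1] is not empty, because it has to change the direction once
   more. *)
- apply/negP => /eqP /(congr1 (fun w => nth false w k1)) /=.
  have: ks1 <> [::] by move=> e; move: e1; rewrite e.
  case: ks1 ok1 {e1 okl1 cl12 cl21 codeE sz} @l1 => // k3 ks1 /= /andP[k30 _] _.
  rewrite nth_cat size_nseq ltnn subnn; case: k3 k30 => //= k3 _.
  by rewrite nth_cat size_nseq k12 nth_nseq k12.
- by rewrite /= size_cat size_nseq ltn_addr.
- by rewrite !run_expand cl12.2 cl21.2.
move=> c j b; have [l -> [okl el]] := codeE c => jl.
case: l okl el jl => // k0 l okl el jl.
(* The word is taken twice, so that its last run is followed by its first; positions in the second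
   copy are reduced modulo the length. *)
have okll := cl _ _ (conj okl el) (conj okl el).
have [] := @run_bounded a true (k0 :: l) k0 l j b okll.1 jl.
rewrite (expand_cat a true (k0 :: l)) el; set w := expand _ _ => t tb [ts tn].
exists t; first by move: tb; rewrite take_cat jl.
rewrite -tn nth_cat; case: ltnP => h; first by rewrite modn_small.
by rewrite -{1}(subnK h) modnDr modn_small //; move: ts; rewrite size_cat; lia.
Qed.
End Runs.

Local Open Scope ring_scope.

(** * Branching in the arrow automaton *)

Local Close Scope ring_scope.

Section Surface.
Variables (A : finType) (bar f : A -> A) (N : A -> nat).
Hypothesis barK : involutive bar.
Hypothesis bar_neq : forall a, bar a != a.
Hypothesis f3 : forall a, f (f (f a)) = a.
Local Notation g := (fun a => bar (f a)).
Local Notation q := (fun a => bar (f (f a))).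
Hypothesis Ng : forall a, N (bar (f a)) = N a.
Hypothesis N2 : forall a, 1 < N a.
Hypothesis Nord : forall a, order (fun a => bar (f a)) a %| N a.
Hypothesis Nvir3 : forall a, N a = 2 -> 2 < N (bar a).
Hypothesis Nvir4 : forall a, N a = 2 -> bar (f a) = a -> 3 < N (bar a).

Local Notation stp := (step bar f).
Local Notation bound := (run_bound f N).
Local Notation reachR := (reach bar f N).

Definition vir a := N a == 2.
(** At a vertex with a virtual arrow no walk changes direction: one of the two adjoining runs would
    use that arrow's orbit, and [N = 2] admits no run at all. Directions change at good states
    only. *)
Definition good a := ~~ vir a && ~~ vir (bar a).
(** From a good [a], the first good state in forward direction: one step of [g], or two if the
    virtual arrow [f a] starts at the vertex in between. [len] counts the letters. *)
Definition gnext a := if vir (f a) then bar (f (bar (f a))) else bar (f a).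
Definition gprev a := bar (if vir (bar (f (f (bar a)))) then bar (f (f (bar (f (f (bar a)))))) else bar (f (f (bar a)))).
Definition len a := (vir (f a)).+1.

Lemma f_injective : injective f. Proof. by move=> a b e; rewrite -(f3 a) e f3. Qed.
Lemma g_injective : injective g.
Proof. by move=> a b /(inv_inj barK) /f_injective. Qed.

Lemma N_ff a : N (f (f a)) = N (bar a).
Proof. by rewrite -Ng f3. Qed.
Lemma vir_ff a : vir (f (f a)) = vir (bar a). Proof. by rewrite /vir N_ff. Qed.
Lemma vir_g a : vir (bar (f a)) = vir a. Proof. by rewrite /vir Ng. Qed.
Lemma bound_false a : bound false a = N (bar a). Proof. by rewrite /run_bound N_ff. Qed.

Lemma iter_g_order a : iter (N a) g a = a.
Proof.
have /dvdnP[m ->] := Nord a.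
by elim: m => // m IH; rewrite mulSn iterD IH iter_order //; apply: g_injective.
Qed.

Lemma vir_bar a : vir a -> ~~ vir (bar a).
Proof. by move/eqP/Nvir3; rewrite /vir; apply: contraL => /eqP->. Qed.

Lemma vir_f a : vir a -> ~~ vir (f a).
Proof. by rewrite -vir_g => /vir_bar; rewrite barK. Qed.

Lemma good_bar a : good (bar a) = good a.
Proof. by rewrite /good barK andbC. Qed.

Lemma good_N a : good a -> 2 < N a.
Proof. by case/andP => v _; have := N2 a; rewrite /vir in v; lia. Qed.

Lemma vir_fg a : vir (f a) -> vir (f (f (bar (f a)))).
Proof. by rewrite vir_ff barK. Qed.

Lemma vir_fg1 a : vir (f a) -> ~~ vir (f (bar (f a))).
Proof.
by move/vir_fg => v; apply/negP => /vir_f; rewrite v.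
Qed.

Lemma good_gnext a : good a -> good (gnext a).
Proof.
rewrite /good /gnext => /andP[va vba]; case: ifP => v; rewrite !vir_g va barK //=.
  exact: vir_fg1.
by rewrite v.
Qed.

Lemma gprevK a : good a -> gprev (gnext a) = a.
Proof.
move=> /andP[va vba]; rewrite /gprev /gnext; case v: (vir (f a)).
  by rewrite barK f3 barK v f3 barK.
by rewrite barK f3 (negPf vba) barK.
Qed.

Lemma gnext_inj : {in good &, injective gnext}.
Proof. by move=> a b ga gb /(congr1 gprev); rewrite !gprevK. Qed.

Lemma gnextN a : N (gnext a) = N a.
Proof. by rewrite /gnext; case: ifP; rewrite !Ng. Qed.

Lemma len_fprime a : good a -> vir (f (bar (gnext a))) = vir (f a).
Proof.
case/andP => _ vba; rewrite /gnext; case: ifP => v; rewrite barK.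
  exact: vir_fg.
by rewrite vir_ff; apply/negbTE.
Qed.

(** Extension by the identity to a permutation of all arrows, so that a power of it is its
    inverse. *)
Definition gperm a := if good a then gnext a else a.
Lemma gperm_inj : injective gperm.
Proof.
move=> a b; rewrite /gperm; case: ifP => ga; case: ifP => gb //.
- exact: gnext_inj.
- by move=> e; rewrite -e good_gnext in gb.
- by move=> e; rewrite e good_gnext in ga.
Qed.

Lemma good_iter_gnext k a : good a -> good (iter k gnext a).
Proof. by move=> ga; elim: k => //= k; apply: good_gnext. Qed.

Lemma gnext_surj a : good a -> exists2 b, good b & gnext b = a.
Proof.
move=> ga; have [k e] := iter_cycle a gperm_inj; exists (iter k gperm a).
  by elim: k {e} => //= k gk; rewrite {1}/gperm gk good_gnext.
have gk : good (iter k gperm a) by elim: k {e} => //= k gk; rewrite {1}/gperm gk good_gnext.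
by rewrite -{2}e -iterSr iterS {2}/gperm gk.
Qed.

Lemma gprevKV a : good a -> good (gprev a) /\ gnext (gprev a) = a.
Proof. by case/gnext_surj => b gb <-; rewrite gprevK. Qed.

Lemma gnext_iter_g k a : exists j, iter k gnext a = iter j g a.
Proof.
elim: k => [|k [j IH]] /=; first by exists 0.
by rewrite IH /gnext; case: ifP => _; [exists j.+2 | exists j.+1].
Qed.

(* The backward analogue of [gnext]: reversing a walk replaces the state [a] by [bar a]. *)
Definition hnext a := bar (gprev (bar a)).
Lemma good_hnext a : good a -> good (hnext a).
Proof. by move=> ga; rewrite /hnext good_bar; have [] := @gprevKV (bar a); rewrite ?good_bar. Qed.
Lemma hnextE a : hnext a = if vir (bar (f (f a))) then bar (f (f (bar (f (f a))))) else bar (f (f a)).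
Proof. by rewrite /hnext /gprev !barK. Qed.

(** The two letters from [a] to [gnext a] already form the zero path $A_a$, so this move is not
    admissible. *)
Definition broken a := [&& good a, vir (f a) & N a == 3].

Lemma reach_gnext a : good a -> ~~ broken a -> reachR (a, true) (gnext a, false).
Proof.
move=> ga nb; have Na := good_N ga.
have -> : (gnext a, false) = (iter (len a) (stp true) a, ~~ true).
  by rewrite /gnext /len; case: (vir (f a)).
apply: reach_run => //; rewrite /run_bound /len; move: nb; rewrite /broken ga /=.
by case: (vir (f a)) => //=; lia.
Qed.

Lemma reach_hnext a : good a -> ~~ broken (bar (hnext a)) -> reachR (a, false) (hnext a, true).
Proof.
move=> ga nb; have [gp ep] := @gprevKV (bar a) (etrans (good_bar a) ga).
have eN : N (bar a) = N (bar (hnext a)) by rewrite /hnext barK -[in LHS]ep gnextN.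
have Na := good_N (etrans (good_bar _) (good_hnext ga)).
have -> : (hnext a, true) = (iter (vir (bar (f (f a)))).+1 (stp false) a, ~~ false).
  by rewrite hnextE; case: (vir _).
apply: reach_run => //; rewrite bound_false eN; move: nb.
have -> : broken (bar (hnext a)) = vir (bar (f (f a))) && (N (bar (hnext a)) == 3).
  rewrite /broken good_bar good_hnext //=; congr (_ && _).
  rewrite hnextE; case: ifP => v; rewrite !barK.
    by rewrite f3 v.
  by rewrite f3; move: ga => /andP[/negbTE].
by case: (vir _) => //=; lia.
Qed.


(** The fourth iterate excludes the orders 1, 2 and 4, the third iterate excludes 3. *)
Lemma order_ge5 a : iter 4 g a != a -> iter 3 g a != a -> 4 < N a.
Proof.
move=> n4 n3; apply: leq_trans (dvdn_leq (ltnW (N2 a)) (Nord a)).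
have := iter_order g_injective a; have := order_gt0 g a.
case: (order _ a) => [|[|[|[|[|k]]]]] //= _ e; move: n4 n3; rewrite /= ?e ?eqxx //.
Qed.

(** * The surroundings of a broken state *)

Section BrokenSegment.
Variable x : A.
Hypothesis bx : broken x.
Let gx := bar (f x).
(** With $y,p,w$ for [sy], [sp], [sw], the relations near a broken $x$ give the steps $x\to
    g(x)\to\bar y\to x$ of [g], and $w\to y\to f^2(x)\to p\to\bar w$ in an orbit that turns out to
    have [N] at least five. *)
Definition sy := f (bar (f x)).
Definition sp := bar x.
Definition sw := f (bar x).

Lemma broken_eta : f sy = bar (f (f x)).
Proof.
case/and3P: bx => _ /eqP vx _; apply: g_injective; rewrite /sy f3 barK.
by have := iter_g_order (f x); rewrite vx.
Qed.

Lemma broken_fz : f (bar sy) = sp.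
Proof.
case/and3P: bx => _ _ /eqP N3; apply: (inv_inj barK); rewrite /sp barK.
by have := iter_g_order x; rewrite N3.
Qed.

Lemma broken_fw : f sw = bar sy.
Proof. by rewrite /sw -/sp -broken_fz f3. Qed.

Lemma broken_gw : bar (f sw) = sy. Proof. by rewrite broken_fw barK. Qed.
Lemma broken_ggy : bar (f (bar (f sy))) = sp.
Proof. by rewrite broken_eta barK f3. Qed.

Lemma broken_Nz : N (bar sy) = 3.
Proof. by case/and3P: bx => _ _ /eqP <-; rewrite /sy !Ng. Qed.

(** The steps from [sw] do not close after three or four. In particular [sp = sw] would give
    [sy = x] and make [f x] fixed by [g]; the condition on virtual loops then contradicts
    [N x = 3]. *)
Lemma broken_Ny : 4 < N sy.
Proof.
rewrite -broken_gw Ng; apply: order_ge5; rewrite /= broken_gw broken_ggy /sp -/sw.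
  exact: bar_neq.
apply/eqP => pw.
have zp : bar sy = sp by apply: f_injective; rewrite broken_fz /sp {1}pw.
have yx : sy = x by apply: (inv_inj barK); rewrite zp.
have := broken_eta; rewrite yx => e.
case/and3P: bx => _ /eqP vx /eqP N3.
by have := Nvir4 vx; rewrite -e => /(_ erefl); rewrite Ng N3.
Qed.

Lemma broken_Nw : N sw = N sy. Proof. by rewrite -broken_gw Ng. Qed.
Lemma broken_Np : N sp = N sy. Proof. by rewrite -broken_ggy !Ng. Qed.
Lemma broken_Nbw : N (bar sw) = N sy. Proof. by rewrite -/sw Ng broken_Np. Qed.

Lemma broken_good : [/\ good sw, good sy & good sp].
Proof.
have Ny := broken_Ny; rewrite /good /vir !broken_Nbw broken_Nw broken_Nz broken_Np.
rewrite /sp barK; case/and3P: bx => _ _ /eqP ->.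
by split; rewrite ?andbT //; lia.
Qed.

Lemma broken_gnextx : gnext x = bar sy.
Proof. by case/and3P: bx => _ v _; rewrite /gnext v. Qed.
Lemma broken_gnextw : gnext sw = sy.
Proof. by rewrite /gnext broken_fw /vir broken_Nz /= barK. Qed.
Lemma broken_gnextp : gnext sp = bar sw.
Proof. by rewrite /gnext -/sw /vir broken_Nw; have := broken_Ny; case: eqP => //= ->. Qed.
Lemma broken_hnexty : hnext sy = sp.
Proof. by rewrite /hnext -broken_gnextx gprevK //; case/and3P: bx. Qed.
Lemma broken_hnextw : hnext sw = x.
Proof. by rewrite /hnext -broken_gnextp gprevK ?barK //; have [] := broken_good. Qed.
Lemma broken_hnextz : hnext (bar sy) = bar sw.
Proof. by rewrite /hnext barK -broken_gnextw gprevK //; have [] := broken_good. Qed.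

(** Three letters forward in the long orbit lead from [sw] to [sp]; one letter back in the orbit of
    [x], which has room for just one, leads to [sy]. *)
Lemma broken_pass : reachR (sw, true) (sy, true) /\ reachR (sp, false) (sy, true).
Proof.
have Ny := broken_Ny.
have pf : reachR (sp, false) (sy, true).
  rewrite -[true]/(~~ false) (_ : sy = iter 1 (stp false) sp); last first.
    by rewrite /= /step -[f sp]/sw broken_gw.
  by apply: reach_run => //; rewrite bound_false barK; case/and3P: bx => _ _ /eqP->.
split=> //; apply: reach_trans pf.
rewrite -[false]/(~~ true) (_ : sp = iter 3 (stp true) sw); last first.
  by rewrite /= /step broken_gw broken_ggy.
by apply: reach_run => //; rewrite /run_bound broken_Nw.
Qed.

(** Three successive changes of direction from [(sw, true)] pass through [(sy, false)], where the
    next move is too long; this walk has the same end. [broken_backward] does the same for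
    [(sw, false)], whose changes pass through [(x, true)]. *)
Lemma broken_forward : reachR (sw, true) (gnext sp, false).
Proof.
apply: reach_trans (broken_pass.1) _.
rewrite broken_gnextp -[false]/(~~ true) (_ : bar sw = iter 3 (stp true) sy); last first.
  by rewrite /= /step broken_ggy.
by apply: reach_run => //; exact: broken_Ny.
Qed.

Lemma broken_backward : reachR (sw, false) (bar sw, true).
Proof.
have Ny := broken_Ny.
have hx : iter 2 (stp false) x = bar sy.
  by rewrite /= /step -broken_eta f3.
apply: (@reach_trans _ _ _ _ (bar sy, true)).
  rewrite -[true]/(~~ false) (_ : bar sy = iter 3 (stp false) sw); last first.
    rewrite iterSr; have -> : stp false sw = x by rewrite /step broken_fw broken_fz barK.
    by rewrite hx.
  by apply: reach_run => //; rewrite bound_false broken_Nbw.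
apply: (@reach_trans _ _ _ _ (x, false)).
  have -> : (x, false) = (iter 1 (stp true) (bar sy), ~~ true).
    by rewrite /= /step broken_fz barK.
  by apply: reach_run => //; rewrite /run_bound broken_Nz.
rewrite -[true]/(~~ false) (_ : bar sw = iter 3 (stp false) x); last first.
  by rewrite iterS hx /step broken_fz.
by apply: reach_run => //; rewrite bound_false -/sp broken_Np.
Qed.
End BrokenSegment.

(** * Changes of direction as permutations *)

Definition turn (z : A * bool) : A * bool :=
  if good z.1 then (if z.2 then gnext z.1 else hnext z.1, ~~ z.2) else z.

Lemma turn_good z : good (turn z).1 = good z.1.
Proof.
case: z => a b; rewrite /turn /=; case: ifP => ga //=.
by case: b; rewrite ?good_gnext ?good_hnext.
Qed.

Lemma turn_inj : injective turn.
Proof.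
move=> z z' e; have := congr1 (fun u => good u.1) e; rewrite !turn_good.
case: z z' e => a b [a' b'] /= E eg; move: E; rewrite /turn /= -eg; case: ifP => // ga E.
have ga' : good a' by rewrite -eg.
have ebb : b = b' by move/(congr1 snd): E => /= /negb_inj.
have := congr1 fst E; rewrite ebb /=; case: b' {E ebb} => e; congr (_, _); first exact: gnext_inj.
apply: (inv_inj barK).
have [[_ <-] [_ <-]] : (good (gprev (bar a)) /\ gnext (gprev (bar a)) = bar a) /\
     (good (gprev (bar a')) /\ gnext (gprev (bar a')) = bar a').
  by split; apply: gprevKV; rewrite good_bar.
by congr gnext; apply: (inv_inj barK).
Qed.

(** The states at which [turn] is not an admissible run. A backward run from [a] is the reverse of
    the forward run from [bar (hnext a)]. *)
Definition zbroken (z : A * bool) :=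
  good z.1 && (if z.2 then broken z.1 else broken (bar (hnext z.1))).

Lemma zbrokenP z : zbroken z -> exists2 x, broken x & z = (x, true) \/ z = (sy x, false).
Proof.
case: z => a [] /andP[/= ga br]; first by exists a => //; left.
exists (bar (hnext a)) => //; right; congr (_, _).
apply: (inv_inj barK); rewrite -broken_gnextx // /hnext barK.
by have [] := @gprevKV (bar a) (etrans (good_bar a) ga).
Qed.

Lemma turn_broken z : good z.1 -> zbroken (turn z) -> exists2 x, broken x &
  z.1 = sw x /\ turn z = if z.2 then (sy x, false) else (x, true).
Proof.
case: z => a b /= ga /zbrokenP[x bx e]; exists x => //.
have [gw gy gp] := broken_good bx.
suff ea : a = sw x by rewrite ea /turn /= gw; case: b {e}; rewrite ?broken_gnextw ?broken_hnextw.
case: e; rewrite /turn /= ga => -[]; case: b => //= e _.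
  apply: (inv_inj barK); rewrite -broken_gnextp //.
  have [_ <-] := @gprevKV (bar a) (etrans (good_bar a) ga); congr gnext.
  by rewrite /sp -e /hnext barK.
by apply: gnext_inj => //; rewrite broken_gnextw.
Qed.

(** Broken states and their images under [turn] are left out, and a turn onto a broken state is
    prolonged to three turns. On what remains this is again injective, and every step is an
    admissible walk. *)
Definition tgood z := [&& good z.1, ~~ zbroken z & [forall u, zbroken u ==> (turn u != z)]].
Definition tpass z :=
  if tgood z then (if zbroken (turn z) then turn (turn (turn z)) else turn z) else z.

Lemma turn3_broken z : good z.1 -> zbroken (turn z) ->
  [/\ ~~ zbroken (turn (turn z)), ~~ zbroken (turn (turn (turn z))) &
      reachR z (turn (turn (turn z)))].
Proof.
move=> gz br; have [x bx [ez et]] := turn_broken gz br.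
have [gw gy gp] := broken_good bx; have Ny := broken_Ny bx.
have gx : good x by case/and3P: bx.
have gz' : good (bar (sy x)) by rewrite good_bar.
have gw' : good (bar (sw x)) by rewrite good_bar.
have n3 a : 4 < N a -> ~~ zbroken (a, true).
  by move=> Na; rewrite /zbroken /broken /=; apply/negP => /andP[_ /and3P[_ _ /eqP e]]; rewrite e in Na.
have n5 a : a = bar (sw x) \/ a = bar (sy x) -> ~~ zbroken (a, false).
  move=> ea; apply/negP => /zbrokenP[x' bx' [//|[e]]].
  case: ea => ea; last first.
    by have := broken_Nz bx; have := broken_Ny bx'; rewrite -e ea => + e3; rewrite e3.
  have : sp x = sw x'.
    by have [? ? ?] := broken_good bx'; apply: gnext_inj => //; rewrite broken_gnextp // broken_gnextw // -ea.
  move=> epw; have := broken_Nw bx; rewrite /sw -/(sp x) epw (broken_fw bx') (broken_Nz bx').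
  by move=> e3; rewrite -e3 in Ny.
rewrite et; case: z gz br ez et => a [] /= gz br ez et; rewrite ez.
- rewrite {1 3 5}/turn /= gy /= broken_hnexty //.
  rewrite /turn /= gp broken_gnextp //; split; last 1 first.
  + by rewrite -broken_gnextp //; apply: broken_forward.
  + by apply: n3; rewrite broken_Np.
  + by apply: n5; left.
rewrite {1 3 5}/turn /= gx /= broken_gnextx //.
rewrite /turn /= gz' /= broken_hnextz //; split.
+ by apply: n5; right.
+ by apply: n3; rewrite broken_Nbw.
exact: broken_backward.
Qed.

Lemma tpass_good z : tgood z -> tgood (tpass z).
Proof.
move=> tz; rewrite /tpass tz; case/and3P: (tz) => gz nz _.
have pred u : good u.1 -> ~~ zbroken u -> ~~ zbroken (turn u) -> tgood (turn u).
  move=> gu nu nt; rewrite /tgood turn_good gu nt /=; apply/forallP => v; apply/implyP => bv.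
  by apply: contra nu => /eqP /turn_inj <-.
case: ifP => bt; last by apply: pred => //; rewrite bt.
by have [n2 n3 _] := turn3_broken gz bt; apply: pred; rewrite ?turn_good.
Qed.

Lemma tpass_inj : injective tpass.
Proof.
move=> z z' e; case tz: (tgood z); case tz': (tgood z').
- move: e; rewrite /tpass tz tz'; case: ifP => bt; case: ifP => bt'.
  + by do 3 move/turn_inj.
  + move/turn_inj => e; case/and3P: tz' => _ _ /forallP /(_ (turn z)).
    by rewrite bt e eqxx.
  + move/turn_inj => e; case/and3P: tz => _ _ /forallP /(_ (turn z')).
    by rewrite bt' -e eqxx.
  + exact: turn_inj.
- by have := tpass_good tz; rewrite e {1}/tpass tz' tz'.
- by have := tpass_good tz'; rewrite -e {1}/tpass tz tz.
by move: e; rewrite /tpass tz tz'.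
Qed.

Lemma reach_tpass z : tgood z -> reachR z (tpass z).
Proof.
move=> tz; rewrite /tpass tz; case/and3P: (tz) => gz nz _; case: ifP => bt.
  by have [] := turn3_broken gz bt.
rewrite /turn gz; move: nz; rewrite /zbroken gz /=.
by case: z gz {tz bt} => a [] /= ga nb; [apply: reach_gnext | apply: reach_hnext].
Qed.

(** From [sy x] forward runs of two and of three letters are admissible, as [N] is at least five.
    After two letters [broken_pass] leads back. After three letters one stands at
    [tpass (sw x, true)]; iterating [tpass] leads to [(sw x, true)], and [broken_pass] leads on to
    [sy x]. *)
Lemma broken_branching x : broken x -> branching bar f N.
Proof.
move=> bx; have [gw gy gp] := broken_good bx; have Ny := broken_Ny bx.
have [pw pp] := broken_pass bx.
exists (sy x), 2, 3; split=> //.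
  by rewrite [iter _ _ _]/= /step broken_ggy.
have -> : iter 3 (stp true) (sy x) = gnext (sp x) by rewrite /= /step broken_ggy // broken_gnextp.
apply: reach_trans pw.
have tw : tgood (sw x, true).
  apply/and3P; split=> //.
    by rewrite /zbroken /broken /= broken_Nw //; apply/negP => /andP[_ /and3P[_ _ /eqP e]]; rewrite e in Ny.
  apply/forallP => u; apply/implyP => /zbrokenP[x' bx' [->|->]].
    by case/and3P: bx' => gx' _ _; rewrite /turn /= gx' xpair_eqE andbF.
  have [gw' gy' gp'] := broken_good bx'.
  rewrite /turn /= gy' /= broken_hnexty //; apply/eqP => -[e].
  have := broken_Nw bx'; rewrite /sw -/(sp x') e (broken_fw bx) (broken_Nz bx).
  by have := broken_Ny bx' => + e3; rewrite -e3.
have e1 : tpass (sw x, true) = (gnext (sp x), false).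
  have t1 : turn (sw x, true) = (sy x, false) by rewrite /turn /= gw broken_gnextw.
  have t2 : turn (sy x, false) = (sp x, true) by rewrite /turn /= gy broken_hnexty.
  have b1 : zbroken (sy x, false) by rewrite /zbroken /= gy broken_hnexty // /sp barK.
  by rewrite /tpass tw t1 b1 t2 /turn /= gp.
have [k ek] := iter_cycle (sw x, true) tpass_inj; rewrite e1 in ek.
set z1 := (gnext (sp x), false) in ek *.
have tz1 : tgood z1 by rewrite /z1 -e1; apply: tpass_good.
have all j : tgood (iter j tpass z1) /\ reachR z1 (iter j tpass z1).
  elim: j => [|j [tj rj]]; first by split=> //; apply: reach_refl.
  by split; [apply: tpass_good | apply: reach_trans rj (reach_tpass tj)].
by rewrite -ek; have [] := all k.
Qed.

(** * Zigzags in the absence of broken states *)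

Hypothesis no_broken : forall a, ~~ broken a.

Definition sigma a := hnext (gnext a).

Lemma good_sigma a : good a -> good (sigma a).
Proof. by move=> ga; rewrite /sigma good_hnext ?good_gnext. Qed.

Lemma sigma_inj : {in good &, injective sigma}.
Proof.
move=> a b; rewrite -!topredE /= => ga gb e; have: turn (turn (a, true)) = turn (turn (b, true)).
  by rewrite /turn /= ga gb /= !good_gnext //= -/(sigma a) e.
by do 2 move/turn_inj; case.
Qed.

Lemma reach_sigma a : good a -> reachR (a, true) (sigma a, true).
Proof.
move=> ga; apply: (@reach_trans _ _ _ _ (gnext a, false)).
  exact: reach_gnext.
by apply: reach_hnext; rewrite ?good_gnext.
Qed.

Definition sperm a := if good a then sigma a else a.
Lemma sperm_inj : injective sperm.
Proof.
move=> a b; rewrite /sperm; case: ifP => ga; case: ifP => gb //.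
- exact: sigma_inj.
- by move=> e; rewrite -e good_sigma in gb.
- by move=> e; rewrite e good_sigma in ga.
Qed.

Lemma reach_sigmaV a : good a -> reachR (sigma a, true) (a, true).
Proof.
move=> ga; have [k] := iter_cycle a sperm_inj; rewrite {2}/sperm ga => e.
have gs := good_sigma ga; rewrite -[X in reachR _ (X, _)]e; move: (sigma a) gs => b gb {e}.
have: good (iter k sperm b) /\ reachR (b, true) (iter k sperm b, true).
  elim: k => [|k [gk rk]]; first by split=> //; apply: reach_refl.
  rewrite /= {1 3}/sperm gk; split; first exact: good_sigma.
  exact: reach_trans rk (reach_sigma gk).
by case.
Qed.

(** A single forward run may pass over the good state [gnext a] to the next one; a run of [k]
    letters needs [k + 2 <= N]. *)
Definition allowed a := len a + len (gnext a) + 2 <= N a.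

Lemma iter_len a : iter (len a) (stp true) a = gnext a.
Proof. by rewrite /len /gnext; case: (vir (f a)). Qed.

(** After overshooting to [gnext (gnext a)] one turns back to [sigma (gnext a)], and [sigma] is
    inverted by its powers. *)
Lemma allowed_long a : good a -> allowed a ->
  reachR (iter (len a + len (gnext a)) (stp true) a, false) (gnext a, true).
Proof.
move=> ga al; rewrite addnC iterD !iter_len.
have gg := good_gnext ga; apply: (@reach_trans _ _ _ _ (sigma (gnext a), true)); last exact: reach_sigmaV.
by apply: reach_hnext; rewrite ?good_gnext.
Qed.

Lemma allowed_reach a : good a -> allowed a -> reachR (a, true) (gnext a, true).
Proof.
move=> ga al; apply: reach_trans (allowed_long ga al).
apply: (@reach_run _ bar f N (len a + len (gnext a)) a true); first by rewrite /len addSn.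
by rewrite /run_bound; move: al; rewrite /allowed addn2.
Qed.

Lemma allowed_branching a : good a -> allowed a -> reachR (gnext a, true) (a, true) ->
  branching bar f N.
Proof.
move=> ga al back; exists a, (len a), (len a + len (gnext a)).
split=> //; first by rewrite -{1}[len a]addn0 ltn_add2l.
- by move: al; rewrite /allowed addn2.
- rewrite iter_len; apply: reach_trans (reach_sigmaV ga).
  by apply: reach_hnext; rewrite ?good_gnext.
exact: reach_trans (allowed_long ga al) back.
Qed.

Definition flexible a := forall k, allowed (iter k gnext a).

(** The return walk goes around the [gnext]-orbit of [a], all of whose steps are allowed. *)
Lemma flexible_branching a : good a -> flexible a -> branching bar f N.
Proof.
move=> ga fl; apply: (allowed_branching ga (fl 0)).
have [k e] := iter_cycle a gperm_inj.
have it j : iter j gperm a = iter j gnext a.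
  elim: j => //= j ->; rewrite {1}/gperm good_iter_gnext //.
rewrite -iterSr it in e.
rewrite -[X in reachR _ (X, _)]e; elim: k {e} => [|k IH]; first exact: reach_refl.
by apply: reach_trans IH _; rewrite [X in reachR _ (X, _)]iterS; apply: allowed_reach; rewrite ?good_iter_gnext.
Qed.

Lemma lenE a : len a = (vir (f a)).+1. Proof. by []. Qed.

(** The local balance for the count in [allowed_return]. If [N] is at least 6 the orbit is flexible;
    for [N] equal to 3, 4 or 5 it is so short that the virtual arrows along it are under control. *)
Lemma allowed_balance a : good a -> (forall b, good b -> ~ flexible b) ->
  allowed a + vir (f (gnext a)) = allowed (gprev a) + vir (f (gprev a)).
Proof.
move=> ga nofl; have [gp ep] := gprevKV ga.
have N_a := gnextN; have Np : N (gprev a) = N a by rewrite -{2}ep gnextN.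
have Na3 := good_N ga.
rewrite /allowed !lenE ep Np.
have [N6|N5] := leqP 6 (N a).
  case: (nofl a ga) => k; rewrite /allowed !lenE.
  have -> : N (iter k gnext a) = N a by elim: k => //= k; rewrite gnextN.
  by move: (vir _) (vir _) => [] []; lia.
have : [|| N a == 3, N a == 4 | N a == 5] by lia.
case/or3P => /eqP NE.
- have nv b : good b -> N b = 3 -> vir (f b) = false.
    by move=> gb Nb; have := no_broken b; rewrite /broken gb Nb eqxx andbT => /negbTE.
  by rewrite !nv ?good_gnext ?gnextN ?Np.
(* For [N = 4] both sides are 1 unless [f a] is virtual; then neither step is allowed, and the two
   neighbours of [a] have to agree. *)
- case v: (vir (f a)); last by rewrite NE; case: (vir _); case: (vir _).
  rewrite NE; suff -> : vir (f (gnext a)) = vir (f (gprev a)) by case: (vir _).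
  have e4 : iter 4 g a = a by rewrite -NE iter_g_order.
  have e2 : gnext a = iter 2 g a by rewrite /gnext v.
  have g2 := good_gnext ga.
  case v2: (vir (f (gnext a))).
    have e : gnext (gnext a) = a by rewrite {1}/gnext v2 e2.
    by rewrite -{1}e gprevK.
  have e3 : gnext (gnext a) = iter 3 g a by rewrite {1}/gnext v2 e2.
  have g3 := good_gnext g2; rewrite e3 in g3.
  have v3 : vir (f (iter 3 g a)) = false.
    apply/negP => v3; have e : gnext (iter 3 g a) = bar (f a).
      by rewrite /gnext v3; congr (bar (f _)); exact: e4.
    by have := good_gnext g3; rewrite e /good barK v andbF.
  have e : gnext (iter 3 g a) = a by rewrite /gnext v3; exact: e4.
  by rewrite -{1}e gprevK.
rewrite NE; case v: (vir (f a)); first by case: (vir _); case: (vir _).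
suff -> : vir (f (gnext a)) = vir (f (gprev a)) by case: (vir _).
have e5 : iter 5 g a = a by rewrite -NE iter_g_order.
(* For [N = 5] and [f a] not virtual both steps are allowed, and again the neighbours have to agree.
   A forbidden step [y] exists, so [f y] and [f (gnext y)] are virtual; this leaves $a=g^4(y)$, with
   neighbours [gnext y] and [y]. *)
have [k /negP nal] := not_all_ex_not _ _ (nofl a ga).
set y := iter k gnext a in nal; have gy : good y by apply: good_iter_gnext.
have Ny : N y = 5 by rewrite /y; elim: k {nal y gy} => //= k; rewrite gnextN.
have [vy vy2] : vir (f y) /\ vir (f (gnext y)).
  by move: nal; rewrite /allowed !lenE Ny; case: (vir _); case: (vir _).
have e2 : gnext y = iter 2 g y by rewrite /gnext vy.
have e4 : gnext (gnext y) = iter 4 g y by rewrite {1}/gnext vy2 e2.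
have ey : iter 5 g y = y by rewrite -Ny iter_g_order.
have [j ej] : exists j, a = iter j g y.
  have [i iE] := gnext_iter_g k a; rewrite -/y in iE.
  exists (4 * i); rewrite iE -iterD (_ : 4 * i + i = i * 5); last by lia.
  by elim: (i) => // i' IH; rewrite mulSn iterD -IH.
have [i i5 ei] : exists2 i, i < 5 & a = iter i g y.
  exists (j %% 5); first by rewrite ltn_mod.
  have e5y m : iter (m * 5) g y = y by elim: m => // m IH; rewrite mulSn iterD IH.
  by rewrite ej {1}(divn_eq j 5) addnC iterD e5y.
have g2 := good_gnext gy; have g4 := good_gnext g2.
have a4 : a = iter 4 g y.
  case: i i5 ei => [|[|[|[|[|i]]]]] // _ ei; move: ga v; rewrite ei.
  - by rewrite vy.
  - by rewrite /good /= barK vy andbF.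
  - by rewrite -e2 vy2.
  have : vir (f (iter 2 g y)) by rewrite -e2.
  by rewrite /good [iter 3 _ _]/= barK => ->; rewrite andbF.
have ga1 : gnext a = y by rewrite /gnext v a4; exact: ey.
have ga2 : gprev a = gnext y by rewrite a4 -e4 gprevK.
by rewrite ga1 ga2 vy vy2.
Qed.

(** A conservation law. Let [X] be what is reachable from [gnext a] by [sigma] and allowed steps.
    Summing [allowed_balance] over [X], which [sigma] permutes, shows that as many allowed steps
    start in [X] as end in [X]. Those that start in [X] end there, so those that end in [X] start
    there, and the step from [a] to [gnext a] is one of them. *)
Lemma allowed_return a : good a -> allowed a -> (forall b, good b -> ~ flexible b) ->
  reachR (gnext a, true) (a, true).
Proof.
move=> ga al nofl.
pose e : rel A := fun x y => good x && ((y == sigma x) || allowed x && (y == gnext x)).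
pose X := [set x | connect e (gnext a) x].
suff : a \in X.
  rewrite inE => /connectP[p]; have := good_gnext ga; move: (gnext a) => b gb.
  elim: p b gb => [|c p IH] b gb /=; first by move=> _ ->; apply: reach_refl.
  case/andP => /andP[_ /orP[/eqP ec|/andP[ab /eqP ec]]] pth la.
    by apply: reach_trans (reach_sigma gb) _; rewrite -ec; apply: IH pth la; rewrite ec good_sigma.
  by apply: reach_trans (allowed_reach gb ab) _; rewrite -ec; apply: IH pth la; rewrite ec good_gnext.
have Xg x : x \in X -> good x.
  rewrite inE => /connectP[p]; have := good_gnext ga; move: (gnext a) => b gb.
  elim: p b gb => [|c p IH] b gb /=; first by move=> _ ->.
  case/andP => /andP[_ /orP[/eqP ec|/andP[ab /eqP ec]]] pth la.
    by apply: IH pth la; rewrite ec good_sigma.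
  by apply: IH pth la; rewrite ec good_gnext.
have Xs x : x \in X -> sigma x \in X.
  move=> xX; move: (xX); rewrite !inE => cx; apply: connect_trans cx (connect1 _).
  by rewrite /e Xg // eqxx.
have Xa x : x \in X -> allowed x -> gnext x \in X.
  move=> xX ax; move: (xX); rewrite !inE => cx; apply: connect_trans cx (connect1 _).
  by rewrite /e Xg // ax eqxx orbT.
have sX : sigma @: X = X.
  apply/eqP; rewrite eqEcard card_in_imset ?leqnn ?andbT; last first.
    by move=> x y /Xg gx /Xg gy; apply: sigma_inj.
  by apply/subsetP => y /imsetP[x xX ->]; apply: Xs.
(* [sigma] exchanges the two sides: [vir (f (gprev (sigma x))) = vir (f (gnext x))]. *)
have sumX : \sum_(x in X) (vir (f (gprev x)) : nat) = \sum_(x in X) (vir (f (gnext x)) : nat).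
  rewrite -{1}sX big_imset /=; last by move=> x y /Xg gx /Xg gy; apply: sigma_inj.
  apply: eq_bigr => x /Xg gx; congr (nat_of_bool _).
  have gg := good_gnext gx.
  have step1 b : good b -> vir (f (gprev (bar b))) = vir (f b).
    move=> gb; have [gp ep] := @gprevKV (bar b) (etrans (good_bar b) gb).
    by rewrite -[in LHS](len_fprime gp) ep barK.
  rewrite /sigma /hnext step1 ?step1 //.
  by have [] := @gprevKV (bar (gnext x)); rewrite ?good_bar.
have sumal : \sum_(x in X) (allowed x : nat) = \sum_(x in X) (allowed (gprev x) : nat).
  have : \sum_(x in X) (allowed x + vir (f (gnext x))) = \sum_(x in X) (allowed (gprev x) + vir (f (gprev x))).
    by apply: eq_bigr => x /Xg gx; apply: allowed_balance.
  by rewrite !big_split /= sumX => /eqP; rewrite eqn_add2r => /eqP.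
have cardE (P : pred A) : \sum_(x in X) (P x : nat) = #|[set x in X | P x]|.
  by rewrite -sum1dep_card big_mkcondr; apply: eq_bigr => x _; case: (P x).
have im : gnext @: [set x in X | allowed x] = [set x in X | allowed (gprev x)].
  apply/eqP; rewrite eqEcard card_in_imset; last first.
    by move=> x y /setIdP[/Xg gx _] /setIdP[/Xg gy _]; apply: gnext_inj.
  rewrite -!cardE sumal leqnn andbT.
  apply/subsetP => y /imsetP[x]; rewrite inE => /andP[xX ax] ->.
  by rewrite inE Xa // gprevK // Xg.
have : gnext a \in [set x in X | allowed (gprev x)] by rewrite inE gprevK // al andbT inE connect0.
rewrite -im => /imsetP[x]; rewrite inE => /andP[xX _] /gnext_inj ->; rewrite ?Xg //.
exact: Xg.
Qed.

Lemma allowed_nonrigid a : good a -> allowed a -> branching bar f N.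
Proof.
move=> ga al; case: (classic (exists2 b, good b & flexible b)) => [[b gb fb]|no].
  exact: flexible_branching fb.
apply: (allowed_branching ga al); apply: allowed_return => // b gb fb.
by apply: no; exists b.
Qed.
End Surface.

Local Open Scope ring_scope.

(** * Ideals of path algebras and monomial congruences *)

Section Ideal.
Variables (K : fieldType) (V A : finType) (s t : A -> V).
Local Notation qp := (qpath V A).
Local Notation KQ := (kq K V A).
Local Notation pval := (pvalid s t).
Local Notation eqv := (kq_eq s t).

(** Formal sums are tested by linear functionals that vanish on invalid paths; this absorbs
    reordering and cancellation of terms. *)
Definition ev (h : qp -> K) (x : KQ) : K := \sum_(u <- x) u.1 * h u.2.
Definition vsupp (h : qp -> K) := forall p, ~~ pval p -> h p = 0.

Lemma ev_cat h x y : ev h (x ++ y) = ev h x + ev h y. Proof. exact: big_cat. Qed.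
Lemma ev_nil h : ev h [::] = 0. Proof. exact: big_nil. Qed.
Lemma ev_scale h c x : ev h (kq_scale c x) = c * ev h x.
Proof. by rewrite /ev big_map mulr_sumr; apply: eq_bigr => u _; rewrite mulrA. Qed.
Lemma ev_sub h x y : ev h (kq_sub x y) = ev h x - ev h y.
Proof. by rewrite ev_cat ev_scale mulN1r. Qed.
Lemma ev_flatten h (l : seq KQ) : ev h (flatten l) = \sum_(x <- l) ev h x.
Proof. by elim: l => [|x l IH]; rewrite ?big_nil ?ev_nil // big_cons /= ev_cat IH. Qed.
Lemma eq_ev h h' x : h =1 h' -> ev h x = ev h' x.
Proof. by move=> e; apply: eq_bigr => u _; rewrite e. Qed.

Lemma ev_coef h x : ev h x = \sum_(p <- undup [seq u.2 | u <- x]) kq_coef x p * h p.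
Proof.
rewrite /kq_coef; under [RHS]eq_bigr do rewrite mulr_suml.
rewrite (exchange_big_dep predT) //= /ev [LHS]big_seq_cond [RHS]big_seq_cond.
apply: eq_bigr => u /andP[ux _].
rewrite big_mkcond (bigD1_seq u.2) ?undup_uniq ?mem_undup ?map_f //= eqxx big1 ?addr0 //.
by move=> p np; rewrite eq_sym (negPf np).
Qed.

Lemma kq_eqP x y : eqv x y <-> forall h, vsupp h -> ev h x = ev h y.
Proof.
split=> [e h hv|e p pv].
  have ext (l : seq qp) z : uniq l -> {subset [seq u.2 | u <- z] <= l} ->
      ev h z = \sum_(p <- l) kq_coef z p * h p.
    move=> ul sub; rewrite ev_coef.
    rewrite [RHS](bigID (mem [seq u.2 | u <- z])) /= [X in _ + X]big1 ?addr0 => [|p pz].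
      rewrite -[RHS]big_filter; apply: perm_big; apply: uniq_perm; rewrite ?undup_uniq ?filter_uniq //.
      move=> p; rewrite mem_undup mem_filter /=; case pz: (p \in _) => //=.
      by rewrite sub.
    rewrite /kq_coef big1_seq ?mul0r // => u /andP[/eqP up uz].
    by case/negP: pz; rewrite -up map_f.
  pose l := undup ([seq u.2 | u <- x] ++ [seq u.2 | u <- y]).
  rewrite (ext l) ?undup_uniq // => [|p px]; last by rewrite mem_undup mem_cat px.
  rewrite (ext l y) ?undup_uniq // => [|p px]; last by rewrite mem_undup mem_cat px orbT.
  apply: eq_bigr => p _; case pv: (pval p); first by rewrite e.
  by rewrite hv ?pv // !mulr0.
have := e (fun q => (q == p)%:R); rewrite /ev /kq_coef => H.
have E (z : KQ) : \sum_(u <- z | u.2 == p) u.1 = \sum_(u <- z) u.1 * (u.2 == p)%:R.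
  by rewrite big_mkcond; apply: eq_bigr => u _; case: eqP; rewrite ?mulr1 ?mulr0.
by rewrite !E; apply: H => q nq; case: eqP nq => // ->; rewrite pv.
Qed.

Lemma ev_mul h x y : ev h (kq_mul t x y) =
  ev (fun u => ev (fun w => if ptarget t u == w.1 then h (u.1, u.2 ++ w.2) else 0) y) x.
Proof.
rewrite /kq_mul ev_flatten big_map /ev; apply: eq_bigr => u _.
rewrite big_map big_filter mulr_sumr big_mkcond; apply: eq_bigr => w _ /=.
by case: ifP => _; rewrite ?mulr0 // mulrA.
Qed.

Lemma ev_one h c p : ev h [:: (c, p)] = c * h p. Proof. exact: big_seq1. Qed.

(** The functional $w\mapsto h(p\,w\,q)$, through which two-sided multiples of relations are
    evaluated. *)
Definition sand (p q : qp) (h : qp -> K) (w : qp) : K :=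
  if (ptarget t p == w.1) && (ptarget t w == q.1) then h (p.1, p.2 ++ w.2 ++ q.2) else 0.

Lemma ptarget_cat v l l' : ptarget t (v, l ++ l') = ptarget t (ptarget t (v, l), l').
Proof. by rewrite /ptarget /= map_cat last_cat. Qed.

Lemma ev_sand h c p c' q x :
  ev h (kq_mul t (kq_mul t [:: (c, p)] x) [:: (c', q)]) = c * c' * ev (sand p q h) x.
Proof.
rewrite !ev_mul ev_one -mulrA; congr (_ * _).
rewrite mulr_sumr; apply: eq_bigr => w _; rewrite mulrCA; congr (_ * _).
rewrite /sand; case: eqP => [e|_]; rewrite ?mulr0 //= ev_one /= ptarget_cat.
rewrite -surjective_pairing e -surjective_pairing catA.
by case: ifP; rewrite ?mulr0.
Qed.

Lemma walk_cat v l l' : walk s t v (l ++ l') = walk s t v l && walk s t (ptarget t (v, l)) l'.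
Proof. by elim: l v => //= a l IH v; rewrite IH andbA. Qed.

Lemma sand_vsupp p q h : vsupp h -> vsupp (sand p q h).
Proof.
move=> hv w nw; rewrite /sand; case: ifP => // /andP[/eqP e1 /eqP e2]; apply: hv.
rewrite /pvalid /= !walk_cat -surjective_pairing e1.
by move: nw; rewrite /pvalid => /negbTE ->; rewrite andbF.
Qed.

Variable R : seq KQ.
Local Notation I := (in_ideal s t R).

Lemma idealP x : I x <-> exists l : seq (K * qp * nat * qp), forall h, vsupp h ->
  ev h x = \sum_(u <- l) u.1.1.1 * ev (sand u.1.1.2 u.2 h) (nth [::] R u.1.2).
Proof.
split=> -[l e]; exists l.
  move/kq_eqP: e => e h hv; rewrite e // ev_flatten big_map; apply: eq_bigr => u _.
  by rewrite ev_scale ev_sand !mul1r.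
apply/kq_eqP => h hv; rewrite e // ev_flatten big_map; apply: eq_bigr => u _.
by rewrite ev_scale ev_sand !mul1r.
Qed.

Lemma ideal_ev x y : (forall h, vsupp h -> ev h x = ev h y) -> I x -> I y.
Proof. by move=> e /idealP[l H]; apply/idealP; exists l => h hv; rewrite -e // H. Qed.

Lemma ideal0 x : (forall h, vsupp h -> ev h x = 0) -> I x.
Proof. by move=> e; apply/idealP; exists [::] => h hv; rewrite big_nil e. Qed.

Lemma ideal_cat x y : I x -> I y -> I (x ++ y).
Proof.
move=> /idealP[l H] /idealP[l' H']; apply/idealP; exists (l ++ l') => h hv.
by rewrite ev_cat big_cat H // H'.
Qed.

Lemma ideal_scale c x : I x -> I (kq_scale c x).
Proof.
move=> /idealP[l H]; apply/idealP.
exists [seq (c * u.1.1.1, u.1.1.2, u.1.2, u.2) | u <- l] => h hv.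
by rewrite ev_scale H // big_map mulr_sumr; apply: eq_bigr => u _; rewrite mulrA.
Qed.

Lemma sand_sand p q p' q' h x : ev (sand p' q' (sand p q h)) x =
  if (ptarget t p == p'.1) && (ptarget t q' == q.1)
  then ev (sand (p.1, p.2 ++ p'.2) (q'.1, q'.2 ++ q.2) h) x else 0.
Proof.
have E2 (w : qp) : ptarget t p' = w.1 -> ptarget t w = q'.1 ->
    ptarget t (p'.1, p'.2 ++ w.2 ++ q'.2) = ptarget t q'.
  by move=> e3 e4; rewrite !ptarget_cat -surjective_pairing e3 -surjective_pairing e4 -surjective_pairing.
case: (boolP (_ && _)) => [/andP[/eqP e1 /eqP e2]|ne].
  have E1 : ptarget t (p.1, p.2 ++ p'.2) = ptarget t p'.
    by rewrite ptarget_cat -surjective_pairing e1 -surjective_pairing.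
  apply: eq_ev => w; rewrite /sand /= E1.
  case: ifP => // /andP[/eqP e3 /eqP e4]; rewrite (E2 w) // e1 e2 !eqxx /=.
  by rewrite -!catA.
rewrite /ev big1 // => w _; rewrite /sand /=; case: ifP => [/andP[/eqP e3 /eqP e4]|_]; rewrite ?mulr0 //.
by rewrite (E2 w.2) // (negPf ne) mulr0.
Qed.

Lemma ideal_mul c p c' q x : I x -> I (kq_mul t (kq_mul t [:: (c, p)] x) [:: (c', q)]).
Proof.
move=> /idealP[l H]; apply/idealP.
exists [seq (c * c' * u.1.1.1 * ((ptarget t p == u.1.1.2.1) && (ptarget t u.2 == q.1))%:R,
   (p.1, p.2 ++ u.1.1.2.2), u.1.2, (u.2.1, u.2.2 ++ q.2)) | u <- l] => h hv.
rewrite ev_sand H ?big_map ?mulr_sumr; last exact: sand_vsupp.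
apply: eq_bigr => u _ /=; rewrite sand_sand.
by case: ifP; rewrite ?mulr1 ?mulr0 ?mul0r // mulrA.
Qed.

Lemma sand_id v w h x : (forall u, u \in [seq u.2 | u <- x] -> u.1 = v /\ ptarget t u = w) ->
  ev (sand (v, [::]) (w, [::]) h) x = ev h x.
Proof.
move=> H; apply: eq_big_seq => u ux; have [e1 e2] := H _ (map_f snd ux).
by rewrite /sand /= e2 -e1 {1}/ptarget /= !eqxx /= cats0 -surjective_pairing.
Qed.

(** Elements of the ideal are built with a path on either side of a relation; for a combination of
    parallel paths the trivial paths at the two ends do nothing. *)
Lemma ideal_gen v w r : (forall u, u \in [seq u.2 | u <- r] -> u.1 = v /\ ptarget t u = w) ->
  r \in R -> I r.
Proof.
move=> H rR; apply/idealP; exists [:: (1, (v, [::]), index r R, (w, [::]))] => h hv.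
by rewrite big_seq1 /= nth_index // mul1r sand_id.
Qed.

Definition mcong (x y : K * qp) := I [:: x; (- y.1, y.2)].

Lemma ev_two h (x y : K * qp) : ev h [:: x; (- y.1, y.2)] = x.1 * h x.2 - y.1 * h y.2.
Proof. by rewrite /ev big_cons big_seq1 /= mulNr. Qed.

Lemma mcong_refl x : mcong x x.
Proof. by apply: ideal0 => h hv; rewrite ev_two subrr. Qed.

Lemma mcong_eq x y : x = y -> mcong x y.
Proof. by move->; apply: mcong_refl. Qed.

Lemma mcong_trans y x z : mcong x y -> mcong y z -> mcong x z.
Proof.
move=> xy yz; apply: ideal_ev (ideal_cat xy yz) => h hv.
by rewrite ev_cat !ev_two addrA subrK.
Qed.

Lemma mcong_sym x y : mcong x y -> mcong y x.
Proof.
move=> xy; apply: ideal_ev (ideal_scale (-1) xy) => h hv.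
by rewrite ev_scale !ev_two mulN1r opprB.
Qed.

Lemma mcong_scale k x y : mcong x y -> mcong (k * x.1, x.2) (k * y.1, y.2).
Proof.
move=> xy; apply: ideal_ev (ideal_scale k xy) => h hv.
by rewrite ev_scale !ev_two /= mulrBr !mulrA.
Qed.

Lemma mcong_ctx u pre v w post c c' l l' :
  ptarget t (u, pre) = v -> ptarget t (v, l) = w -> ptarget t (v, l') = w ->
  mcong (c, (v, l)) (c', (v, l')) ->
  mcong (c, (u, pre ++ l ++ post)) (c', (u, pre ++ l' ++ post)).
Proof.
move=> e1 e2 e3 xy; apply: ideal_ev (ideal_mul 1 (u, pre) 1 (w, post) xy) => h hv.
by rewrite ev_sand !ev_two /sand /= e1 e2 e3 !eqxx /= !mul1r.
Qed.

Definition mzero (p : qp) := forall c, I [:: (c, p)].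

Lemma mzero_path p : I (kq_path p) -> mzero p.
Proof.
by move=> H c; apply: ideal_ev (ideal_scale c H) => h hv; rewrite ev_scale !ev_one mul1r.
Qed.

Lemma mzero_ctx u pre v w post l : ptarget t (u, pre) = v -> ptarget t (v, l) = w ->
  mzero (v, l) -> mzero (u, pre ++ l ++ post).
Proof.
move=> e1 e2 z c; apply: ideal_ev (ideal_mul 1 (u, pre) 1 (w, post) (z c)) => h hv.
by rewrite ev_sand !ev_one /sand /= e1 e2 !eqxx /= !mul1r.
Qed.

Lemma mzero_cong c c' p p' : c != 0 -> mcong (c, p) (c', p') -> mzero p' -> mzero p.
Proof.
move=> c0 pp' z k; apply: ideal_ev (ideal_scale (k / c) (ideal_cat pp' (z c'))) => h hv.
by rewrite ev_scale ev_cat ev_two !ev_one /= subrK mulrA divfK.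
Qed.
End Ideal.

(** * Monomial isomorphisms *)

Section Monomial.
Variables (K : fieldType) (V A V' A' : finType) (s t : A -> V) (s' t' : A' -> V').
Variables (eV : V -> V') (xk : A -> K) (xl : A -> seq A').

(** The images of arrows are nonempty, so that their targets do not depend on the vertex at which
    they are attached. *)
Definition monomial_data := [/\ injective eV, (forall a, (0 < size (xl a))%N),
  (forall a, walk s' t' (eV (s a)) (xl a)) & (forall a, ptarget t' (eV (s a), xl a) = eV (t a))].
Definition mcoef (l : seq A) := \prod_(a <- l) xk a.
Definition mpath (l : seq A) := flatten [seq xl a | a <- l].
Definition msubst (p : qpath V A) : qpath V' A' := (eV p.1, mpath p.2).
Definition mmap (x : kq K V A) : kq K V' A' := [seq (u.1 * mcoef u.2.2, msubst u.2) | u <- x].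

Hypothesis mono : monomial_data.

Lemma ptarget_nonempty v w (l : seq A') : (0 < size l)%N -> ptarget t' (v, l) = ptarget t' (w, l).
Proof. by case: l. Qed.

Lemma msubst_target p : ptarget t' (msubst p) = eV (ptarget t p).
Proof.
case: mono => _ ne _ tg; case: p => v l; rewrite /msubst /=.
elim: l v => [|a l IH] v //=; rewrite /mpath /= ptarget_cat.
by rewrite (ptarget_nonempty _ (eV (s a)) (ne a)) tg IH.
Qed.

Lemma msubst_valid p : pvalid s' t' (msubst p) = pvalid s t p.
Proof.
case: mono => inj ne wk tg; case: p => v l; rewrite /pvalid /=.
elim: l v => [|a l IH] v //=; rewrite /mpath /= walk_cat.
rewrite (ptarget_nonempty _ (eV (s a)) (ne a)) tg IH; congr (_ && _).
have := wk a; have := ne a; case: (xl a) => //= b m _ /andP[/eqP -> ->].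
by rewrite andbT (inj_eq inj).
Qed.

Definition pull (h : qpath V' A' -> K) (p : qpath V A) : K := mcoef p.2 * h (msubst p).

Lemma ev_mmap h x : ev h (mmap x) = ev (pull h) x.
Proof. by rewrite /ev big_map; apply: eq_bigr => u _; rewrite /pull mulrA. Qed.

Lemma pull_vsupp h : vsupp s' t' h -> vsupp s t (pull h).
Proof. by move=> hv p np; rewrite /pull hv ?mulr0 // msubst_valid. Qed.

Lemma mcoef_cat l l' : mcoef (l ++ l') = mcoef l * mcoef l'.
Proof. exact: big_cat. Qed.

Lemma mpath_cat l l' : mpath (l ++ l') = mpath l ++ mpath l'.
Proof. by rewrite /mpath map_cat flatten_cat. Qed.

Lemma sand_pull p q h x : ev (sand t p q (pull h)) x =
  mcoef p.2 * mcoef q.2 * ev (pull (sand t' (msubst p) (msubst q) h)) x.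
Proof.
rewrite /ev mulr_sumr; apply: eq_bigr => u _; rewrite /sand /pull !msubst_target /=.
case: mono => inj _ _ _; rewrite !(inj_eq inj).
case: ifP => _; rewrite ?mulr0 // !mcoef_cat /msubst /= !mpath_cat.
by ring.
Qed.

Lemma ideal_mmap R R' : (forall r, r \in R -> in_ideal s' t' R' (mmap r)) ->
  forall x, in_ideal s t R x -> in_ideal s' t' R' (mmap x).
Proof.
move=> HR x /idealP[l H].
pose F (u : K * qpath V A * nat * qpath V A) := kq_scale u.1.1.1
  (kq_mul t' (kq_mul t' [:: (mcoef u.1.1.2.2, msubst u.1.1.2)] (mmap (nth [::] R u.1.2)))
     [:: (mcoef u.2.2, msubst u.2)]).
have : in_ideal s' t' R' (flatten [seq F u | u <- l]).
  elim: l {H} => [|u l IH] /=; first by apply: ideal0 => h hv; rewrite ev_nil.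
  apply: ideal_cat IH; apply: ideal_scale; apply: ideal_mul.
  have [lt|ge] := ltnP u.1.2 (size R); first by apply: HR; apply: mem_nth.
  by rewrite nth_default //; apply: ideal0 => h hv; rewrite ev_nil.
apply: ideal_ev => h hv; rewrite ev_mmap (H _ (pull_vsupp hv)) ev_flatten big_map.
by apply: eq_bigr => u _; rewrite ev_scale ev_sand ev_mmap sand_pull.
Qed.

Lemma foldl_monomial c u m v l : ptarget t' (u, m) = eV v -> walk s t v l ->
  foldl (kq_mul t') [:: (c, (u, m))] [seq [:: (xk a, (eV (s a), xl a))] | a <- l] =
  [:: (c * mcoef l, (u, m ++ mpath l))].
Proof.
case: mono => inj ne wk tg.
elim: l c m v => [|a l IH] c m v tm /=.
  by rewrite /mcoef big_nil mulr1 cats0.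
case/andP => /eqP sv wl; rewrite /kq_mul /= tm sv eqxx /=.
rewrite (IH _ _ (t a)) //; last by rewrite ptarget_cat tm -sv tg.
by rewrite /mcoef big_cons /mpath /= mulrA catA.
Qed.
End Monomial.

(** * Substitutions that are inverse modulo the relations *)

Section Composite.
Variables (K : fieldType) (V A V' A' : finType) (s t : A -> V) (s' t' : A' -> V').
Variables (eV : V -> V') (xk : A -> K) (xl : A -> seq A').
Variables (dV : V' -> V) (yk : A' -> K) (yl : A' -> seq A).
Hypothesis mono : monomial_data s t s' t' eV xl.
Hypothesis mono' : monomial_data s' t' s t dV yl.
Hypothesis eVK : cancel eV dV.
Variable R : seq (kq K V A).
Local Notation cong := (mcong s t R).

Hypothesis roundtrip : forall a,
  cong (xk a * mcoef yk (xl a), (s a, mpath yl (xl a))) (1, (s a, [:: a])).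

Lemma roundtrip_target a : ptarget t (s a, mpath yl (xl a)) = t a.
Proof.
case: (mono) => _ _ _ tg; have := msubst_target mono' (eV (s a), xl a).
by rewrite /msubst /= eVK tg eVK.
Qed.

Lemma roundtrip_path v l : walk s t v l ->
  cong (mcoef xk l * mcoef yk (mpath xl l), (v, mpath yl (mpath xl l))) (1, (v, l)).
Proof.
elim: l v => [|a l IH] v /=.
  by rewrite /mpath /mcoef /= !big_nil mul1r => _; apply: mcong_refl.
case/andP => /eqP <- wl.
have -> : mcoef xk (a :: l) = xk a * mcoef xk l by rewrite /mcoef big_cons.
rewrite -[mpath xl (a :: l)]/(xl a ++ mpath xl l) mcoef_cat mpath_cat.
set k1 := xk a * mcoef yk (xl a); set k2 := mcoef xk l * mcoef yk (mpath xl l).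
have -> : xk a * mcoef xk l * (mcoef yk (xl a) * mcoef yk (mpath xl l)) = k2 * k1.
  by rewrite /k1 /k2 mulrACA mulrC.
have tl : ptarget t (t a, mpath yl (mpath xl l)) = ptarget t (t a, l).
  have := msubst_target mono' (msubst eV xl (t a, l)); rewrite (msubst_target mono).
  by rewrite /msubst /= !eVK.
apply: (@mcong_trans _ _ _ _ _ _ (k2 * 1, (s a, [:: a] ++ mpath yl (mpath xl l)))).
  exact: (mcong_scale k2 (@mcong_ctx _ _ _ _ _ _ (s a) [::] (s a) (t a)
    (mpath yl (mpath xl l)) _ _ _ [:: a] erefl (roundtrip_target a) erefl (roundtrip a))).
rewrite mulr1; have := @mcong_ctx _ _ _ _ _ _ (s a) [:: a] (t a) _ [::] _ _ _ l erefl tl erefl (IH _ wl).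
by rewrite !cats0.
Qed.

Lemma roundtrip_mmap y : in_ideal s t R (kq_sub (mmap dV yk yl (mmap eV xk xl y)) y).
Proof.
elim: y => [|u y IH]; first by apply: ideal0 => h hv; rewrite ev_sub !ev_nil subrr.
case vu: (pvalid s t u.2).
  have := roundtrip_path vu; move/(ideal_scale u.1) => H.
  apply: ideal_ev (ideal_cat H IH) => h hv.
  rewrite ev_cat ev_scale ev_two !ev_sub /= -/(mmap _ _ _ _) /ev !big_cons /=.
  rewrite /msubst /= eVK -surjective_pairing !mul1r mulrBr opprD.
  by rewrite addrACA !mulrA.
apply: ideal_ev IH => h hv; rewrite !ev_sub /= /ev !big_cons /=.
have -> : h u.2 = 0 by rewrite hv ?vu.
rewrite mulr0 add0r [X in X * h _]mulrC.
have -> : h (msubst dV yl (msubst eV xl u.2)) = 0.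
  by rewrite hv // (msubst_valid mono') (msubst_valid mono) vu.
by rewrite mulr0 add0r.
Qed.
End Composite.

(** Injectivity and surjectivity both come from the substitution in the other direction, which is
    inverse on arrows modulo the ideals and hence on all paths. *)
Theorem monomial_alg_iso (K : fieldType) (P P' : pres K)
  (eV : pV P -> pV P') (xk : pA P -> K) (xl : pA P -> seq (pA P'))
  (dV : pV P' -> pV P) (yk : pA P' -> K) (yl : pA P' -> seq (pA P)) :
  monomial_data (ps P) (pt P) (ps P') (pt P') eV xl ->
  monomial_data (ps P') (pt P') (ps P) (pt P) dV yl ->
  cancel eV dV -> cancel dV eV ->
  (forall r, r \in prels P -> in_ideal (ps P') (pt P') (prels P') (mmap eV xk xl r)) ->
  (forall r, r \in prels P' -> in_ideal (ps P) (pt P) (prels P) (mmap dV yk yl r)) ->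
  (forall a, mcong (ps P) (pt P) (prels P)
     (xk a * mcoef yk (xl a), (ps P a, mpath yl (xl a))) (1, (ps P a, [:: a]))) ->
  (forall a, mcong (ps P') (pt P') (prels P')
     (yk a * mcoef xk (yl a), (ps P' a, mpath xl (yl a))) (1, (ps P' a, [:: a]))) ->
  alg_iso P P'.
Proof.
move=> mono mono' eVK dVK HR HR' rt rt'.
exists (fun v => [:: (1, (eV v, [::]))]), (fun a => [:: (xk a, (eV (ps P a), xl a))]).
move=> I' eqI' mul' phip phi.
have phiE y h : vsupp (ps P') (pt P') h -> ev h (phi y) = ev h (mmap eV xk xl y).
  move=> hv; rewrite /phi ev_flatten big_map /mmap /ev big_map; apply: eq_bigr => u _.
  rewrite -/(ev h _) ev_scale /phip; case vu: (pvalid _ _ _).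
    by rewrite (foldl_monomial xk mono 1 (v := u.2.1)) //= ev_one mul1r mulrA.
  by rewrite ev_nil mulr0 hv ?mulr0 // (msubst_valid mono) vu.
have eqE a b : (forall h, vsupp (ps P') (pt P') h -> ev h a = ev h b) -> eqI' a b.
  by move=> e; apply: ideal0 => h hv; rewrite ev_sub e // subrr.
split; first split.
- move=> v w; apply: eqE => h hv; rewrite /mul' ev_mul ev_one mul1r /ptarget /= ev_one mul1r /=.
  case: (eqVneq v w) => [->|ne]; first by rewrite eqxx ev_one mul1r.
  by rewrite (inj_eq (can_inj eVK)) (negPf ne) ev_nil.
- apply: eqE => h hv; rewrite ev_flatten big_map /kq_one /ev [RHS]big_map.
  rewrite (eq_bigr (fun v => h (eV v, [::]))) => [|v _]; last by rewrite big_seq1 mul1r.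
  rewrite [RHS](eq_bigr (fun v => h (v, [::]))) => [|v _]; last by rewrite mul1r.
  rewrite !big_enum /= [RHS](reindex eV) //.
  by exists dV => v _.
- move=> a; apply: eqE => h hv; case: mono => _ _ _ tg.
  by rewrite /mul' ev_sand !mul1r sand_id // => u; rewrite inE => /eqP ->; rewrite tg.
- move=> r /HR; apply: ideal_ev => h hv; by rewrite phiE.
- move=> y Hy; have Hm : I' (mmap eV xk xl y).
    by apply: ideal_ev Hy => h hv; rewrite phiE.
  have H1 := ideal_mmap mono' HR' Hm.
  have H2 := roundtrip_mmap mono mono' eVK rt y.
  apply: ideal_ev (ideal_cat H1 (ideal_scale (-1) H2)) => h hv.
  by rewrite ev_cat ev_scale ev_sub mulN1r opprB addrC subrK.
move=> z; exists (mmap dV yk yl z).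
have := roundtrip_mmap mono' mono dVK rt' z; apply: ideal_ev => h hv.
by rewrite !ev_sub phiE.
Qed.

(** * Weighted surface algebras and rescaling *)

Section WsaFacts.
Variables (K : fieldType) (Q : tqdata K).
Hypothesis wsa : is_wsa Q.
Local Notation A := (tA Q).
Local Notation s := (ts Q).
Local Notation t := (tt Q).
Local Notation f := (tf Q).
Definition tN (a : A) : nat := (tm Q a * tn a)%N.

Lemma tbarP (a : A) : tbar a != a /\ (forall b, (s b == s a) = (b == a) || (b == tbar a)).
Proof.
case: wsa => _ deg _ _ _.
have [/eqP + _] := deg (s a); rewrite -cardsE => /cards2P[x [y [xy E]]].
have mem b : (s b == s a) = (b == x) || (b == y).
  by have := in_set2 b x y; rewrite -E !inE.
rewrite /tbar; case: pickP => [b /andP[ba sb]|no] /=.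
  split=> // c; rewrite mem; move: sb (eqxx (s a)); rewrite !mem => /orP[] /eqP eb /orP[] /eqP ea.
  - by rewrite ea eb eqxx in ba.
  - by rewrite ea eb orbC.
  - by rewrite ea eb.
  - by rewrite ea eb eqxx in ba.
exfalso; have := eqxx (s a); rewrite mem => /orP[] /eqP ea.
  by have := no y; rewrite mem eqxx orbT andbT ea eq_sym (negPf xy).
by have := no x; rewrite mem eqxx andbT ea (negPf xy).
Qed.

Lemma tbar_neq (a : A) : tbar a != a. Proof. exact: (tbarP a).1. Qed.
Lemma ts_eq (a b : A) : (s a == s b) = (b == a) || (b == tbar a).
Proof. by rewrite eq_sym (tbarP a).2. Qed.
Lemma ts_bar (a : A) : s (tbar a) = s a.
Proof. by apply/eqP; rewrite (tbarP a).2 eqxx orbT. Qed.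
Lemma tbarK : involutive (@tbar K Q).
Proof.
move=> a; have := (tbarP (tbar a)).2 a; rewrite ts_bar eqxx => /esym/orP[]/eqP e //.
by have := tbar_neq a; rewrite -e eqxx.
Qed.
Lemma tf3 (a : A) : f (f (f a)) = a. Proof. by case: wsa => _ _ [_ _ ->]. Qed.
Lemma ts_f (a : A) : s (f a) = t a. Proof. by case: wsa => _ _ [_ -> _]. Qed.
Lemma tg_inj : injective (@tg K Q).
Proof. by case: wsa => _ _ [fi _ _] _ _ a b /(inv_inj tbarK) /fi. Qed.

Lemma tn_g (a : A) : tn (tg a) = tn a.
Proof.
exact/order_id_cycle/cycle_orbit/tg_inj.
Qed.

Lemma tN_g (a : A) : tN (tg a) = tN a.
Proof. by rewrite /tN tn_g; case: wsa => _ _ _ /(_ a)[_ _ -> _] _. Qed.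
Lemma tN_ge2 (a : A) : (1 < tN a)%N.
Proof. by case: wsa => _ _ _ _ /(_ a)[]. Qed.
Lemma tn_dvd (a : A) : (order (fun a : A => tbar (f a)) a %| tN a)%N.
Proof. exact: dvdn_mull. Qed.
Lemma tN_vir3 (a : A) : tN a = 2 -> (2 < tN (tbar a))%N.
Proof.
case: wsa => _ _ _ _ /(_ (tbar a))[]; rewrite /tvirtual -!/(tN _) tbarK => _ h3 h4 e.
by case: (eqVneq (s a) (t a)) => st; [apply/ltnW/h4 | apply: h3]; rewrite ?e.
Qed.
(** An arrow fixed by [g] is a loop; in this form the condition on virtual loops speaks of [f] and
    [bar] only. *)
Lemma tN_vir4 (a : A) : tN a = 2 -> tbar (f a) = a -> (3 < tN (tbar a))%N.
Proof.
case: wsa => _ _ _ _ /(_ (tbar a))[]; rewrite /tvirtual -!/(tN _) tbarK => _ _ h4 e l.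
by apply: h4; rewrite ?e // -ts_f -[in LHS]l ts_bar.
Qed.

(** Arrows that meet at a vertex are linked by [f] and [bar], so connectedness of the quiver becomes
    transitivity of the group that these two generate. *)
Lemma arrows_connected (S : {set A}) a0 : a0 \in S ->
  (forall a, a \in S -> f a \in S) -> (forall a, a \in S -> tbar a \in S) -> forall a, a \in S.
Proof.
move=> aS Sf Sb.
case: wsa => [[_ conn] _ _ _ _].
have Ss a b : s a = s b -> a \in S -> b \in S.
  by move/eqP; rewrite ts_eq => /orP[]/eqP-> // /Sb.
have Sst a b : t a = s b -> a \in S <-> b \in S.
  rewrite -ts_f => e; split=> [aS'|bS]; first exact: Ss e (Sf _ aS').
  by rewrite -(tf3 a); apply/Sf/Sf/(Ss _ _ (esym e)).
move=> a; have /connectP[p] := conn (s a0) (s a).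
have : exists2 b, b \in S & s b = s a0 by exists a0.
elim: p (s a0) => [|w p IH] v [b bS sb] /=.
  by move=> _ e; apply: Ss bS; rewrite sb e.
case/andP => /existsP[c /orP[]/andP[/eqP e1 /eqP e2]]; apply: IH.
  have cS : c \in S by apply: Ss bS; rewrite sb.
  by exists (f c); rewrite ?Sf // ts_f.
by exists c => //; apply/(Sst c b) => //; rewrite e1.
Qed.

Lemma source_arrow (v : tV Q) : exists a, s a = v.
Proof.
case: wsa => _ deg _ _ _; have [+ _] := deg v.
case: (pickP [pred a | s a == v]) => [a /eqP e _|no]; first by exists a.
by rewrite eq_card0.
Qed.

(** Both paths end at the source of $f^2(a)$, because $g(f^2(a))=\bar a$. *)
Lemma Apath_target (a : A) : ptarget t (Apath (tbar a)) = ptarget t (s a, [:: a; f a]).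
Proof.
rewrite /ptarget /= /Apath; have N2 := tN_ge2 (tbar a).
have gN : iter (tN (tbar a)) (@tg K Q) (tbar a) = tbar a.
  by rewrite /tN; elim: (tm _ _) => // m IH; rewrite mulSn iterD IH iter_order //; apply: tg_inj.
rewrite -/(tN _) (_ : (tN (tbar a)).-1 = (tN (tbar a) - 2).+1); last by lia.
rewrite (_ : iota 0 _.+1 = iota 0 (tN (tbar a) - 2) ++ [:: (tN (tbar a) - 2)%N]); last first.
  by rewrite -addn1 iotaD.
rewrite !map_cat last_cat /= -!ts_f -ts_bar -/(tg _) -iterS; congr (s _).
apply: tg_inj; rewrite -iterS (_ : (tN (tbar a) - 2).+2 = tN (tbar a)); last by lia.
by rewrite gN /tg tf3.
Qed.

End WsaFacts.

Lemma tbar_uniq (K : fieldType) (Q : tqdata K) (a b : tA Q) :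
  (forall c, (c != a) && (ts Q c == ts Q a) = (c == b)) -> tbar a = b.
Proof.
move=> H; rewrite /tbar; case: pickP => [c|/(_ b)] /=; rewrite H ?eqxx //.
by move/eqP.
Qed.

Lemma order_conj (T T' : finType) (h : T -> T) (h' : T' -> T') (u : T -> T') x :
  injective u -> (forall y, u (h y) = h' (u y)) -> order h' (u x) = order h x.
Proof.
move=> ui uh; have it k y : iter k h' (u y) = u (iter k h y) by elim: k => //= k ->.
rewrite /order -(card_image ui); apply: eq_card => y; rewrite -!topredE /=.
apply/idP/mapP => [c|[z]].
  exists (iter (findex h' (u x) y) h x); last by rewrite -it iter_findex.
  by rewrite mem_enum -topredE /= fconnect_iter.
by rewrite mem_enum -topredE /= => c ->; rewrite -(iter_findex c) -it fconnect_iter.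
Qed.

(** What makes the two sides of each binomial relation parallel. It passes along [tq_morph], which
    supplies it for the target data. *)
Definition tq_basic (K : fieldType) (Q : tqdata K) :=
  [/\ (forall a : tA Q, ts Q (tbar a) = ts Q a), (forall a : tA Q, ts Q (tf Q a) = tt Q a) &
      (forall a : tA Q, ptarget (tt Q) (Apath (tbar a)) = ptarget (tt Q) (ts Q a, [:: a; tf Q a]))].

Lemma wsa_basic (K : fieldType) (Q : tqdata K) : is_wsa Q -> tq_basic Q.
Proof. by move=> w; split=> a; [exact: ts_bar | exact: ts_f | exact: Apath_target]. Qed.

(** * Isomorphisms by rescaling arrows *)

Section Transport.
Variables (K : fieldType) (Q Q' : tqdata K).
Variables (hV : tV Q -> tV Q') (hA : tA Q -> tA Q').
Variable (k : tA Q -> K).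
Definition tq_morph :=
  [/\ injective hV, injective hA,
      (forall a, ts Q' (hA a) = hV (ts Q a)) /\ (forall a, tt Q' (hA a) = hV (tt Q a)),
      (forall a, hA (tf Q a) = tf Q' (hA a)) /\ (forall a, hA (tbar a) = tbar (hA a)) &
      (forall a, tm Q' (hA a) = tm Q a)].
(** Under this equation $a\mapsto k_a\,h(a)$ carries the binomial relation of $a$ to $k_a k_{f(a)}$
    times that of $h(a)$. *)
Definition scaling := forall a,
  tc Q (tbar a) * \prod_(b <- (Apath (tbar a)).2) k b = k a * k (tf Q a) * tc Q' (hA (tbar a)).

Hypothesis iso : tq_morph.

Let hAg a : hA (tg a) = tg (hA a).
Proof. by case: iso => _ _ _ [hf hb] _; rewrite /tg hb hf. Qed.

Let hAn a : tn (hA a) = tn a.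
Proof. by case: iso => _ hi _ _ _; apply: order_conj. Qed.

Let hAN a : tN (hA a) = tN a.
Proof. by case: iso => _ _ _ _ hm; rewrite /tN hAn hm. Qed.

Let hA_vir a : tvirtual (hA a) = tvirtual a.
Proof. by rewrite /tvirtual -!/(tN _) hAN. Qed.

Let hA_iter j a : hA (iter j (@tg K Q) a) = iter j (@tg K Q') (hA a).
Proof. by elim: j => //= j <-. Qed.

Let hAp l : mpath (fun a => [:: hA a]) l = map hA l.
Proof. by rewrite /mpath; elim: l => //= a l ->. Qed.

Let hApath a : msubst hV (fun a => [:: hA a]) (Apath a) = Apath (hA a).
Proof.
case: iso => _ _ [hs _] _ _; rewrite /msubst hAp /= -hs /Apath -!/(tN _) hAN -map_comp.
by congr (_, _); apply: eq_map => j /=; apply: hA_iter.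
Qed.

Let hA_target p : ptarget (tt Q') (hV p.1, map hA p.2) = hV (ptarget (tt Q) p).
Proof.
case: iso => _ _ [_ ht] _ _; case: p => v l; rewrite /ptarget /= -map_comp.
by elim: l v => //= a l IH v; rewrite ht IH.
Qed.

Lemma tq_morph_monomial :
  monomial_data (ts Q) (tt Q) (ts Q') (tt Q') hV (fun a => [:: hA a]).
Proof. by case: iso => hi _ [hs ht] _ _; split=> // a; rewrite /= ?hs ?eqxx // /ptarget /= ht. Qed.

Lemma tq_basic_transport : tq_basic Q -> (forall a', exists a, hA a = a') -> tq_basic Q'.
Proof.
case: (iso) => hi hAi [hs ht] [hf hb] hm [b1 b2 b3] surj.
split=> a'; have [a <-] := surj a'.
- by rewrite -hb !hs b1.
- by rewrite -hf hs ht b2.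
rewrite -hb -hApath /msubst hAp hA_target b3 -hA_target /=.
by rewrite hs hf.
Qed.

Hypothesis basic : tq_basic Q.
Hypothesis sc : scaling.

Lemma scaling_rels r : r \in Lam_rels Q ->
  in_ideal (ts Q') (tt Q') (Lam_rels Q') (mmap hV k (fun a => [:: hA a]) r).
Proof.
case: (iso) => hi hAi [hs ht] [hf hb] hm; case: basic => tsb tsf Apt.
have zero a b c : ts Q b = tt Q a -> ts Q c = tt Q b ->
    kq_path (ts Q' (hA a), [:: hA a; hA b; hA c]) \in Lam_rels Q' ->
    in_ideal (ts Q') (tt Q') (Lam_rels Q')
     (mmap hV k (fun a => [:: hA a]) (kq_path (ts Q a, [:: a; b; c]))).
  move=> e1 e2 inR; apply: mzero_path.
  rewrite /msubst hAp /= -hs; apply: (@ideal_gen _ _ _ _ _ _ (ts Q' (hA a)) (tt Q' (hA c))) => //.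
  by move=> u; rewrite inE => /eqP->.
rewrite !mem_cat => /or3P[] /mapP[a].
- move=> _ ->; have R'a : kq_sub (kq_path (ts Q' (hA a), [:: hA a; tf Q' (hA a)]))
      (kq_scale (tc Q' (tbar (hA a))) (kq_path (Apath (tbar (hA a))))) \in Lam_rels Q'.
    rewrite /Lam_rels mem_cat; apply/orP; left; apply/mapP; exists (hA a) => //.
    by rewrite mem_enum.
  have IR := @ideal_gen K (tV Q') (tA Q') (ts Q') (tt Q') _ (ts Q' (hA a)) (hV (tt Q (tf Q a))) _ _ R'a.
  have {}IR := ideal_scale (k a * k (tf Q a)) (IR _).
  apply: ideal_ev (IR _) => [h hv|u]; last first.
    rewrite !inE => /orP[]/eqP->; first by rewrite /ptarget /= -hf ht.
    rewrite -hb -hApath; split; first by rewrite /= tsb hs.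
    by rewrite /msubst hAp hA_target Apt.
  rewrite ev_mmap ev_scale !ev_sub !ev_scale !ev_one /pull hApath -!hb /mcoef /=.
  rewrite !big_cons big_nil /msubst hAp /= -!hs -hf !mul1r mulr1.
  rewrite mulrBr; congr (_ - _); rewrite [LHS]mulrA [RHS]mulrA; congr (_ * _).
  exact/esym/sc.
- rewrite mem_filter => /andP[nv _] ->; apply: zero; rewrite ?hAg.
  + by rewrite tsf.
  + by rewrite tsb tsf.
  rewrite /Lam_rels !mem_cat; apply/orP; right; apply/orP; left; apply/mapP; exists (hA a).
    by rewrite mem_filter mem_enum -!hf hA_vir nv.
  by rewrite -!hf.
rewrite mem_filter => /andP[nv _] ->; apply: zero; rewrite ?hAg.
+ by rewrite tsb tsf.
+ by rewrite tsf.
rewrite /Lam_rels !mem_cat; apply/orP; right; apply/orP; right; apply/mapP; exists (hA a).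
  by rewrite mem_filter mem_enum -!hf hA_vir nv.
by rewrite hf hAg.
Qed.
End Transport.

Theorem scaling_alg_iso (K : fieldType) (Q Q' : tqdata K) (hV : tV Q -> tV Q') (hA : tA Q -> tA Q')
    (gV : tV Q' -> tV Q) (k : tA Q -> K) :
  is_wsa Q -> tq_morph hV hA -> cancel hV gV -> cancel gV hV -> (forall a', exists a, hA a = a') ->
  (forall a, k a != 0) -> scaling hA k -> alg_iso (LamP Q) (LamP Q').
Proof.
move=> wsa iso hVK gVK surj k0 sc; have basic := wsa_basic wsa.
have basic' := tq_basic_transport iso basic surj.
case: (iso) => hi hAi [hs ht] [hf hb] hm.
have bij : bijective hA.
  apply: inj_card_bij => //.
  rewrite -(card_codom hAi); apply: subset_leq_card; apply/subsetP => a' _.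
  by have [a <-] := surj a'; apply: codom_f.
case: bij => gA hAK gAK.
have gs a' : ts Q (gA a') = gV (ts Q' a') by rewrite -{2}(gAK a') hs hVK.
have iso' : tq_morph gV gA.
  split=> [||||a']; [exact: can_inj gVK | exact: can_inj gAK | split=> a' | split=> a' |].
  - exact: gs.
  - by rewrite -{2}(gAK a') ht hVK.
  - by apply: hAi; rewrite gAK hf gAK.
  - by apply: hAi; rewrite gAK hb gAK.
  - by rewrite -{2}(gAK a') hm.
pose k' a' := (k (gA a'))^-1.
have mcK l : mcoef k' (map hA l) = (mcoef k l)^-1.
  rewrite /mcoef; elim: l => [|a l IH] /=; rewrite ?big_nil ?invr1 // !big_cons IH invfM.
  by rewrite /k' hAK.
have ck l : mcoef k l != 0 by rewrite /mcoef; elim: l => [|a l IH]; rewrite ?big_nil ?oner_eq0 // big_cons mulf_neq0.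
have sc' : scaling gA k'.
  move=> a'; rewrite -(gAK a'); set a := gA a'.
  have e : (Apath (tbar (hA a))).2 = map hA (Apath (tbar a)).2.
    rewrite -hb /Apath /= -/(tN _) -/(tN _) (_ : tN (hA (tbar a)) = tN (tbar a)); last first.
      by rewrite /tN hm /tn (order_conj (h := @tg K Q) _ hAi) // => y; rewrite /tg hb hf.
    rewrite -map_comp; apply: eq_map => j /=; elim: j => //= j ->.
    by rewrite /tg hb hf.
  rewrite e -/(mcoef k' _) mcK -hb -hf hAK /k' !hAK.
  have := sc a; rewrite -/(mcoef k _) => E.
  apply: (mulfI (ck (Apath (tbar a)).2)); apply: (mulfI (mulf_neq0 (k0 a) (k0 (tf Q a)))).
  rewrite -invfM [_ * (_ / _)]mulrCA; set M := mcoef _ _ in E *.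
  have M0 : M != 0 by apply: ck.
  have ka := k0 a; have kf := k0 (tf Q a).
  transitivity (k a * k (tf Q a) * tc Q' (hA (tbar a))); first by field.
  rewrite -E; by field; rewrite kf.
have mono := tq_morph_monomial iso; have mono' := tq_morph_monomial iso'.
apply: (monomial_alg_iso (P := LamP Q) (P' := LamP Q') (xk := k) (yk := k') mono mono') => //.
- exact: scaling_rels.
- exact: scaling_rels.
- move=> a; apply: mcong_eq; rewrite /mcoef /mpath /= big_seq1 /k' hAK.
  by rewrite mulfV.
move=> a'; apply: mcong_eq; rewrite /mcoef /mpath /= big_seq1 /k' gAK.
by rewrite mulVf.
Qed.

(** * Comparison with a tabulated quiver *)

Section Table.
Variables (K : fieldType) (Q : tqdata K).
Hypothesis wsa : is_wsa Q.
Variables (nv na : nat) (sl tl fl ml : seq nat) (cl : seq K) (c0 : K) (il Nl : seq nat).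
Let Q' := mkTQ nv na sl tl fl ml cl c0.
Variable h : nat -> tA Q.
Local Notation S k := (nth 0%N sl k).
Local Notation F k := (nth 0%N fl k).
Local Notation I k := (nth 0%N il k).

(** [il] tabulates [bar], and [Nl] the products $mn$. This part is checked by computation; what
    remains for [Q] is a numbering [h] of its arrows that respects [f] and [bar]. *)
Definition table_ok :=
  [&& all (fun k => [&& S k <= nv, F k <= na, I k <= na & nth 0%N tl k == S (F k)]%N) (iota 0 na.+1),
      all (fun k => all (fun j => (S k == S j) == (j == k) || (j == I k)) (iota 0 na.+1)) (iota 0 na.+1) &
      all (fun v => has (fun k => S k == v) (iota 0 na.+1)) (iota 0 nv.+1)].

Hypothesis ok : table_ok.
Hypothesis hF : forall k, (k <= na)%N -> h (F k) = tf Q (h k).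
Hypothesis hI : forall k, (k <= na)%N -> h (I k) = tbar (h k).
Hypothesis hinj : forall j k, (j <= na)%N -> (k <= na)%N -> h j = h k -> j = k.
Hypothesis hsurj : forall a, exists2 k, (k <= na)%N & h k = a.
Hypothesis hm : forall k, (k <= na)%N -> tm Q (h k) = nth 0%N ml k.
Hypothesis hN : forall k, (k <= na)%N -> tN (h k) = nth 0%N Nl k.
Variable kap : nat -> K.
Hypothesis kap0 : forall k, (k <= na)%N -> kap k != 0.
Hypothesis hsc : forall k, (k <= na)%N ->
  tc Q (h (I k)) * \prod_(i <- iota 0 (nth 0%N Nl (I k)).-1) kap (iter i (fun j => I (F j)) (I k)) =
  kap k * kap (F k) * nth c0 cl (I k).

Let okF k : (k <= na)%N -> [/\ (S k <= nv)%N, (F k <= na)%N, (I k <= na)%N & nth 0%N tl k = S (F k)].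
Proof.
move=> kn; case/and3P: ok => /allP/(_ k) H _ _; have /H/and4P[] : k \in iota 0 na.+1 by rewrite mem_iota.
by move=> ? ? ? /eqP.
Qed.
Let okS k j : (k <= na)%N -> (j <= na)%N -> (S k == S j) = (j == k) || (j == I k).
Proof.
move=> kn jn; case/and3P: ok => _ /allP/(_ k) H _; have /H/allP/(_ j) H' : k \in iota 0 na.+1 by rewrite mem_iota.
by have /H'/eqP : j \in iota 0 na.+1 by rewrite mem_iota.
Qed.
Let okV v : (v <= nv)%N -> exists2 k, (k <= na)%N & S k = v.
Proof.
move=> vn; case/and3P: ok => _ _ /allP/(_ v) H; have /H/hasP[k] : v \in iota 0 nv.+1 by rewrite mem_iota.
by rewrite mem_iota => /andP[_ kn] /eqP e; exists k.
Qed.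

Let hA (a : tA Q) : tA Q' := odflt ord0 [pick k : 'I_na.+1 | h k == a].
Let hAK a : h (hA a) = a.
Proof.
rewrite /hA; case: pickP => [k /eqP //|no]; have [k kn e] := hsurj a.
by have := no (Ordinal (kn : (k < na.+1)%N)); rewrite /= e eqxx.
Qed.
Let le (k : 'I_na.+1) : (k <= na)%N. Proof. by rewrite -ltnS. Qed.
Let hA_h k : (k <= na)%N -> hA (h k) = k :> nat.
Proof. by move=> kn; apply: hinj => //; rewrite ?hAK ?le. Qed.
Let hA_f a : hA (tf Q a) = F (hA a) :> nat.
Proof. by have [_ ? _ _] := okF (le (hA a)); apply: hinj; rewrite ?le // hAK hF ?le ?hAK. Qed.
Let hA_b a : hA (tbar a) = I (hA a) :> nat.
Proof. by have [_ _ ? _] := okF (le (hA a)); apply: hinj; rewrite ?le // hAK hI ?le ?hAK. Qed.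
Let hA_inj : injective hA.
Proof. by move=> a b e; rewrite -(hAK a) e hAK. Qed.
Let s'E (k j : 'I_na.+1) : (ts Q' k == ts Q' j) = (S k == S j).
Proof.
have [Sk _ _ _] := okF (le k); have [Sj _ _ _] := okF (le j).
by rewrite -(inj_eq val_inj) /= !inordK.
Qed.
Let sE' a b : (ts Q' (hA a) == ts Q' (hA b)) = (ts Q a == ts Q b).
Proof.
rewrite s'E okS ?le // (ts_eq wsa) -!hA_b.
by rewrite (inj_eq val_inj) -!(inj_eq hA_inj) -(inj_eq val_inj).
Qed.
Let hV (v : tV Q) : tV Q' := if [pick a | ts Q a == v] is Some a then ts Q' (hA a) else ord0.
Let hVs a : ts Q' (hA a) = hV (ts Q a).
Proof.
rewrite /hV; case: pickP => [b sb|/(_ a)]; last by rewrite eqxx.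
by apply/eqP; rewrite sE' eq_sym.
Qed.
Let hV_inj : injective hV.
Proof.
move=> v w; have [a <-] := source_arrow wsa v; have [b <-] := source_arrow wsa w.
by rewrite -!hVs => /eqP; rewrite sE' => /eqP.
Qed.

Theorem table_alg_iso : alg_iso (LamP Q) (LamP Q').
Proof.
have surj (a' : tA Q') : exists a, hA a = a'.
  by exists (h a'); apply: val_inj; rewrite /= hA_h ?le.
have iso : tq_morph hV hA.
  split=> //; [split=> // a | split=> a | move=> a].
  - rewrite -(ts_f wsa) -hVs /= hA_f; have [_ _ _ ->] := okF (le (hA a)).
    by [].
  - by apply: val_inj; rewrite /= inordK ?hA_f //; have [_ ? _ _] := okF (le (hA a)).
  - apply/esym/tbar_uniq => c; have [c' <-] := surj c; rewrite sE' (tbarP wsa a).2 !(inj_eq hA_inj).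
    case: (eqVneq c' a) => [->|] //=; rewrite eq_sym; apply/esym/negbTE; exact: tbar_neq.
  - by rewrite /= -hm ?le // hAK.
pose gV (v' : tV Q') : tV Q := odflt (ts Q (h 0)) [pick v | hV v == v'].
have hVsurj v' : exists v, hV v = v'.
  have [|k kn Sk] := okV (v := v'); first by rewrite -ltnS.
  exists (ts Q (h k)); rewrite -hVs; apply: val_inj; rewrite /= hA_h // Sk.
  by rewrite inord_val.
have gVK : cancel gV hV.
  move=> v'; rewrite /gV; case: pickP => [v /eqP //|no]; have [v e] := hVsurj v'.
  by have := no v; rewrite e eqxx.
have hVK : cancel hV gV by move=> v; apply: hV_inj; rewrite gVK.
apply: (scaling_alg_iso (k := fun a => kap (hA a)) wsa iso hVK gVK surj).
  by move=> a; apply: kap0; apply: le.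
move=> a; rewrite /= hA_f hA_b -(hsc (le (hA a))).
have [_ _ Ik _] := okF (le (hA a)).
rewrite -/(tN _) -hN // hI ?le // hAK; congr (_ * _); rewrite big_map; apply: eq_bigr => i _.
congr kap; elim: i => [|i IH] /=; first by rewrite hA_b.
by rewrite hA_b hA_f IH.
Qed.
End Table.

(** * Rigid arrow automata *)

Local Close Scope ring_scope.

Section Rigid.
Variables (A : finType) (bar f : A -> A) (N : A -> nat).
Hypothesis barK : involutive bar.
Hypothesis bar_neq : forall a, bar a != a.
Hypothesis f3 : forall a, f (f (f a)) = a.
Local Notation g := (fun a => bar (f a)).
Hypothesis Ng : forall a, N (bar (f a)) = N a.
Hypothesis N2 : forall a, 1 < N a.
Hypothesis Nord : forall a, order (fun a => bar (f a)) a %| N a.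
Hypothesis Nvir3 : forall a, N a = 2 -> 2 < N (bar a).
Hypothesis conn : forall (S : {set A}) a0, a0 \in S ->
  (forall a, a \in S -> f a \in S) -> (forall a, a \in S -> bar a \in S) -> forall a, a \in S.

Local Notation vr := (vir N).
Local Notation gd := (good bar N).
Local Notation G := (gnext bar f N).
Hypothesis no_broken : forall a, ~~ broken bar f N a.
Hypothesis rigid : forall a, gd a -> ~~ allowed bar f N a.

Let gd_bar a : gd (bar a) = gd a := good_bar N barK a.
Let gd_G a : gd a -> gd (G a) := @good_gnext A bar f N barK f3 Ng Nvir3 a.
Let GN a : N (G a) = N a := gnextN Ng a.
Let G_inj := gnext_inj barK f3 (N := N).
Let gN a : iter (N a) g a = a := iter_g_order barK f3 Nord a.

(** Not being allowed bounds [N a] by 5. For [N = 4] and [f a] not virtual, $g^3(a)$ would be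
    allowed or have the same successor as $a$. For [N = 5] all steps would be double, and three of
    them would lead to $g^6(a)=g(a)$, which is not good. *)
Lemma rigid_good a : gd a -> (N a = 3 /\ ~~ vr (f a)) \/ (N a = 4 /\ vr (f a)).
Proof.
have nal b : gd b -> N b < (vr (f b)).+1 + (vr (f (G b))).+1 + 2.
  by move=> gb; have := rigid gb; rewrite /allowed /len -ltnNge.
move=> ga; have N3 := good_N N2 ga; have al := nal a ga.
have : [|| N a == 3, N a == 4 | N a == 5].
  by move: al; case: (vr _); case: (vr _) => /=; lia.
case/or3P => /eqP Na.
- by left; split=> //; have := no_broken a; rewrite /broken ga Na eqxx andbT.
- right; split=> //; apply: contraT => nv.
  have e1 : G a = bar (f a) by rewrite /gnext (negPf nv).
  have v1 : vr (f (G a)) by move: al; rewrite Na (negPf nv); case: (vr _).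
  have e2 : G (G a) = iter 3 g a by rewrite {1}/gnext v1 e1.
  have g3 : gd (iter 3 g a) by rewrite -e2 !gd_G.
  have e4 : iter 4 g a = a by rewrite -Na gN.
  have N3' : N (iter 3 g a) = 4 by rewrite -e2 !GN.
  have := nal _ g3; rewrite N3'; case v3: (vr (f (iter 3 g a))).
    have e3 : G (iter 3 g a) = G a.
      by rewrite e1 /gnext v3; congr (bar (f _)); exact: e4.
    have ea := G_inj g3 ga e3; rewrite ea in v3.
    by rewrite v3 in nv.
  have -> : G (iter 3 g a) = a by rewrite /gnext v3; exact: e4.
  by rewrite (negPf nv).
have [v0 v1] : vr (f a) /\ vr (f (G a)).
  by move: al; rewrite Na; case: (vr _); case: (vr _).
have al2 := nal _ (gd_G (gd_G ga)); have al1 := nal _ (gd_G ga).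
rewrite !GN Na v1 in al1 al2.
have v2 : vr (f (G (G a))) by move: al1; case: (vr _).
have e1 : G a = iter 2 g a by rewrite /gnext v0.
have e2 : G (G a) = iter 4 g a by rewrite {1}/gnext v1 e1.
have e3 : G (G (G a)) = iter 1 g a.
  rewrite {1}/gnext v2 e2 /=; congr (bar (f _)).
  by have := gN a; rewrite Na.
by have := gd_G (gd_G (gd_G ga)); rewrite e3 /good /= barK v0 andbF.
Qed.

Lemma exists_good (a : A) : exists b, gd b.
Proof.
have key b : vr b -> gd (f (f b)).
  move=> vb; have vf := vir_f barK Ng Nvir3.
  rewrite /good; apply/andP; split.
    by apply/negP => /vf; rewrite f3 vb.
  by rewrite -(vir_ff f3 Ng) f3 vf.
case va: (vr a); first by exists (f (f a)); apply: key.
case vb: (vr (bar a)); first by exists (f (f (bar a))); apply: key.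
by exists a; rewrite /good va vb.
Qed.

Definition dbl a := gd a && vr (f a).

Lemma dblN a : gd a -> dbl a = (N a == 4).
Proof. by move=> ga; rewrite /dbl ga /=; case: (rigid_good ga) => -[-> v]; rewrite ?v ?(negPf v). Qed.

Lemma dbl_G a : dbl a -> dbl (G a).
Proof. by case/andP => ga va; rewrite dblN ?gd_G // GN -dblN // /dbl ga. Qed.

Lemma dbl_fprime a : dbl a -> dbl (bar (G a)).
Proof.
by case/andP => ga va; rewrite /dbl gd_bar gd_G // (len_fprime barK f3 Ng ga).
Qed.

Lemma dbl_GE a : dbl a -> G a = bar (f (bar (f a))).
Proof. by case/andP => _ v; rewrite /gnext v. Qed.

Lemma dbl_N a : dbl a -> N a = 4.
Proof. by move=> da; case/andP: (da) => ga _; apply/eqP; rewrite -dblN. Qed.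

Lemma dbl_GG a : dbl a -> G (G a) = a.
Proof.
move=> da; rewrite (dbl_GE (dbl_G da)) (dbl_GE da).
by have := gN a; rewrite (dbl_N da).
Qed.

Lemma dbl_bar a : dbl a -> dbl (bar a).
Proof. by move=> da; rewrite -(dbl_GG da); apply/dbl_fprime/dbl_G. Qed.

Lemma dbl_fg a : dbl a -> f (bar (f a)) = bar (G a).
Proof. by move=> da; rewrite dbl_GE // barK. Qed.

Lemma dbl_ff a : dbl a -> f (f a) = bar (f (G (bar a))).
Proof.
move=> da; have db := dbl_bar da; apply: (f_injective f3).
by rewrite f3 dbl_fg ?dbl_G // dbl_GG // barK.
Qed.

(** Since [N (f a) = 2], $g^2$ fixes [f a]. Rewritten by [dbl_ff] this says
    [G (bar (G (bar a))) = a], and [G] is an involution here. *)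
Lemma dbl_comm a : dbl a -> G (bar a) = bar (G a).
Proof.
move=> da; have db := dbl_bar da; have dc := dbl_bar (dbl_G db).
have e (b : A) : dbl b -> bar (f (f b)) = f (G (bar b)) by move=> dB; rewrite dbl_ff // barK.
have : f (G (bar (G (bar a)))) = f a.
  have /andP[_ /eqP vfa] := da; rewrite -e ?dbl_G // -e //.
  by have := gN (f a); rewrite vfa.
move/(f_injective f3) => E; rewrite -[in RHS]E dbl_GG // barK //.
Qed.

(** If no good arrow has a virtual [f a], then [f] preserves good arrows, as [bar] does; by
    connectedness all arrows are good, with [N = 3]. *)
Theorem rigid_dichotomy (a0 : A) : (forall a, N a = 3) \/ exists x, dbl x.
Proof.
case: (pickP dbl) => [x dx|no]; first by right; exists x.
left; have [b gb] := exists_good a0.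
have ngd a : gd a -> N a = 3 /\ ~~ vr (f a).
  move=> ga; case: (rigid_good ga) => // -[_ v]; by have := no a; rewrite /dbl ga v.
have gf a : gd a -> gd (f a).
  move=> ga; have [_ nv] := ngd a ga; have := gd_G ga.
  by rewrite /gnext (negPf nv) gd_bar.
move=> a; have : a \in [set a | gd a].
  by apply: (@conn _ b) => [|c|c]; rewrite !inE ?gd_bar //; apply: gf.
by rewrite inE => /ngd [].
Qed.
End Rigid.

Local Open Scope ring_scope.

(** * The algebra T(lam) *)

Section Relations.
Variables (K : fieldType) (Q : tqdata K).
Hypothesis basic : tq_basic Q.
Local Notation cong := (mcong (ts Q) (tt Q) (Lam_rels Q)).
Local Notation zero := (mzero (ts Q) (tt Q) (Lam_rels Q)).

Lemma rel_cong (a : tA Q) :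
  cong (1, (ts Q a, [:: a; tf Q a])) (tc Q (tbar a), Apath (tbar a)).
Proof.
case: basic => b1 b2 b3.
have inR : kq_sub (kq_path (ts Q a, [:: a; tf Q a]))
   (kq_scale (tc Q (tbar a)) (kq_path (Apath (tbar a)))) \in Lam_rels Q.
  by rewrite /Lam_rels mem_cat; apply/orP; left; apply/mapP; exists a; rewrite ?mem_enum.
have H := @ideal_gen K _ _ (ts Q) (tt Q) _ (ts Q a) (ptarget (tt Q) (ts Q a, [:: a; tf Q a])) _ _ inR.
apply: ideal_ev (H _) => [h hv|u].
  by rewrite ev_sub ev_scale !ev_one ev_two /= !mul1r.
rewrite !inE => /orP[]/eqP-> //; split; first by rewrite /= b1.
exact: b3.
Qed.

Lemma path3_zero (a b c : tA Q) : kq_path (ts Q a, [:: a; b; c]) \in Lam_rels Q ->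
  zero (ts Q a, [:: a; b; c]).
Proof.
move=> inR; apply: mzero_path; apply: (@ideal_gen _ _ _ _ _ _ (ts Q a) (tt Q c)) => // u.
by rewrite inE => /eqP->.
Qed.

Lemma rel_zero1 (a : tA Q) : ~~ tvirtual (tf Q (tf Q a)) ->
  zero (ts Q a, [:: a; tf Q a; tg (tf Q a)]).
Proof.
move=> nv; apply: path3_zero; rewrite /Lam_rels !mem_cat; apply/orP; right; apply/orP; left.
by apply/mapP; exists a => //; rewrite mem_filter nv mem_enum.
Qed.

Lemma rel_zero2 (a : tA Q) : ~~ tvirtual (tf Q a) ->
  zero (ts Q a, [:: a; tg a; tf Q (tg a)]).
Proof.
move=> nv; apply: path3_zero; rewrite /Lam_rels !mem_cat; apply/orP; right; apply/orP; right.
by apply/mapP; exists a => //; rewrite mem_filter nv mem_enum.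
Qed.
End Relations.

Section MoreCong.
Variables (K : fieldType) (V A : finType) (s t : A -> V) (R : seq (kq K V A)).
Local Notation cong := (mcong s t R).
Local Notation zero := (mzero s t R).

Lemma mcong_adj c c' k k' p p' : c != 0 -> cong (c, p) (c', p') -> k * c' = k' * c ->
  cong (k, p) (k', p').
Proof.
move=> c0 H e; have := mcong_scale (k / c) H; rewrite /= divfK //.
by rewrite mulrAC e mulfK.
Qed.

End MoreCong.

Lemma mmap_rel (K : fieldType) (V A V' A' : finType) (s' t' : A' -> V') (R' : seq (kq K V' A'))
   (eV : V -> V') (xk : A -> K) (xl : A -> seq A') p p' c :
  mcong s' t' R' (mcoef xk p.2, msubst eV xl p) (c * mcoef xk p'.2, msubst eV xl p') ->
  in_ideal s' t' R' (mmap eV xk xl (kq_sub (kq_path p) (kq_scale c (kq_path p')))).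
Proof.
apply: ideal_ev => h hv; rewrite ev_mmap ev_sub ev_scale !ev_one ev_two /pull /=.
by rewrite !mul1r mulrA.
Qed.

(** Explicit lists of binomials and zero paths: they cover the given relations, and everything
    listed holds modulo the ideal. *)
Definition presented (K : fieldType) (P : pres K) (bs : seq (qpath (pV P) (pA P) * K * qpath (pV P) (pA P)))
    (zs : seq (qpath (pV P) (pA P))) :=
  [/\ {in prels P, forall r, r \in [seq kq_sub (kq_path b.1.1) (kq_scale b.1.2 (kq_path b.2)) | b <- bs] ++
                                   [seq kq_path z | z <- zs]},
      {in bs, forall b, mcong (ps P) (pt P) (prels P) (1, b.1.1) (b.1.2, b.2)}
    & {in zs, forall z, mzero (ps P) (pt P) (prels P) z}].

Section TriangleData.
Variables (K : fieldType) (lam : K).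
Let T := T_alg lam.
Local Notation a_ k := (inord k : tA T).
Local Notation il := [:: 5; 3; 4; 1; 2; 0]%N.
Local Notation gl := [:: 3; 4; 5; 0; 1; 2]%N.
Local Notation fl := [:: 1; 2; 0; 5; 3; 4]%N.
Local Notation sl := [:: 0; 1; 2; 1; 2; 0]%N.
Local Notation tl := [:: 1; 2; 0; 0; 1; 2]%N.

Lemma Ts k : (k <= 5)%N -> ts T (a_ k) = inord (nth 0%N sl k).
Proof. by move=> kn; rewrite /= inordK. Qed.
Lemma Tt k : (k <= 5)%N -> tt T (a_ k) = inord (nth 0%N tl k).
Proof. by move=> kn; rewrite /= inordK. Qed.
Lemma Tf k : (k <= 5)%N -> tf T (a_ k) = a_ (nth 0%N fl k).
Proof. by move=> kn; rewrite /= inordK. Qed.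
Lemma Tarrow (a : tA T) : exists2 k, (k <= 5)%N & a = a_ k.
Proof.
by exists (nat_of_ord (a : 'I_6)); [rewrite -ltnS; apply: ltn_ord | apply/esym/(@inord_val 5)].
Qed.

Lemma Tbar k : (k <= 5)%N -> tbar (a_ k) = a_ (nth 0%N il k).
Proof.
move=> kn; apply: tbar_uniq => c; have [j jn ->] := Tarrow c.
rewrite !Ts // -!val_eqE /= !inordK //.
all: by move: kn jn; case: k => [|[|[|[|[|[|k]]]]]] // _; case: j => [|[|[|[|[|[|j]]]]]].
Qed.

Lemma Tg k : (k <= 5)%N -> tg (a_ k) = a_ (nth 0%N gl k).
Proof.
move=> kn; rewrite /tg Tf // Tbar; last by case: k kn => [|[|[|[|[|[|k]]]]]].
by case: k kn => [|[|[|[|[|[|k]]]]]].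
Qed.

Lemma Tn k : (k <= 5)%N -> tn (a_ k) = 2%N.
Proof.
move=> kn; have gk : (nth 0 gl k <= 5)%N by case: k kn => [|[|[|[|[|[|k]]]]]].
have gg : nth 0%N gl (nth 0%N gl k) = k by case: k kn {gk} => [|[|[|[|[|[|k]]]]]].
rewrite /tn; apply: (@order_cycle _ (@tg K T) [:: a_ k; a_ (nth 0%N gl k)]).
- by rewrite /= Tg // Tg // gg !eqxx.
- rewrite /= inE -val_eqE /= !inordK // andbT.
  by case: k kn {gk gg} => [|[|[|[|[|[|k]]]]]].
- exact: mem_head.
Qed.

Lemma TN k : (k <= 5)%N -> tN (a_ k) = (nth 0 [:: 2; 2; 1; 2; 2; 1] k * 2)%N.
Proof. by move=> kn; rewrite /tN Tn //= inordK. Qed.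

Lemma TApath k : (k <= 5)%N -> Apath (a_ k) = (inord (nth 0%N sl k),
  if (k \in [:: 2; 5]%N) then [:: a_ k] else [:: a_ k; a_ (nth 0%N gl k); a_ k]).
Proof.
move=> kn; rewrite /Apath -/(tN _) TN // Ts //; congr (_, _).
by case: k kn => [|[|[|[|[|[|k]]]]]] // _ /=; rewrite ?Tg.
Qed.

Lemma Tvir k : (k <= 5)%N -> tvirtual (a_ k) = (k \in [:: 2; 5]%N).
Proof. by move=> kn; rewrite /tvirtual -/(tN _) TN //; case: k kn => [|[|[|[|[|[|k]]]]]]. Qed.

Lemma Tbasic : tq_basic T.
Proof.
split=> a; have [k kn ->] := Tarrow a.
- by rewrite Tbar // !Ts //; case: k kn => [|[|[|[|[|[|k]]]]]].
- by rewrite Tf // Tt // Ts; case: k kn => [|[|[|[|[|[|k]]]]]].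
have lastE w b (y z : tA T) : last w [seq tt T i | i <- if b then [:: y] else [:: y; z; y]] = tt T y.
  by case: b.
rewrite Tbar // TApath; last by case: k kn => [|[|[|[|[|[|k]]]]]].
rewrite /ptarget lastE Tf //; cbn [map last fst snd].
by rewrite !Tt; case: k kn => [|[|[|[|[|[|k]]]]]].
Qed.

Local Notation w_ k := (inord k%N : tV T).
Lemma Tc k : (k <= 5)%N -> tc T (a_ k) = nth 1 [:: lam; 1; 1; lam; 1; 1] k.
Proof. by move=> kn; rewrite /= inordK. Qed.

Lemma T_presented : presented (P := LamP T)
  [:: ((w_ 0, [:: a_ 0; a_ 1]), 1, (w_ 0, [:: a_ 5])); ((w_ 1, [:: a_ 1; a_ 2]), lam, (w_ 1, [:: a_ 3; a_ 0; a_ 3])); ((w_ 2, [:: a_ 2; a_ 0]), 1, (w_ 2, [:: a_ 4; a_ 1; a_ 4])); ((w_ 1, [:: a_ 3; a_ 5]), 1, (w_ 1, [:: a_ 1; a_ 4; a_ 1])); ((w_ 2, [:: a_ 4; a_ 3]), 1, (w_ 2, [:: a_ 2])); ((w_ 0, [:: a_ 5; a_ 4]), lam, (w_ 0, [:: a_ 0; a_ 3; a_ 0]))]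
  [:: (w_ 1, [:: a_ 1; a_ 2; a_ 5]); (w_ 2, [:: a_ 2; a_ 0; a_ 3]); (w_ 1, [:: a_ 3; a_ 5; a_ 2]); (w_ 0, [:: a_ 5; a_ 4; a_ 1]); (w_ 0, [:: a_ 0; a_ 3; a_ 5]); (w_ 2, [:: a_ 2; a_ 5; a_ 4]); (w_ 0, [:: a_ 5; a_ 2; a_ 0]); (w_ 2, [:: a_ 4; a_ 1; a_ 2])].
Proof.
split.
- move=> r; rewrite [prels _]/(Lam_rels T) /Lam_rels !mem_cat => /or3P[] /mapP[a].
  + have [k kn ->] := Tarrow a => _ ->; apply/orP; left; apply/mapP.
    exists (nth (w_ 0, [::], 0, (w_ 0, [::])) [:: ((w_ 0, [:: a_ 0; a_ 1]), 1, (w_ 0, [:: a_ 5])); ((w_ 1, [:: a_ 1; a_ 2]), lam, (w_ 1, [:: a_ 3; a_ 0; a_ 3])); ((w_ 2, [:: a_ 2; a_ 0]), 1, (w_ 2, [:: a_ 4; a_ 1; a_ 4])); ((w_ 1, [:: a_ 3; a_ 5]), 1, (w_ 1, [:: a_ 1; a_ 4; a_ 1])); ((w_ 2, [:: a_ 4; a_ 3]), 1, (w_ 2, [:: a_ 2])); ((w_ 0, [:: a_ 5; a_ 4]), lam, (w_ 0, [:: a_ 0; a_ 3; a_ 0]))] k); first exact: mem_nth.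
    by rewrite Ts // Tf // Tbar // Tc ?TApath; case: k kn => [|[|[|[|[|[|k]]]]]].
  + have [k kn ->] := Tarrow a; rewrite mem_filter !Tf ?Tvir; try by case: k kn => [|[|[|[|[|[|k]]]]]].
    move=> /andP[nv _] ->; apply/orP; right; apply/mapP.
    (* The index list sends an arrow to its zero path; at the arrows removed by the filter the entry
       0 is a dummy. The list for the other family of zero paths works in the same way. *)
    exists (nth (w_ 0, [::]) [:: (w_ 1, [:: a_ 1; a_ 2; a_ 5]); (w_ 2, [:: a_ 2; a_ 0; a_ 3]); (w_ 1, [:: a_ 3; a_ 5; a_ 2]); (w_ 0, [:: a_ 5; a_ 4; a_ 1]); (w_ 0, [:: a_ 0; a_ 3; a_ 5]); (w_ 2, [:: a_ 2; a_ 5; a_ 4]); (w_ 0, [:: a_ 5; a_ 2; a_ 0]); (w_ 2, [:: a_ 4; a_ 1; a_ 2])] (nth 0%N [:: 0; 0; 1; 2; 0; 3]%N k)).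
      by case: k kn {nv} => [|[|[|[|[|[|k]]]]]] // _; rewrite !inE eqxx ?orbT.
    rewrite Ts // Tg; last by case: k kn {nv} => [|[|[|[|[|[|k]]]]]].
    by case: k kn nv => [|[|[|[|[|[|k]]]]]].
  + have [k kn ->] := Tarrow a; rewrite mem_filter Tf //.
    rewrite Tvir; last by case: k kn => [|[|[|[|[|[|k]]]]]].
    move=> /andP[nv _] ->; apply/orP; right; apply/mapP.
    exists (nth (w_ 0, [::]) [:: (w_ 1, [:: a_ 1; a_ 2; a_ 5]); (w_ 2, [:: a_ 2; a_ 0; a_ 3]); (w_ 1, [:: a_ 3; a_ 5; a_ 2]); (w_ 0, [:: a_ 5; a_ 4; a_ 1]); (w_ 0, [:: a_ 0; a_ 3; a_ 5]); (w_ 2, [:: a_ 2; a_ 5; a_ 4]); (w_ 0, [:: a_ 5; a_ 2; a_ 0]); (w_ 2, [:: a_ 4; a_ 1; a_ 2])] (nth 0%N [:: 4; 0; 5; 0; 7; 6]%N k)).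
      by case: k kn {nv} => [|[|[|[|[|[|k]]]]]] // _; rewrite !inE eqxx ?orbT.
    rewrite Ts // Tg // Tf; last by case: k kn {nv} => [|[|[|[|[|[|k]]]]]].
    by case: k kn nv => [|[|[|[|[|[|k]]]]]].
- have H k : (k <= 5)%N -> mcong (ts T) (tt T) (Lam_rels T)
      (1, (inord (nth 0%N sl k), [:: a_ k; a_ (nth 0%N fl k)]))
      (nth 1 [:: lam; 1; 1; lam; 1; 1] (nth 0%N il k), (inord (nth 0%N sl (nth 0%N il k)),
        if (nth 0%N il k) \in [:: 2; 5]%N then [:: a_ (nth 0%N il k)]
        else [:: a_ (nth 0%N il k); a_ (nth 0%N gl (nth 0%N il k)); a_ (nth 0%N il k)])).
    move=> kn; have jn : (nth 0 il k <= 5)%N by case: k kn => [|[|[|[|[|[|k]]]]]].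
    by have := rel_cong Tbasic (a_ k); rewrite Tbar // TApath // Ts // Tf // Tc.
  move=> b; rewrite !inE; repeat (case/orP; first (move/eqP->)); last (move/eqP->).
  + exact: (H 0%N isT).
  + exact: (H 1%N isT).
  + exact: (H 2%N isT).
  + exact: (H 3%N isT).
  + exact: (H 4%N isT).
  + exact: (H 5%N isT).
- have fn k : (k <= 5 -> nth 0 fl k <= 5)%N by case: k => [|[|[|[|[|[|k]]]]]].
  have gn k : (k <= 5 -> nth 0 gl k <= 5)%N by case: k => [|[|[|[|[|[|k]]]]]].
  have H1 k : (k <= 5)%N -> nth 0%N fl (nth 0%N fl k) \notin [:: 2; 5]%N ->
      mzero (ts T) (tt T) (Lam_rels T)
      (inord (nth 0%N sl k), [:: a_ k; a_ (nth 0%N fl k); a_ (nth 0%N gl (nth 0%N fl k))]).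
    move=> kn nv; have := rel_zero1 (Q := T) (a := a_ k).
    by rewrite Ts // !Tf ?fn // Tg ?fn // Tvir ?fn //; apply.
  have H2 k : (k <= 5)%N -> nth 0%N fl k \notin [:: 2; 5]%N ->
      mzero (ts T) (tt T) (Lam_rels T)
      (inord (nth 0%N sl k), [:: a_ k; a_ (nth 0%N gl k); a_ (nth 0%N fl (nth 0%N gl k))]).
    move=> kn nv; have := rel_zero2 (Q := T) (a := a_ k).
    by rewrite Ts // Tg // !Tf ?gn // Tvir ?fn //; apply.
  move=> z; rewrite !inE; repeat (case/orP; first (move/eqP->)); last (move/eqP->).
  + exact: (H1 1%N isT isT).
  + exact: (H1 2%N isT isT).
  + exact: (H1 3%N isT isT).
  + exact: (H1 5%N isT isT).
  + exact: (H2 0%N isT isT).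
  + exact: (H2 2%N isT isT).
  + exact: (H2 5%N isT isT).
  + exact: (H2 4%N isT isT).
Qed.

Lemma T_arrows : uniq [:: a_ 0; a_ 1; a_ 2; a_ 3; a_ 4; a_ 5] /\
  forall a, a \in [:: a_ 0; a_ 1; a_ 2; a_ 3; a_ 4; a_ 5].
Proof.
split; first by rewrite /= !inE -!val_eqE /= !inordK.
move=> a; have [k kn ->] := Tarrow a.
by case: k kn => [|[|[|[|[|[|k]]]]]] // _; rewrite !inE eqxx ?orbT.
Qed.

Lemma T_vertices : uniq [:: w_ 0; w_ 1; w_ 2] /\ forall v, v \in [:: w_ 0; w_ 1; w_ 2].
Proof.
split; first by rewrite /= !inE -!val_eqE /= !inordK.
move=> v; rewrite -(@inord_val 2 v) !inE.
by case: v => -[|[|[|k]]] // i; rewrite eqxx ?orbT.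
Qed.

Lemma T_sources : [seq ts T a | a <- [:: a_ 0; a_ 1; a_ 2; a_ 3; a_ 4; a_ 5]] =
  [:: w_ 0; w_ 1; w_ 2; w_ 1; w_ 2; w_ 0].
Proof. by cbn [map]; rewrite !Ts. Qed.

Lemma T_targets : [seq tt T a | a <- [:: a_ 0; a_ 1; a_ 2; a_ 3; a_ 4; a_ 5]] =
  [:: w_ 1; w_ 2; w_ 0; w_ 0; w_ 1; w_ 2].
Proof. by cbn [map]; rewrite !Tt. Qed.
End TriangleData.

(** * The two-loop algebra *)

Section LoopsTriangle.
Variables (K : fieldType) (P P' : pres K) (c c1 c2 lam : K).
Variables (al be de ga xi ze : pA P) (v1 v2 v3 : pV P) (p0 p1 p2 p3 p4 p5 : pA P') (w1 w2 w3 : pV P').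
Let sA := [:: al; be; de; ga; xi; ze].
Let sV := [:: v1; v2; v3].
Let tA := [:: p0; p1; p2; p3; p4; p5].
Let tV := [:: w1; w2; w3].
Hypotheses (uA : uniq sA) (allA : forall a, a \in sA) (uV : uniq sV) (allV : forall v, v \in sV).
Hypotheses (uA' : uniq tA) (allA' : forall a, a \in tA) (uV' : uniq tV) (allV' : forall v, v \in tV).
Hypothesis sE : [seq ps P a | a <- sA] = [:: v2; v1; v2; v3; v1; v3].
Hypothesis tE : [seq pt P a | a <- sA] = [:: v1; v2; v3; v2; v1; v3].
Hypothesis sE' : [seq ps P' a | a <- tA] = [:: w1; w2; w3; w2; w3; w1].
Hypothesis tE' : [seq pt P' a | a <- tA] = [:: w2; w3; w1; w1; w2; w3].
Hypotheses (c0 : c != 0) (c10 : c1 != 0) (c20 : c2 != 0) (lamE : lam = (c ^+ 2 * c1 * c2)^-1).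
Hypothesis presP : presented
    [:: ((v2, [:: al; xi]), c, (v2, [:: de; ga; al]));
       ((v1, [:: xi; be]), c, (v1, [:: be; de; ga]));
       ((v1, [:: be; al]), c1, (v1, [:: xi]));
       ((v2, [:: de; ze]), c, (v2, [:: al; be; de]));
       ((v3, [:: ze; ga]), c, (v3, [:: ga; al; be]));
       ((v3, [:: ga; de]), c2, (v3, [:: ze]))]
    [:: (v2, [:: al; xi; xi]);
       (v1, [:: xi; be; de]);
       (v2, [:: de; ze; ze]);
       (v3, [:: ze; ga; al]);
       (v1, [:: xi; xi; be]);
       (v1, [:: be; de; ze]);
       (v3, [:: ga; al; xi]);
       (v3, [:: ze; ze; ga])].
Hypothesis presP' : presented
    [:: ((w1, [:: p0; p1]), 1, (w1, [:: p5]));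
       ((w2, [:: p1; p2]), lam, (w2, [:: p3; p0; p3]));
       ((w3, [:: p2; p0]), 1, (w3, [:: p4; p1; p4]));
       ((w2, [:: p3; p5]), 1, (w2, [:: p1; p4; p1]));
       ((w3, [:: p4; p3]), 1, (w3, [:: p2]));
       ((w1, [:: p5; p4]), lam, (w1, [:: p0; p3; p0]))]
    [:: (w2, [:: p1; p2; p5]);
       (w3, [:: p2; p0; p3]);
       (w2, [:: p3; p5; p2]);
       (w1, [:: p5; p4; p1]);
       (w1, [:: p0; p3; p5]);
       (w3, [:: p2; p5; p4]);
       (w1, [:: p5; p2; p0]);
       (w3, [:: p4; p1; p2])].

Let sI (D : pA P -> Prop) : D al -> D be -> D de -> D ga -> D xi -> D ze -> forall a, D a.
Proof.
move=> h1 h2 h3 h4 h5 h6 a; have := allA a; rewrite !inE.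
by do 5?case/orP=> [/eqP->//|]; move/eqP->.
Qed.
Let tI (D : pA P' -> Prop) : D p0 -> D p1 -> D p2 -> D p3 -> D p4 -> D p5 -> forall a, D a.
Proof.
move=> h1 h2 h3 h4 h5 h6 a; have := allA' a; rewrite !inE.
by do 5?case/orP=> [/eqP->//|]; move/eqP->.
Qed.
Let s_ : (ps P al = v2) * (ps P be = v1) * (ps P de = v2) * (ps P ga = v3) * (ps P xi = v1) * (ps P ze = v3).
Proof. by case: sE. Qed.
Let t_ : (pt P al = v1) * (pt P be = v2) * (pt P de = v3) * (pt P ga = v2) * (pt P xi = v1) * (pt P ze = v3).
Proof. by case: tE. Qed.
Let s'_ : (ps P' p0 = w1) * (ps P' p1 = w2) * (ps P' p2 = w3) * (ps P' p3 = w2) * (ps P' p4 = w3) * (ps P' p5 = w1).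
Proof. by case: sE'. Qed.
Let t'_ : (pt P' p0 = w2) * (pt P' p1 = w3) * (pt P' p2 = w1) * (pt P' p3 = w1) * (pt P' p4 = w2) * (pt P' p5 = w3).
Proof. by case: tE'. Qed.

Let cg := mcong (ps P) (pt P) (prels P).
Let zr := mzero (ps P) (pt P) (prels P).
Let ct := mcong (ps P') (pt P') (prels P').
Let zt := mzero (ps P') (pt P') (prels P').

Ltac binomial_of H := let Hb := fresh in
  by case: H => _ Hb _; apply: (Hb (_, _, _)); rewrite !inE eqxx ?orbT.
Ltac zero_of H := by case: H => _ _; apply; rewrite !inE eqxx ?orbT.
Tactic Notation "in_context" uconstr(pre) constr(v) constr(w) uconstr(post)
    uconstr(l) uconstr(l') constr(H) :=
  by refine (@mcong_ctx _ _ _ _ _ _ _ pre v w post _ _ l l' _ _ _ H); rewrite /ptarget /= ?t_ ?t'_.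
Ltac by_index d F U := let H := fresh in
  have H k := @index_uniq _ d k _ ^~ U; rewrite /F; repeat split;
  first [by rewrite (H 0%N isT) | by rewrite (H 1%N isT) | by rewrite (H 2%N isT) |
         by rewrite (H 3%N isT) | by rewrite (H 4%N isT) | by rewrite (H 5%N isT)].

(* The virtual loops [xi], [ze] go to paths of length two, and so do the virtual arrows [p2], [p5]
   in the other direction. *)
Let xl a := nth [::] [:: [:: p3]; [:: p0]; [:: p1]; [:: p4]; [:: p0; p3]; [:: p4; p1]] (index a sA).
(** With [al], [be], [de] unscaled the rest is forced: [be al = c1 xi] gives the coefficient of
    [xi], the relations of [ga de] and [de ze] those of [ga] and [ze], and the relation of [al xi]
    then gives $\lambda=(c^2c_1c_2)^{-1}$. *)
Let xk a := nth 0 [:: 1; 1; 1; c * c2; c1^-1; c] (index a sA).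
Let yl a := nth [::] [:: [:: be]; [:: de]; [:: ga; al]; [:: al]; [:: ga]; [:: be; de]] (index a tA).
Let yk a := nth 0 [:: 1; 1; (c * c2)^-1; 1; (c * c2)^-1; 1] (index a tA).
Let eV v := nth w1 tV (index v sV).
Let dV v := nth v1 sV (index v tV).

Let xl_ : (xl al = [:: p3]) * (xl be = [:: p0]) * (xl de = [:: p1]) *
  (xl ga = [:: p4]) * (xl xi = [:: p0; p3]) * (xl ze = [:: p4; p1]).
Proof. by_index al xl uA. Qed.
Let xk_ : (xk al = 1) * (xk be = 1) * (xk de = 1) *
  (xk ga = c * c2) * (xk xi = c1^-1) * (xk ze = c).
Proof. by_index al xk uA. Qed.
Let yl_ : (yl p0 = [:: be]) * (yl p1 = [:: de]) * (yl p2 = [:: ga; al]) *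
  (yl p3 = [:: al]) * (yl p4 = [:: ga]) * (yl p5 = [:: be; de]).
Proof. by_index p0 yl uA'. Qed.
Let yk_ : (yk p0 = 1) * (yk p1 = 1) * (yk p2 = (c * c2)^-1) *
  (yk p3 = 1) * (yk p4 = (c * c2)^-1) * (yk p5 = 1).
Proof. by_index p0 yk uA'. Qed.
Let eV_ : (eV v1 = w1) * (eV v2 = w2) * (eV v3 = w3).
Proof. by_index v1 eV uV. Qed.
Let dV_ : (dV w1 = v1) * (dV w2 = v2) * (dV w3 = v3).
Proof. by_index w1 dV uV'. Qed.
Let lam0 : lam != 0.
Proof. by rewrite lamE invr_eq0 !mulf_neq0 ?expf_neq0. Qed.

Let q0 : cg (1, (v2, [:: al; xi])) (c, (v2, [:: de; ga; al])).
Proof. binomial_of presP. Qed.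
Let q1 : cg (1, (v1, [:: xi; be])) (c, (v1, [:: be; de; ga])).
Proof. binomial_of presP. Qed.
Let q2 : cg (1, (v1, [:: be; al])) (c1, (v1, [:: xi])).
Proof. binomial_of presP. Qed.
Let q3 : cg (1, (v2, [:: de; ze])) (c, (v2, [:: al; be; de])).
Proof. binomial_of presP. Qed.
Let q4 : cg (1, (v3, [:: ze; ga])) (c, (v3, [:: ga; al; be])).
Proof. binomial_of presP. Qed.
Let q5 : cg (1, (v3, [:: ga; de])) (c2, (v3, [:: ze])).
Proof. binomial_of presP. Qed.
Let z0 : zr (v2, [:: al; xi; xi]).
Proof. zero_of presP. Qed.
Let z1 : zr (v1, [:: xi; be; de]).
Proof. zero_of presP. Qed.
Let z3 : zr (v3, [:: ze; ga; al]).
Proof. zero_of presP. Qed.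
Let z4 : zr (v1, [:: xi; xi; be]).
Proof. zero_of presP. Qed.
Let z5 : zr (v1, [:: be; de; ze]).
Proof. zero_of presP. Qed.
Let z6 : zr (v3, [:: ga; al; xi]).
Proof. zero_of presP. Qed.
Let z7 : zr (v3, [:: ze; ze; ga]).
Proof. zero_of presP. Qed.
Let t0 : ct (1, (w1, [:: p0; p1])) (1, (w1, [:: p5])).
Proof. binomial_of presP'. Qed.
Let t1 : ct (1, (w2, [:: p1; p2])) (lam, (w2, [:: p3; p0; p3])).
Proof. binomial_of presP'. Qed.
Let t2 : ct (1, (w3, [:: p2; p0])) (1, (w3, [:: p4; p1; p4])).
Proof. binomial_of presP'. Qed.
Let t3 : ct (1, (w2, [:: p3; p5])) (1, (w2, [:: p1; p4; p1])).
Proof. binomial_of presP'. Qed.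
Let t4 : ct (1, (w3, [:: p4; p3])) (1, (w3, [:: p2])).
Proof. binomial_of presP'. Qed.
Let t5 : ct (1, (w1, [:: p5; p4])) (lam, (w1, [:: p0; p3; p0])).
Proof. binomial_of presP'. Qed.
Let y1 : zt (w3, [:: p2; p0; p3]).
Proof. zero_of presP'. Qed.
Let y3 : zt (w1, [:: p5; p4; p1]).
Proof. zero_of presP'. Qed.
Let y4 : zt (w1, [:: p0; p3; p5]).
Proof. zero_of presP'. Qed.
Let y7 : zt (w3, [:: p4; p1; p2]).
Proof. zero_of presP'. Qed.

(** [P1] to [P4] eliminate the virtual arrows [p2] and [p5], and [R1] to [R4] below eliminate the
    virtual loops. What is left has the same shape on both sides, with [al], [be], [de], [ga]
    matching [p3], [p0], [p1], [p4]. *)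
Let P1 : ct (1, (w2, [:: p1; p4; p3])) (lam, (w2, [:: p3; p0; p3])).
Proof.
apply: (@mcong_trans _ _ _ _ _ _ (1, (w2, [:: p1; p2]))); first by in_context ([:: p1]) w3 w1 ([::]) ([:: p4; p3]) ([:: p2]) t4.
in_context ([::]) w2 w1 ([::]) ([:: p1; p2]) ([:: p3; p0; p3]) t1.
Qed.
Let P2 : ct (1, (w1, [:: p0; p1; p4])) (lam, (w1, [:: p0; p3; p0])).
Proof.
apply: (@mcong_trans _ _ _ _ _ _ (1, (w1, [:: p5; p4]))); first by in_context ([::]) w1 w3 ([:: p4]) ([:: p0; p1]) ([:: p5]) t0.
in_context ([::]) w1 w2 ([::]) ([:: p5; p4]) ([:: p0; p3; p0]) t5.
Qed.
Let P3 : ct (1, (w2, [:: p3; p0; p1])) (1, (w2, [:: p1; p4; p1])).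
Proof.
apply: (@mcong_trans _ _ _ _ _ _ (1, (w2, [:: p3; p5]))); first by in_context ([:: p3]) w1 w3 ([::]) ([:: p0; p1]) ([:: p5]) t0.
in_context ([::]) w2 w3 ([::]) ([:: p3; p5]) ([:: p1; p4; p1]) t3.
Qed.
Let P4 : ct (1, (w3, [:: p4; p3; p0])) (1, (w3, [:: p4; p1; p4])).
Proof.
apply: (@mcong_trans _ _ _ _ _ _ (1, (w3, [:: p2; p0]))); first by in_context ([::]) w3 w1 ([:: p0]) ([:: p4; p3]) ([:: p2]) t4.
in_context ([::]) w3 w2 ([::]) ([:: p2; p0]) ([:: p4; p1; p4]) t2.
Qed.
Let Z1 : zt (w2, [:: p3; p0; p3; p0; p3]).
Proof.
apply: (@mzero_cong _ _ _ _ _ _ lam 1 _ (w2, [:: p1; p2; p0; p3])).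
- by rewrite ?oner_eq0.
- in_context ([::]) w2 w1 ([:: p0; p3]) ([:: p3; p0; p3]) ([:: p1; p2]) (mcong_sym t1).
by apply: (@mzero_ctx _ _ _ _ _ _ _ [:: p1] w3 w1 [::] [:: p2; p0; p3] _ _ y1); rewrite /ptarget /= ?t'_.
Qed.
Let Z2 : zt (w1, [:: p0; p3; p0; p1]).
Proof.
apply: (@mzero_cong _ _ _ _ _ _ 1 1 _ (w1, [:: p0; p3; p5])).
- by rewrite ?oner_eq0.
- in_context ([:: p0; p3]) w1 w3 ([::]) ([:: p0; p1]) ([:: p5]) t0.
by apply: (@mzero_ctx _ _ _ _ _ _ _ [::] w1 w3 [::] [:: p0; p3; p5] _ _ y4); rewrite /ptarget /= ?t'_.
Qed.
Let Z3 : zt (w2, [:: p1; p4; p1; p4; p1]).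
Proof.
apply: (@mzero_cong _ _ _ _ _ _ 1 1 _ (w2, [:: p3; p5; p4; p1])).
- by rewrite ?oner_eq0.
- in_context ([::]) w2 w3 ([:: p4; p1]) ([:: p1; p4; p1]) ([:: p3; p5]) (mcong_sym t3).
by apply: (@mzero_ctx _ _ _ _ _ _ _ [:: p3] w1 w3 [::] [:: p5; p4; p1] _ _ y3); rewrite /ptarget /= ?t'_.
Qed.
Let Z4 : zt (w3, [:: p4; p1; p4; p3]).
Proof.
apply: (@mzero_cong _ _ _ _ _ _ 1 1 _ (w3, [:: p4; p1; p2])).
- by rewrite ?oner_eq0.
- in_context ([:: p4; p1]) w3 w1 ([::]) ([:: p4; p3]) ([:: p2]) t4.
by apply: (@mzero_ctx _ _ _ _ _ _ _ [::] w3 w1 [::] [:: p4; p1; p2] _ _ y7); rewrite /ptarget /= ?t'_.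
Qed.
Let Z5 : zt (w1, [:: p0; p3; p0; p3; p0]).
Proof.
apply: (@mzero_cong _ _ _ _ _ _ lam 1 _ (w1, [:: p0; p3; p5; p4])).
- by rewrite ?oner_eq0.
- in_context ([:: p0; p3]) w1 w2 ([::]) ([:: p0; p3; p0]) ([:: p5; p4]) (mcong_sym t5).
by apply: (@mzero_ctx _ _ _ _ _ _ _ [::] w1 w3 [:: p4] [:: p0; p3; p5] _ _ y4); rewrite /ptarget /= ?t'_.
Qed.
Let Z6 : zt (w1, [:: p0; p1; p4; p1]).
Proof.
apply: (@mzero_cong _ _ _ _ _ _ 1 1 _ (w1, [:: p5; p4; p1])).
- by rewrite ?oner_eq0.
- in_context ([::]) w1 w3 ([:: p4; p1]) ([:: p0; p1]) ([:: p5]) t0.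
by apply: (@mzero_ctx _ _ _ _ _ _ _ [::] w1 w3 [::] [:: p5; p4; p1] _ _ y3); rewrite /ptarget /= ?t'_.
Qed.
Let Z7 : zt (w3, [:: p4; p3; p0; p3]).
Proof.
apply: (@mzero_cong _ _ _ _ _ _ 1 1 _ (w3, [:: p2; p0; p3])).
- by rewrite ?oner_eq0.
- in_context ([::]) w3 w1 ([:: p0; p3]) ([:: p4; p3]) ([:: p2]) t4.
by apply: (@mzero_ctx _ _ _ _ _ _ _ [::] w3 w1 [::] [:: p2; p0; p3] _ _ y1); rewrite /ptarget /= ?t'_.
Qed.
Let Z8 : zt (w3, [:: p4; p1; p4; p1; p4]).
Proof.
apply: (@mzero_cong _ _ _ _ _ _ 1 1 _ (w3, [:: p4; p1; p2; p0])).
- by rewrite ?oner_eq0.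
- in_context ([:: p4; p1]) w3 w2 ([::]) ([:: p4; p1; p4]) ([:: p2; p0]) (mcong_sym t2).
by apply: (@mzero_ctx _ _ _ _ _ _ _ [::] w3 w1 [:: p0] [:: p4; p1; p2] _ _ y7); rewrite /ptarget /= ?t'_.
Qed.
Let Y1 : zr (v2, [:: de; ga; al; be; de]).
Proof.
apply: (@mzero_cong _ _ _ _ _ _ c 1 _ (v2, [:: al; xi; be; de])).
- by rewrite ?oner_eq0.
- in_context ([::]) v2 v1 ([:: be; de]) ([:: de; ga; al]) ([:: al; xi]) (mcong_sym q0).
by apply: (@mzero_ctx _ _ _ _ _ _ _ [:: al] v1 v3 [::] [:: xi; be; de] _ _ z1); rewrite /ptarget /= ?t_.
Qed.
Let Y2 : zr (v3, [:: ga; al; be; al]).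
Proof.
apply: (@mzero_cong _ _ _ _ _ _ 1 c1 _ (v3, [:: ga; al; xi])).
- by rewrite ?oner_eq0.
- in_context ([:: ga; al]) v1 v1 ([::]) ([:: be; al]) ([:: xi]) q2.
by apply: (@mzero_ctx _ _ _ _ _ _ _ [::] v3 v1 [::] [:: ga; al; xi] _ _ z6); rewrite /ptarget /= ?t_.
Qed.
Let Y3 : zr (v2, [:: al; be; de; ga; al]).
Proof.
apply: (@mzero_cong _ _ _ _ _ _ c 1 _ (v2, [:: al; be; al; xi])).
- by rewrite ?oner_eq0.
- in_context ([:: al; be]) v2 v1 ([::]) ([:: de; ga; al]) ([:: al; xi]) (mcong_sym q0).
apply: (@mzero_cong _ _ _ _ _ _ 1 c1 _ (v2, [:: al; xi; xi])).
- by rewrite ?oner_eq0.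
- in_context ([:: al]) v1 v1 ([:: xi]) ([:: be; al]) ([:: xi]) q2.
by apply: (@mzero_ctx _ _ _ _ _ _ _ [::] v2 v1 [::] [:: al; xi; xi] _ _ z0); rewrite /ptarget /= ?t_.
Qed.
Let Y4 : zr (v1, [:: be; de; ga; de]).
Proof.
apply: (@mzero_cong _ _ _ _ _ _ 1 c2 _ (v1, [:: be; de; ze])).
- by rewrite ?oner_eq0.
- in_context ([:: be; de]) v3 v3 ([::]) ([:: ga; de]) ([:: ze]) q5.
by apply: (@mzero_ctx _ _ _ _ _ _ _ [::] v1 v3 [::] [:: be; de; ze] _ _ z5); rewrite /ptarget /= ?t_.
Qed.
Let Y5 : zr (v1, [:: be; al; be; de]).
Proof.
apply: (@mzero_cong _ _ _ _ _ _ 1 c1 _ (v1, [:: xi; be; de])).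
- by rewrite ?oner_eq0.
- in_context ([::]) v1 v1 ([:: be; de]) ([:: be; al]) ([:: xi]) q2.
by apply: (@mzero_ctx _ _ _ _ _ _ _ [::] v1 v3 [::] [:: xi; be; de] _ _ z1); rewrite /ptarget /= ?t_.
Qed.
Let Y6 : zr (v3, [:: ga; al; be; de; ga]).
Proof.
apply: (@mzero_cong _ _ _ _ _ _ c 1 _ (v3, [:: ze; ga; de; ga])).
- by rewrite ?oner_eq0.
- in_context ([::]) v3 v2 ([:: de; ga]) ([:: ga; al; be]) ([:: ze; ga]) (mcong_sym q4).
apply: (@mzero_cong _ _ _ _ _ _ 1 c2 _ (v3, [:: ze; ze; ga])).
- by rewrite ?oner_eq0.
- in_context ([:: ze]) v3 v3 ([:: ga]) ([:: ga; de]) ([:: ze]) q5.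
by apply: (@mzero_ctx _ _ _ _ _ _ _ [::] v3 v2 [::] [:: ze; ze; ga] _ _ z7); rewrite /ptarget /= ?t_.
Qed.
Let Y7 : zr (v1, [:: be; de; ga; al; be]).
Proof.
apply: (@mzero_cong _ _ _ _ _ _ c 1 _ (v1, [:: xi; be; al; be])).
- by rewrite ?oner_eq0.
- in_context ([::]) v1 v2 ([:: al; be]) ([:: be; de; ga]) ([:: xi; be]) (mcong_sym q1).
apply: (@mzero_cong _ _ _ _ _ _ 1 c1 _ (v1, [:: xi; xi; be])).
- by rewrite ?oner_eq0.
- in_context ([:: xi]) v1 v1 ([:: be]) ([:: be; al]) ([:: xi]) q2.
by apply: (@mzero_ctx _ _ _ _ _ _ _ [::] v1 v2 [::] [:: xi; xi; be] _ _ z4); rewrite /ptarget /= ?t_.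
Qed.
Let Y8 : zr (v3, [:: ga; de; ga; al]).
Proof.
apply: (@mzero_cong _ _ _ _ _ _ 1 c2 _ (v3, [:: ze; ga; al])).
- by rewrite ?oner_eq0.
- in_context ([::]) v3 v3 ([:: ga; al]) ([:: ga; de]) ([:: ze]) q5.
by apply: (@mzero_ctx _ _ _ _ _ _ _ [::] v3 v1 [::] [:: ze; ga; al] _ _ z3); rewrite /ptarget /= ?t_.
Qed.

(* The vanishing paths above enter the verification of the relations only through [//]. *)
Let R1 : cg (1, (v2, [:: al; be; al])) (c1 * c, (v2, [:: de; ga; al])).
Proof.
apply: (@mcong_trans _ _ _ _ _ _ (c1, (v2, [:: al; xi]))).
  in_context ([:: al]) v1 v1 ([::]) ([:: be; al]) ([:: xi]) q2.
by apply: mcong_adj q0 _; rewrite ?oner_eq0 ?mulr1.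
Qed.
Let R2 : cg (1, (v1, [:: be; al; be])) (c1 * c, (v1, [:: be; de; ga])).
Proof.
apply: (@mcong_trans _ _ _ _ _ _ (c1, (v1, [:: xi; be]))).
  in_context ([::]) v1 v1 ([:: be]) ([:: be; al]) ([:: xi]) q2.
by apply: mcong_adj q1 _; rewrite ?oner_eq0 ?mulr1.
Qed.
Let R3 : cg (1, (v2, [:: de; ga; de])) (c2 * c, (v2, [:: al; be; de])).
Proof.
apply: (@mcong_trans _ _ _ _ _ _ (c2, (v2, [:: de; ze]))).
  in_context ([:: de]) v3 v3 ([::]) ([:: ga; de]) ([:: ze]) q5.
by apply: mcong_adj q3 _; rewrite ?oner_eq0 ?mulr1.
Qed.
Let R4 : cg (1, (v3, [:: ga; de; ga])) (c2 * c, (v3, [:: ga; al; be])).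
Proof.
apply: (@mcong_trans _ _ _ _ _ _ (c2, (v3, [:: ze; ga]))).
  in_context ([::]) v3 v3 ([:: ga]) ([:: ga; de]) ([:: ze]) q5.
by apply: mcong_adj q4 _; rewrite ?oner_eq0 ?mulr1.
Qed.

Let eVK : cancel eV dV.
Proof. by move=> v; have := allV v; rewrite !inE => /or3P[] /eqP ->; rewrite !eV_ !dV_. Qed.
Let dVK : cancel dV eV.
Proof. by move=> v; have := allV' v; rewrite !inE => /or3P[] /eqP ->; rewrite !dV_ !eV_. Qed.

Let mono : monomial_data (ps P) (pt P) (ps P') (pt P') eV xl.
Proof.
split; first exact: can_inj eVK.
- by apply: sI; rewrite xl_.
- by apply: sI; rewrite xl_ s_ eV_ /= ?s'_ ?t'_ ?s'_ !eqxx.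
- by apply: sI; rewrite xl_ s_ t_ !eV_ /ptarget /= t'_.
Qed.

Let mono' : monomial_data (ps P') (pt P') (ps P) (pt P) dV yl.
Proof.
split; first exact: can_inj dVK.
- by apply: tI; rewrite yl_.
- by apply: tI; rewrite yl_ s'_ dV_ /= ?s_ ?t_ ?s_ !eqxx.
- by apply: tI; rewrite yl_ s'_ t'_ !dV_ /ptarget /= t_.
Qed.

Ltac split_mem := rewrite !inE; repeat (case/orP; first (move/eqP->)); last (move/eqP->).

Let xmap r : r \in prels P -> in_ideal (ps P') (pt P') (prels P') (mmap eV xk xl r).
Proof.
case: presP => H _ _ /H; rewrite mem_cat => /orP[]/mapP[b bin ->].
  apply: mmap_rel; move: bin; split_mem.
  1-6: rewrite /msubst /mpath /mcoef /= ?big_cons ?big_nil ?xl_ ?xk_ ?eV_ /=.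
  - by apply: mcong_adj (mcong_sym P1) _ => //; rewrite lamE; field; rewrite ?c0 ?c10 ?c20.
  - by apply: mcong_adj (mcong_sym P2) _ => //; rewrite lamE; field; rewrite ?c0 ?c10 ?c20.
  - by apply: mcong_eq; congr (_, _); field; rewrite ?c0 ?c10 ?c20.
  - by apply: mcong_adj (mcong_sym P3) _; rewrite ?oner_eq0 //; ring.
  - by apply: mcong_adj (mcong_sym P4) _; rewrite ?oner_eq0 //; ring.
  - by apply: mcong_eq; congr (_, _); ring.
suff: zt (msubst eV xl b) by apply.
move: bin; split_mem.
1-8: rewrite /msubst /mpath /= ?xl_ ?eV_ //.
Qed.

Let ymap r : r \in prels P' -> in_ideal (ps P) (pt P) (prels P) (mmap dV yk yl r).
Proof.
case: presP' => H _ _ /H; rewrite mem_cat => /orP[]/mapP[b bin ->].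
  apply: mmap_rel; move: bin; split_mem.
  1-6: rewrite /msubst /mpath /mcoef /= ?big_cons ?big_nil ?yl_ ?yk_ ?dV_ /=.
  - by apply: mcong_eq; congr (_, _); ring.
  - by apply: mcong_adj (mcong_sym R1) _; rewrite ?mulf_neq0 // lamE; field; rewrite ?c0 ?c10 ?c20.
  - by apply: mcong_adj (mcong_sym R4) _; rewrite ?mulf_neq0 //; field; rewrite ?c0 ?c20.
  - by apply: mcong_adj (mcong_sym R3) _; rewrite ?mulf_neq0 //; field; rewrite ?c0 ?c20.
  - by apply: mcong_eq; congr (_, _); ring.
  - by apply: mcong_adj (mcong_sym R2) _; rewrite ?mulf_neq0 // lamE; field; rewrite ?c0 ?c10 ?c20.
suff: zr (msubst dV yl b) by apply.
move: bin; split_mem.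
1-8: rewrite /msubst /mpath /= ?yl_ ?dV_ //.
Qed.

Theorem loops_triangle_iso : alg_iso P P'.
Proof.
apply: (@monomial_alg_iso K P P' eV xk xl dV yk yl mono mono' eVK dVK xmap ymap).
- apply: sI; rewrite xl_ xk_ s_ /mcoef /mpath /= !big_cons big_nil ?yk_ ?yl_ /=.
  + by apply: mcong_eq; congr (_, _); field; rewrite ?c0 ?c10 ?c20.
  + by apply: mcong_eq; congr (_, _); field; rewrite ?c0 ?c10 ?c20.
  + by apply: mcong_eq; congr (_, _); field; rewrite ?c0 ?c10 ?c20.
  + by apply: mcong_eq; congr (_, _); field; rewrite ?c0 ?c20.
  + by apply: mcong_adj q2 _; rewrite ?oner_eq0 //; field; rewrite ?c0 ?c10 ?c20.
  + by apply: mcong_adj q5 _; rewrite ?oner_eq0 //; field; rewrite ?c0 ?c20.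
- apply: tI; rewrite yl_ yk_ s'_ /mcoef /mpath /= !big_cons big_nil ?xk_ ?xl_ /=.
  + by apply: mcong_eq; congr (_, _); field; rewrite ?c0 ?c10 ?c20.
  + by apply: mcong_eq; congr (_, _); field; rewrite ?c0 ?c10 ?c20.
  + by apply: mcong_adj t4 _; rewrite ?oner_eq0 //; field; rewrite ?c0 ?c20.
  + by apply: mcong_eq; congr (_, _); field; rewrite ?c0 ?c10 ?c20.
  + by apply: mcong_eq; congr (_, _); field; rewrite ?c0 ?c20.
  + by apply: mcong_adj t0 _; rewrite ?oner_eq0 //; field; rewrite ?c0 ?c10 ?c20.
Qed.
End LoopsTriangle.

(** * Identification of the rigid algebras *)

(* Some word in [f] and [bar] carries the pair [(j, k)] to a pair [B] of indices that are known
   to name different arrows. *)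
Fixpoint separated (B : nat -> nat -> bool) (fl il : seq nat) (fuel j k : nat) : bool :=
  [|| B j k, B k j | if fuel is fuel'.+1 then
    separated B fl il fuel' (nth 0%N fl j) (nth 0%N fl k) ||
    separated B fl il fuel' (nth 0%N il j) (nth 0%N il k) else false].

Lemma separated_inj (A : Type) (h : nat -> A) (f bar : A -> A)
    (B : nat -> nat -> bool) (fl il : seq nat) (fuel na : nat) :
  (forall k, (k <= na)%N -> h (nth 0%N fl k) = f (h k)) ->
  (forall k, (k <= na)%N -> h (nth 0%N il k) = bar (h k)) ->
  all (fun k => (nth 0%N fl k <= na) && (nth 0%N il k <= na))%N (iota 0 na.+1) ->
  (forall j k, (j <= na)%N -> (k <= na)%N -> B j k -> h j <> h k) ->
  all (fun j => all (fun k => (j == k) || separated B fl il fuel j k) (iota 0 na.+1)) (iota 0 na.+1) ->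
  forall j k, (j <= na)%N -> (k <= na)%N -> h j = h k -> j = k.
Proof.
move=> hF hI /allP ran hB /allP sep j k jn kn e.
have rn i : (i <= na)%N -> (nth 0 fl i <= na)%N /\ (nth 0 il i <= na)%N.
  by move=> le_i; apply/andP; apply: ran; rewrite mem_iota.
have key n : forall j k, (j <= na)%N -> (k <= na)%N -> separated B fl il n j k -> h j <> h k.
  elim: n => [|n IH] {e} {}j {}k {}jn {}kn /= /or3P[H|H|] //; try exact: hB.
  - by move/esym; apply: hB.
  - by move/esym; apply: hB.
  have [[? ?] [? ?]] := (rn j jn, rn k kn).
  case/orP => H e; apply: (IH _ _ _ _ H) => //.
    by rewrite !hF // e.
  by rewrite !hI // e.
have /sep/allP/(_ k) : j \in iota 0 na.+1 by rewrite mem_iota.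
by rewrite mem_iota => /(_ kn)/orP[/eqP//|/key H]; case: (H jn kn).
Qed.

Section Rigid.
Variables (K : closedFieldType) (Q : tqdata K).
Hypothesis wsa : is_wsa Q.
Local Notation A := (tA Q).
Local Notation f := (tf Q).
Local Notation bar := (@tbar K Q).
Local Notation N := (@tN K Q).
Let b3 : involutive bar := tbarK wsa.
Let f3 : forall a, f (f (f a)) = a := tf3 wsa.

Lemma tc_g (a : A) : tc Q (tg a) = tc Q a.
Proof. by case: wsa => _ _ _ H _; case: (H a). Qed.
Lemma tc_neq0 (a : A) : tc Q a != 0.
Proof. by case: wsa => _ _ _ H _; case: (H a). Qed.

Let iter_tn (a : A) : iter (tn a) (@tg K Q) a = a.
Proof. exact: (iter_order (tg_inj wsa)). Qed.

Lemma weight_fix (a : A) : tg a = a -> tm Q a = tN a.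
Proof.
move=> ga; rewrite /tN /tn (@order_cycle _ (@tg K Q) [:: a]) ?muln1 ?mem_head //.
by rewrite /= ga eqxx.
Qed.

Lemma weight_prime (a : A) : prime (tN a) -> tg a != a -> tm Q a = 1%N.
Proof.
move=> pN ga; have N0 := prime_gt0 pN.
have n1 : tn a != 1%N.
  by apply: contraNneq ga => n1; have := iter_tn a; rewrite n1 /= => ->.
have dn : (tn a %| tN a)%N by apply: dvdn_mull.
case/primeP: pN => _ /(_ _ dn)/pred2P[e|e]; first by rewrite e in n1.
by apply/eqP; rewrite -(eqn_pmul2r N0) mul1n -{1}e.
Qed.

Lemma weight_half (a : A) : tN a = 4%N -> tg a != a -> tg (tg a) = a -> tm Q a = 2%N.
Proof.
move=> N4 ga gg; have n2 : tn a = 2%N.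
  rewrite /tn (@order_cycle _ (@tg K Q) [:: a; tg a]) ?mem_head //=; first by rewrite gg !eqxx.
  by rewrite inE eq_sym ga.
by apply/eqP; rewrite -(eqn_pmul2r (isT : (0 < 2)%N)) -{1}n2 -/(tN a) N4.
Qed.

Lemma weight_full (a : A) : tN a = 4%N -> tg (tg a) != a -> tm Q a = 1%N.
Proof.
move=> N4 gg; have : (tn a %| 4)%N by rewrite -N4; apply: dvdn_mull.
have n1 : tn a != 1%N.
  by apply: contraNneq gg => n1; have := iter_tn a; rewrite n1 /= => e; rewrite !e.
have n2 : tn a != 2%N.
  by apply: contraNneq gg => n2; have := iter_tn a; rewrite n2 /= => ->.
rewrite dvdn_divisors // !inE (negPf n1) (negPf n2) /= => /eqP e.
by apply/eqP; rewrite -(eqn_pmul2r (isT : (0 < 4)%N)) -{1}e -/(tN a) N4.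
Qed.

Lemma table_surj na fl il (h : nat -> A) :
  (forall k, (k <= na)%N -> h (nth 0%N fl k) = f (h k)) ->
  (forall k, (k <= na)%N -> h (nth 0%N il k) = tbar (h k)) ->
  all (fun k => (nth 0%N fl k <= na) && (nth 0%N il k <= na))%N (iota 0 na.+1) ->
  forall a, exists2 k, (k <= na)%N & h k = a.
Proof.
move=> hF hI /allP ran a.
pose S := [set a | has (fun k => h k == a) (iota 0 na.+1)].
have SP b : reflect (exists2 k, (k <= na)%N & h k = b) (b \in S).
  rewrite inE; apply: (iffP hasP) => -[k]; first by rewrite mem_iota => kn /eqP; exists k.
  by move=> kn e; exists k; rewrite ?mem_iota //; apply/eqP.
have rn k : (k <= na)%N -> (nth 0 fl k <= na)%N /\ (nth 0 il k <= na)%N.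
  by move=> le_k; apply/andP; apply: ran; rewrite mem_iota.
apply/SP; apply: (arrows_connected wsa (a0 := h 0)) => [|b /SP[k kn <-]|b /SP[k kn <-]]; apply/SP.
- by exists 0%N.
- by exists (nth 0%N fl k); [case: (rn k kn) | apply: hF].
- by exists (nth 0%N il k); [case: (rn k kn) | apply: hI].
Qed.

(** * All products equal to three: the algebras $D(\lambda)$ and $\Lambda(\lambda)$ *)

Section Case3.
Hypothesis N3 : forall a, N a = 3%N.

Let g3 (a : A) : tg (tg (tg a)) = a.
Proof.
have /dvdnP[m e] : (tn a %| 3)%N by rewrite -(N3 a); apply: dvdn_mull.
suff: iter 3 (@tg K Q) a = a by [].
by rewrite e; elim: m {e} => // m IH; rewrite mulSn addnC iterD iter_tn.
Qed.
Let bfb (a : A) : tbar (f (tbar a)) = f (f (tbar (f (f a)))).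
Proof.
by have := g3 (f (f a)); rewrite /tg f3 => e; rewrite -[f (f a)]e b3 f3.
Qed.

(** For [u = bar b] the relation [bfb] gives $\overline{f(u)}=f^2(u)$, so the set of
    $f(u),f^2(u),u,b$ is closed under [f] and [bar] and contains all arrows. *)
Lemma case3_fixed (b : A) : f b = b ->
  exists2 lam : K, lam != 0 & alg_iso (LamP Q) (LamP (D_alg lam)).
Proof.
move=> fb; pose u := tbar b.
have gu : tbar (f u) = f (f u) by rewrite bfb fb fb.
pose fl := [:: 1; 2; 0; 3]%N; pose il := [:: 1; 0; 3; 2]%N.
pose h k := nth b [:: f u; f (f u); u; b] k.
have hF k : (k <= 3)%N -> h (nth 0%N fl k) = f (h k).
  by case: k => [|[|[|[|k]]]] // _; rewrite /h /= ?f3 ?fb.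
have hI k : (k <= 3)%N -> h (nth 0%N il k) = tbar (h k).
  by case: k => [|[|[|[|k]]]] // _; rewrite /h /= -?gu ?b3.
have hsurj := table_surj hF hI isT.
have hinj : forall j k, (j <= 3)%N -> (k <= 3)%N -> h j = h k -> j = k.
  apply: (@separated_inj _ h f bar (fun j k => k == nth 0 il j)%N fl il 4) => //.
  by move=> j k jn kn /eqP ->; rewrite hI // => /esym/eqP; apply/negP/tbar_neq.
have hg k : (k <= 3)%N -> tg (h k) = h (nth 0%N il (nth 0%N fl k)).
  by move=> kn; rewrite hI ?hF //; case: k kn => [|[|[|[|k]]]].
pose c1 := tc Q (h 0); pose c2 := tc Q (h 1).
have c10 : c1 != 0 by apply: tc_neq0.
have c20 : c2 != 0 by apply: tc_neq0.
(* Rescaling makes the parameter of the three-element orbit 1 and moves it to the orbit of the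
   loop. *)
exists (c1 * c2 ^+ 3); first by rewrite mulf_neq0 ?expf_neq0.
apply: (@table_alg_iso K Q wsa 1 3 _ _ _ _ _ _ il [:: 3; 3; 3; 3]%N h _ hF hI hinj hsurj _ _
   (fun k => nth 1 [:: c2; c2^-1; 1; 1] k)).
- by [].
- move=> k kn; have gk := hg k kn.
  have [k0|k0] := eqVneq k 0%N; first by rewrite k0 in gk *; rewrite weight_fix ?N3.
  rewrite weight_prime ?N3 //; first by case: k kn k0 {gk} => [|[|[|[|k]]]].
  rewrite gk; apply/eqP => /hinj e.
  by move: kn k0 e {gk}; case: k => [|[|[|[|k]]]] //= _ _ /(_ isT isT).
- by move=> k kn; rewrite N3; case: k kn => [|[|[|[|k]]]].
- by case=> [|[|[|[|k]]]] // _ /=; rewrite ?invr_eq0 ?oner_eq0.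
have C k : (k <= 3)%N -> tc Q (h (nth 0%N il (nth 0%N fl k))) = tc Q (h k).
  by move=> kn; rewrite -hg // tc_g.
have C3 : tc Q (h 3) = c2 by rewrite -(C 3%N isT) -(C 2%N isT).
have C2 : tc Q (h 2) = c2 by rewrite -(C 2%N isT).
case=> [|[|[|[|k]]]] // _; cbn [nth il]; rewrite ?C2 ?C3 -/c1 -/c2 /= !big_cons big_nil /=;
  field; rewrite ?c20 //.
Qed.

(** A nontrivial element of the alternating group on four letters is conjugate to [bar], [f] or
    $f^{-1}$. None of these fixes an arrow, so the group acts freely and there are twelve arrows. *)
Lemma case3_free : (forall a, f a != a) -> A ->
  exists2 lam : K, lam != 0 & alg_iso (LamP Q) (LamP (L_alg lam)).
Proof.
move=> fa a.
have bffb (x : A) : tbar (f (f (tbar x))) = f (tbar (f x)).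
  by have := bfb (f x); rewrite f3 => <-; rewrite b3.
pose fl := [:: 9; 4; 3; 5; 6; 2; 1; 10; 7; 11; 8; 0]%N.
pose il := [:: 2; 10; 0; 8; 9; 6; 5; 11; 3; 4; 1; 7]%N.
pose h k := nth a [:: a; f (f (tbar (f a))); tbar a; f (tbar a); tbar (f a); f (f (tbar a));
  f (tbar (f a)); tbar (f (f a)); f (f (tbar (f (f a)))); f a; f (tbar (f (f a))); f (f a)] k.
have hF k : (k <= 11)%N -> h (nth 0%N fl k) = f (h k).
  by case: k => [|[|[|[|[|[|[|[|[|[|[|[|k]]]]]]]]]]]] // _; rewrite /h /= ?f3.
have hI k : (k <= 11)%N -> h (nth 0%N il k) = tbar (h k).
  by case: k => [|[|[|[|[|[|[|[|[|[|[|[|k]]]]]]]]]]]] // _; rewrite /h /= ?bffb ?bfb ?f3 ?b3 // -?bfb -?bffb ?b3.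
have hsurj := table_surj hF hI isT.
have hinj : forall j k, (j <= 11)%N -> (k <= 11)%N -> h j = h k -> j = k.
  apply: (@separated_inj _ h f bar (fun j k => (k == nth 0 il j) || (k == nth 0 fl j))%N fl il 4) => //.
  move=> j k jn kn /orP[]/eqP->; rewrite ?hI ?hF // => /esym/eqP; apply/negP; first exact: tbar_neq.
  exact: fa.
have hg k : (k <= 11)%N -> tg (h k) = h (nth 0%N il (nth 0%N fl k)).
  by move=> kn; rewrite hI ?hF //; case: k kn => [|[|[|[|[|[|[|[|[|[|[|[|k]]]]]]]]]]]].
pose c1 := tc Q (h 0); pose c2 := tc Q (h 1); pose c3 := tc Q (h 2); pose c4 := tc Q (h 3).
have c10 : c1 != 0 by apply: tc_neq0.
have c20 : c2 != 0 by apply: tc_neq0.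
have c30 : c3 != 0 by apply: tc_neq0.
have c40 : c4 != 0 by apply: tc_neq0.
exists (c1 * c2 * c3 * c4); first by rewrite !mulf_neq0.
apply: (@table_alg_iso K Q wsa 5 11 _ _ _ _ _ _ il (nseq 12 3%N) h _ hF hI hinj hsurj _ _
   (fun k => nth 1 [:: c2; 1; c3^-1; 1; c4; c3; c4^-1; 1; 1; c2^-1; 1; 1] k)).
- by [].
- move=> k kn; rewrite weight_prime ?N3 //; first by case: k kn => [|[|[|[|[|[|[|[|[|[|[|[|k]]]]]]]]]]]].
  rewrite hg //; apply/eqP => /hinj e.
  by move: kn e; case: k => [|[|[|[|[|[|[|[|[|[|[|[|k]]]]]]]]]]]] //= _ /(_ isT isT).
- by move=> k kn; rewrite N3; case: k kn => [|[|[|[|[|[|[|[|[|[|[|[|k]]]]]]]]]]]].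
- by case=> [|[|[|[|[|[|[|[|[|[|[|[|k]]]]]]]]]]]] // _ /=; rewrite ?invr_eq0 ?oner_eq0.
have C k : (k <= 11)%N -> tc Q (h (nth 0%N il (nth 0%N fl k))) = tc Q (h k).
  by move=> kn; rewrite -hg // tc_g.
have C4 : tc Q (h 4) = c1 := C 0%N isT.
have C5 : tc Q (h 5) = c1 by rewrite -C4 -(C 4%N isT).
have C9 : tc Q (h 9) = c2 := C 1%N isT.
have C7 : tc Q (h 7) = c2 by rewrite -C9 -(C 9%N isT).
have C8 : tc Q (h 8) = c3 := C 2%N isT.
have C11 : tc Q (h 11) = c3 by rewrite -C8 -(C 8%N isT).
have C6 : tc Q (h 6) = c4 := C 3%N isT.
have C10 : tc Q (h 10) = c4 by rewrite -C6 -(C 6%N isT).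
case=> [|[|[|[|[|[|[|[|[|[|[|[|k]]]]]]]]]]]] // _; cbn [nth il];
  rewrite ?C4 ?C5 ?C6 ?C7 ?C8 ?C9 ?C10 ?C11 -/c1 -/c2 -/c3 -/c4 /= !big_cons big_nil /=;
  field; rewrite ?c20 ?c30 ?c40 //.
Qed.
End Case3.

(** * Some product equal to four: the algebras $S(\lambda)$ and $T(\lambda)$ *)

Section Case4.
Local Notation G := (gnext bar f N).
Local Notation dbl := (dbl bar f N).
Hypothesis no_broken : forall a, ~~ broken bar f N a.
Hypothesis rigid : forall a, good bar N a -> ~~ allowed bar f N a.

Let Ng a : N (bar (f a)) = N a := tN_g wsa a.
Let Nvir3 a : N a = 2%N -> (2 < N (bar a))%N := @tN_vir3 _ _ wsa a.
Let D_b (a : A) : dbl a -> dbl (tbar a) :=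
  @dbl_bar _ _ _ _ b3 f3 Ng (tN_ge2 wsa) (@tn_dvd K Q) Nvir3 no_broken rigid a.
Let D_G (a : A) : dbl a -> dbl (G a) :=
  @dbl_G _ _ _ _ b3 f3 Ng (tN_ge2 wsa) (@tn_dvd K Q) Nvir3 no_broken rigid a.
Let GG (a : A) : dbl a -> G (G a) = a :=
  @dbl_GG _ _ _ _ b3 f3 Ng (tN_ge2 wsa) (@tn_dvd K Q) Nvir3 no_broken rigid a.
Let Gb (a : A) : dbl a -> G (tbar a) = tbar (G a) :=
  @dbl_comm _ _ _ _ b3 f3 Ng (tN_ge2 wsa) (@tn_dvd K Q) Nvir3 no_broken rigid a.
Let fg (a : A) : dbl a -> f (tbar (f a)) = tbar (G a) := @dbl_fg _ _ _ _ b3 a.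
Let ff (a : A) : dbl a -> f (f a) = tbar (f (tbar (G a))).
Proof.
move=> da; rewrite -Gb //.
exact: (@dbl_ff _ _ _ _ b3 f3 Ng (tN_ge2 wsa) (@tn_dvd K Q) Nvir3 no_broken rigid a).
Qed.
Let DN (a : A) : dbl a -> N a = 4%N :=
  @dbl_N _ _ _ _ b3 f3 Ng (tN_ge2 wsa) (@tn_dvd K Q) Nvir3 no_broken rigid a.
Let DNf (a : A) : dbl a -> N (f a) = 2%N.
Proof. by case/andP => _ /eqP. Qed.
Let DNg (a : A) : dbl a -> N (tbar (f a)) = 4%N.
Proof. by move=> da; rewrite Ng DN. Qed.
Let gd_D (a : A) : dbl a -> good bar N a.
Proof. by case/andP. Qed.
Let gd_f (a : A) : dbl a -> good bar N (f a) = false.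
Proof. by case/andP => _ v; rewrite /good v. Qed.
Let gd_g (a : A) : dbl a -> good bar N (tbar (f a)) = false.
Proof. by case/andP => _ v; rewrite /good b3 v andbF. Qed.

(** Label 0: no virtual arrow at the vertex; label 1: the companion of a virtual arrow; label 2:
    virtual. Arrows with different labels are different. *)
Let labelled (l : nat) (a : A) :=
  [/\ (l <= 2)%N, good bar N a = (l == 0%N) & N a = if l == 2%N then 2%N else 4%N].

Let labelled_neq l l' a a' : labelled l a -> labelled l' a' -> l != l' -> a <> a'.
Proof.
move=> [l2 ga Na] [l2' ga' Na'] ll' e; move: ga Na ll'; rewrite e ga' Na'; clear -l2 l2'.
by case: l l2 => [|[|[|l]]] //; case: l' l2' => [|[|[|l']]].
Qed.

(** The four-group of [bar] and [G] acts freely on the orbit of [x], and each of its four members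
    $y$ brings $f(y)$ and $\overline{f(y)}$: twelve arrows. *)
Lemma case4_sphere x : dbl x -> G x != x -> G x != tbar x ->
  exists2 lam : K, lam != 0 & alg_iso (LamP Q) (LamP (S_alg lam)).
Proof.
move=> dx Gx Gbx.
have [du dy dz] : [/\ dbl (tbar x), dbl (G x) & dbl (tbar (G x))] by split; do ?[apply: D_b | apply: D_G].
have GGx : G (G x) = x by apply: GG.
pose fl := [:: 8; 6; 10; 4; 11; 2; 9; 0; 7; 1; 5; 3]%N.
pose il := [:: 4; 8; 6; 10; 0; 11; 2; 9; 1; 7; 3; 5]%N.
pose h k := nth x [:: x; tbar (f x); G x; tbar (f (G x)); tbar x; tbar (f (tbar x)); tbar (G x);
  tbar (f (tbar (G x))); f x; f (tbar (G x)); f (G x); f (tbar x)] k.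
have hF k : (k <= 11)%N -> h (nth 0%N fl k) = f (h k).
  by case: k => [|[|[|[|[|[|[|[|[|[|[|[|k]]]]]]]]]]]] // _; rewrite /h /= ?fg ?ff ?Gb ?GGx ?b3.
have hI k : (k <= 11)%N -> h (nth 0%N il k) = tbar (h k).
  by case: k => [|[|[|[|[|[|[|[|[|[|[|[|k]]]]]]]]]]]] // _; rewrite /h /= ?b3.
have hsurj := table_surj hF hI isT.
pose lab k := nth 0%N [:: 0; 1; 0; 1; 0; 1; 0; 1; 2; 2; 2; 2]%N k.
have hlab k : (k <= 11)%N -> labelled (lab k) (h k).
  by rewrite /labelled; case: k => [|[|[|[|[|[|[|[|[|[|[|[|k]]]]]]]]]]]] // _; rewrite /h /= ?gd_g ?gd_f ?gd_D ?DNg ?DNf ?DN.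
have hinj : forall j k, (j <= 11)%N -> (k <= 11)%N -> h j = h k -> j = k.
  apply: (@separated_inj _ h f bar (fun j k => [|| k == nth 0 il j, lab j != lab k,
    (j == 2) && (k == 0) | (j == 2) && (k == 4)])%N fl il 4) => //.
  move=> j k jn kn /or4P[/eqP ->|lk|/andP[/eqP-> /eqP->]|/andP[/eqP-> /eqP->]].
  - by rewrite hI // => /esym/eqP; apply/negP/tbar_neq.
  - exact: labelled_neq (hlab j jn) (hlab k kn) lk.
  - exact/eqP.
  - exact/eqP.
have hg k : (k <= 11)%N -> tg (h k) = h (nth 0%N il (nth 0%N fl k)).
  by move=> kn; rewrite hI ?hF //; case: k kn => [|[|[|[|[|[|[|[|[|[|[|[|k]]]]]]]]]]]].
pose c1 := tc Q (h 0); pose c2 := tc Q (h 4); pose c3 := tc Q (h 8); pose c4 := tc Q (h 10).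
have c10 : c1 != 0 by apply: tc_neq0.
have c20 : c2 != 0 by apply: tc_neq0.
have c30 : c3 != 0 by apply: tc_neq0.
have c40 : c4 != 0 by apply: tc_neq0.
exists (c1 * c2 * c3 * c4); first by rewrite !mulf_neq0.
apply: (@table_alg_iso K Q wsa 5 11 _ _ _ _ _ _ il [:: 4; 4; 4; 4; 4; 4; 4; 4; 2; 2; 2; 2]%N
   h _ hF hI hinj hsurj _ _
   (fun k => nth 1 [:: c2 * c3; 1; c4; 1; 1; 1; 1; c2^-1; c3^-1; 1; c4^-1; 1] k)).
- by [].
- move=> k kn; have [_ _ Nk] := hlab k kn; have gk := hg k kn.
  transitivity 1%N; last by case: k kn {gk Nk} => [|[|[|[|[|[|[|[|[|[|[|[|k]]]]]]]]]]]].
  have [k8|k8] := ltnP k 8.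
    apply: weight_full; first by rewrite Nk; case: k k8 {kn gk Nk} => [|[|[|[|[|[|[|[|k]]]]]]]].
    rewrite gk hg; last by case: k k8 {kn gk Nk} => [|[|[|[|[|[|[|[|k]]]]]]]].
    apply/eqP => /hinj e; move: e {gk Nk kn}.
    by case: k k8 => [|[|[|[|[|[|[|[|k]]]]]]]] //= _ /(_ isT isT).
  apply: weight_prime; first by rewrite Nk; case: k kn k8 {gk Nk} => [|[|[|[|[|[|[|[|[|[|[|[|k]]]]]]]]]]]].
  rewrite gk; apply/eqP => /hinj e; move: e {gk Nk}.
  by case: k kn k8 => [|[|[|[|[|[|[|[|[|[|[|[|k]]]]]]]]]]]] //= _ _ /(_ isT isT).
- move=> k kn; have [_ _ ->] := hlab k kn.
  by case: k kn => [|[|[|[|[|[|[|[|[|[|[|[|k]]]]]]]]]]]].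
- by case=> [|[|[|[|[|[|[|[|[|[|[|[|k]]]]]]]]]]]] // _ /=; rewrite ?mulf_neq0 ?invr_eq0 ?oner_eq0.
have cg k : (k <= 11)%N -> tc Q (h (nth 0 il (nth 0 fl k))%N) = tc Q (h k).
  by move=> kn; rewrite -hg // tc_g.
have C1 : tc Q (h 1) = c1 := cg 0%N isT.
have C2 : tc Q (h 2) = c1 by rewrite -C1 -(cg 1%N isT).
have C3 : tc Q (h 3) = c1 by rewrite -C2 -(cg 2%N isT).
have C5 : tc Q (h 5) = c2 := cg 4%N isT.
have C6 : tc Q (h 6) = c2 by rewrite -C5 -(cg 5%N isT).
have C7 : tc Q (h 7) = c2 by rewrite -C6 -(cg 6%N isT).
have C9 : tc Q (h 9) = c3 := cg 8%N isT.
have C11 : tc Q (h 11) = c4 := cg 10%N isT.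
case=> [|[|[|[|[|[|[|[|[|[|[|[|k]]]]]]]]]]]] // _; cbn [nth il];
  rewrite ?C1 ?C2 ?C3 ?C5 ?C6 ?C7 ?C9 ?C11 -/c1 -/c2 -/c3 -/c4 /= !big_cons big_nil /=; field; rewrite ?c10 ?c20 ?c30 ?c40 //.
Qed.

Lemma closed_field_sqrt (c : K) : exists r : K, r ^+ 2 = c.
Proof.
have [r] := @solve_monicpoly K 2 (nth 0 [:: c]) isT.
by rewrite !big_ord_recl big_ord0 /= !mul0r !addr0 expr0 mulr1 => e; exists r.
Qed.

Lemma case4_triangle x : dbl x -> G x = x ->
  exists2 lam : K, lam != 0 & alg_iso (LamP Q) (LamP (T_alg lam)).
Proof.
move=> dx Gx; pose u := tbar x.
have du : dbl u by apply: D_b.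
have Gu : G u = u by rewrite Gb // Gx.
have [bx bu] : tbar x = u /\ tbar u = x by rewrite b3.
pose fl := [:: 1; 2; 0; 5; 3; 4]%N.
pose il := [:: 5; 3; 4; 1; 2; 0]%N.
pose h k := nth x [:: tbar (f u); x; f x; u; tbar (f x); f u] k.
have hF k : (k <= 5)%N -> h (nth 0%N fl k) = f (h k).
  by case: k => [|[|[|[|[|[|k]]]]]] // _; rewrite /h //= ?fg ?ff // ?Gx ?Gu ?bx ?bu.
have hI k : (k <= 5)%N -> h (nth 0%N il k) = tbar (h k).
  by case: k => [|[|[|[|[|[|k]]]]]] // _; rewrite /h //= ?b3.
have hsurj := table_surj hF hI isT.
pose lab k := nth 0%N [:: 1; 0; 2; 0; 1; 2]%N k.
have hlab k : (k <= 5)%N -> labelled (lab k) (h k).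
  by rewrite /labelled; case: k => [|[|[|[|[|[|k]]]]]] // _; rewrite /h /= ?gd_g ?gd_f ?gd_D ?DNg ?DNf ?DN.
have hinj : forall j k, (j <= 5)%N -> (k <= 5)%N -> h j = h k -> j = k.
  apply: (@separated_inj _ h f bar (fun j k => (k == nth 0 il j) || (lab j != lab k))%N fl il 4) => //.
  move=> j k jn kn /orP[/eqP ->|lk]; last exact: labelled_neq (hlab j jn) (hlab k kn) lk.
  by rewrite hI // => /esym/eqP; apply/negP/tbar_neq.
have hg k : (k <= 5)%N -> tg (h k) = h (nth 0%N il (nth 0%N fl k)).
  by move=> kn; rewrite hI ?hF //; case: k kn => [|[|[|[|[|[|k]]]]]].
pose c1 := tc Q (h 0); pose c2 := tc Q (h 1); pose c3 := tc Q (h 2).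
have c10 : c1 != 0 by apply: tc_neq0.
have c20 : c2 != 0 by apply: tc_neq0.
have c30 : c3 != 0 by apply: tc_neq0.
(* On the orbit of [h 1] the path $A_a$ is $a\,g(a)\,a$; the rescaling that makes its parameter 1
   uses a square root. *)
have [r r2] := closed_field_sqrt c2.
have r0 : r != 0 by apply: contraNneq c20 => e; rewrite -r2 e expr0n.
exists (c1 * c2 * c3 ^+ 2); first by rewrite !mulf_neq0 ?expf_neq0.
apply: (@table_alg_iso K Q wsa 2 5 _ _ _ _ _ _ il [:: 4; 4; 2; 4; 4; 2]%N h _ hF hI hinj hsurj _ _
   (fun k => nth 1 [:: r * c3; r^-1; c3^-1; 1; 1; 1] k)).
- by [].
- move=> k kn; have [_ _ Nk] := hlab k kn; have gk := hg k kn.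
  have gne : tg (h k) != h k.
    rewrite gk; apply/eqP => /hinj e; move: e {gk Nk}.
    by case: k kn => [|[|[|[|[|[|k]]]]]] //= _ /(_ isT isT).
  have [N2|N4] := eqVneq (N (h k)) 2%N.
    rewrite weight_prime ?N2 //; rewrite Nk in N2; move: N2; clear -kn.
    by case: k kn => [|[|[|[|[|[|k]]]]]].
  rewrite weight_half //.
  - by rewrite Nk in N4; move: N4; clear -kn; case: k kn => [|[|[|[|[|[|k]]]]]].
  - by rewrite Nk in N4 *; move: N4; case: ifP.
  rewrite gk hg; last by clear -kn; case: k kn => [|[|[|[|[|[|k]]]]]].
  by clear -kn; case: k kn => [|[|[|[|[|[|k]]]]]].
- move=> k kn; have [_ _ ->] := hlab k kn.
  by case: k kn => [|[|[|[|[|[|k]]]]]].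
- by case=> [|[|[|[|[|[|k]]]]]] // _ /=; rewrite ?mulf_neq0 ?invr_eq0 ?oner_eq0.
have cg k : (k <= 5)%N -> tc Q (h (nth 0 il (nth 0 fl k))%N) = tc Q (h k).
  by move=> kn; rewrite -hg // tc_g.
have C3 : tc Q (h 3) = c1 := cg 0%N isT.
have C4 : tc Q (h 4) = c2 := cg 1%N isT.
have C5 : tc Q (h 5) = c3 := cg 2%N isT.
case=> [|[|[|[|[|[|k]]]]]] // _; cbn [nth il]; rewrite ?C3 ?C4 ?C5 -/c1 -/c2 -/c3 -?r2 /= !big_cons big_nil /=;
  field; rewrite ?c10 ?c30 ?r0 //.
Qed.

(** Here [f x] and [f (bar x)] are virtual loops and the other four arrows form one [g]-orbit. The
    quiver of $T(\lambda)$ has no loops, so no numbering of arrows can match the two, and the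
    algebras are compared by [loops_triangle_iso]. *)
Lemma case4_loops x : dbl x -> G x = tbar x ->
  exists2 lam : K, lam != 0 & alg_iso (LamP Q) (LamP (T_alg lam)).
Proof.
move=> dx Gx; pose u := tbar x; pose be := tbar (f x); pose ga := tbar (f u).
pose xi := f x; pose ze := f u.
have du : dbl u by apply: D_b.
have Gu : G u = x by rewrite Gb // Gx b3.
have [bx bu] : tbar x = u /\ tbar u = x by rewrite b3.
have [bbe bxi bga bze] : [/\ tbar be = xi, tbar xi = be, tbar ga = ze & tbar ze = ga] by rewrite !b3.
have fbe : f be = x by rewrite fg // Gx b3.
have fga : f ga = u by rewrite fg // Gu.
have fxi : f xi = be by rewrite /xi ff // Gx b3.
have fze : f ze = ga by rewrite /ze ff // Gu.
pose fl := [:: 4; 0; 5; 2; 1; 3]%N.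
pose il := [:: 2; 4; 0; 5; 1; 3]%N.
pose h k := nth x [:: x; be; u; ga; xi; ze] k.
have hF k : (k <= 5)%N -> h (nth 0%N fl k) = f (h k).
  by case: k => [|[|[|[|[|[|k]]]]]] // _; rewrite /h /= ?fbe ?fga ?fxi ?fze.
have hI k : (k <= 5)%N -> h (nth 0%N il k) = tbar (h k).
  by case: k => [|[|[|[|[|[|k]]]]]] // _; rewrite /h /= ?bbe ?bga ?bxi ?bze.
have hsurj := table_surj hF hI isT.
pose lab k := nth 0%N [:: 0; 1; 0; 1; 2; 2]%N k.
have hlab k : (k <= 5)%N -> labelled (lab k) (h k).
  rewrite /labelled; case: k => [|[|[|[|[|[|k]]]]]] // _; rewrite /h /= /be /ga /xi /ze ?gd_g ?gd_f ?gd_D ?DNg ?DNf ?DN //.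
have hinj : forall j k, (j <= 5)%N -> (k <= 5)%N -> h j = h k -> j = k.
  apply: (@separated_inj _ h f bar (fun j k => (k == nth 0 il j) || (lab j != lab k))%N fl il 4) => //.
  move=> j k jn kn /orP[/eqP ->|lk]; last exact: labelled_neq (hlab j jn) (hlab k kn) lk.
  by rewrite hI // => /esym/eqP; apply/negP/tbar_neq.
pose c := tc Q x; pose c1 := tc Q xi; pose c2 := tc Q ze.
have c0 : c != 0 by apply: tc_neq0.
have c10 : c1 != 0 by apply: tc_neq0.
have c20 : c2 != 0 by apply: tc_neq0.
have cbe : tc Q be = c by apply: tc_g.
have cu : tc Q u = c by rewrite -cbe -[u]b3 bu -fbe tc_g.
have cga : tc Q ga = c by rewrite -cu; apply: tc_g.
pose lam := (c ^+ 2 * c1 * c2)^-1.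
exists lam; first by rewrite invr_eq0 !mulf_neq0 ?expf_neq0.
have gE : [/\ tg x = be, tg be = u, tg u = ga, tg ga = x & tg xi = xi /\ tg ze = ze].
  by rewrite /tg fbe fga fxi fze bx bu bbe bga.
case: gE => gx gbe gu gga [gxi gze].
have Np k (kn : (k <= 5)%N) : N (h k) = if lab k == 2%N then 2%N else 4%N by case: (hlab k kn).
have [Nx Nbe Nu Nga] : [/\ N x = 4%N, N be = 4%N, N u = 4%N & N ga = 4%N].
  by split; [apply: (Np 0%N) | apply: (Np 1%N) | apply: (Np 2%N) | apply: (Np 3%N)].
have [Nxi Nze] : N xi = 2%N /\ N ze = 2%N by split; [apply: (Np 4%N) | apply: (Np 5%N)].
pose v1 := ts Q be; pose v2 := ts Q x; pose v3 := ts Q ga.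
have sx : ts Q x = v2 by [].
have su : ts Q u = v2 by rewrite /u ts_bar.
have sbe : ts Q be = v1 by [].
have sxi : ts Q xi = v1 by rewrite -bbe ts_bar.
have sga : ts Q ga = v3 by [].
have sze : ts Q ze = v3 by rewrite -bga ts_bar.
have tx : tt Q x = v1 by rewrite -(ts_f wsa).
have tbe : tt Q be = v2 by rewrite -(ts_f wsa) fbe.
have tu : tt Q u = v3 by rewrite -(ts_f wsa).
have tga : tt Q ga = v2 by rewrite -(ts_f wsa) fga.
have txi : tt Q xi = v1 by rewrite -(ts_f wsa) fxi.
have tze : tt Q ze = v3 by rewrite -(ts_f wsa) fze.
have allA a : a \in [:: x; be; u; ga; xi; ze].
  by have [k kn <-] := hsurj a; apply: mem_nth.
have uA : uniq [:: x; be; u; ga; xi; ze] by apply/(uniqP x) => j k jn kn; apply: hinj.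
have allV v : v \in [:: v1; v2; v3].
  have [a <-] := source_arrow wsa v; move: (allA a); rewrite !inE.
  by repeat (case/orP; first (move/eqP->)); last (move/eqP->);
    rewrite ?sx ?su ?sbe ?sga ?sxi ?sze eqxx ?orbT.
have vneq j k : (j <= 5)%N -> (k <= 5)%N -> j != k -> k != nth 0%N il j -> ts Q (h j) != ts Q (h k).
  move=> jn kn jk kj; rewrite (ts_eq wsa) negb_or -hI //; apply/andP; split.
    by apply: contraNneq jk => /hinj->.
  apply: contraNneq kj => /hinj-> //.
  by case: (j) jn => [|[|[|[|[|[|j']]]]]].
have uV : uniq [:: v1; v2; v3].
  by rewrite /= !inE negb_or (vneq 1%N 0%N) // (vneq 1%N 3%N) // (vneq 0%N 3%N).
have basic := wsa_basic wsa.
pose cg := mcong (ts Q) (tt Q) (Lam_rels Q); pose zr := mzero (ts Q) (tt Q) (Lam_rels Q).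
have Ap a : Apath a = (ts Q a, [seq iter i (@tg K Q) a | i <- iota 0 (N a).-1]) by [].
have [Ax Abe Au Aga] : [/\ Apath x = (v2, [:: x; be; u]), Apath be = (v1, [:: be; u; ga]),
    Apath u = (v2, [:: u; ga; x]) & Apath ga = (v3, [:: ga; x; be])].
  by rewrite !Ap Nx Nbe Nu Nga /= !(gx, gbe, gu, gga) su.
have [Axi Aze] : Apath xi = (v1, [:: xi]) /\ Apath ze = (v3, [:: ze]) by rewrite !Ap Nxi Nze /= sxi sze.
have [vx vbe vu vga] : [/\ tvirtual x = false, tvirtual be = false, tvirtual u = false & tvirtual ga = false].
  by rewrite /tvirtual -![(_ * _)%N]/(tN _) Nx Nbe Nu Nga.
have [vxi vze] : tvirtual xi /\ tvirtual ze by rewrite /tvirtual -![(_ * _)%N]/(tN _) Nxi Nze.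
have fE := (fbe, fga, fxi, fze, erefl : f x = xi, erefl : f u = ze).
have bE := (bx, bu, bbe, bga, bxi, bze).
have sE := (sx, su, sbe, sxi, sga, sze).
have gE := (gx, gbe, gu, gga, gxi, gze).
have vE := (vx, vbe, vu, vga, vxi, vze).
have AE := (Ax, Abe, Au, Aga, Axi, Aze).
have cE := (cbe, cu, cga, erefl : tc Q x = c, erefl : tc Q xi = c1, erefl : tc Q ze = c2).
have presP : presented (P := LamP Q)
    [:: ((v2, [:: x; xi]), c, (v2, [:: u; ga; x]));
       ((v1, [:: xi; be]), c, (v1, [:: be; u; ga]));
       ((v1, [:: be; x]), c1, (v1, [:: xi]));
       ((v2, [:: u; ze]), c, (v2, [:: x; be; u]));
       ((v3, [:: ze; ga]), c, (v3, [:: ga; x; be]));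
       ((v3, [:: ga; u]), c2, (v3, [:: ze]))]
    [:: (v2, [:: x; xi; xi]);
       (v1, [:: xi; be; u]);
       (v2, [:: u; ze; ze]);
       (v3, [:: ze; ga; x]);
       (v1, [:: xi; xi; be]);
       (v1, [:: be; u; ze]);
       (v3, [:: ga; x; xi]);
       (v3, [:: ze; ze; ga])].
  split.
  - move=> r; rewrite [prels _]/(Lam_rels Q) /Lam_rels !mem_cat => /or3P[] /mapP[a].
    + move=> _ ->; apply/orP; left; move: (allA a); rewrite !inE.
      by repeat (case/orP; first (move/eqP->)); last (move/eqP->);
        rewrite ?fE ?bE ?sE ?cE ?AE ?eqxx ?orbT.
    + rewrite mem_filter => /andP[nv _] ->; apply/orP; right; move: (allA a) nv; rewrite !inE.
      by repeat (case/orP; first (move/eqP->)); last (move/eqP->);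
        rewrite !fE vE // => _; rewrite ?gE ?sE ?eqxx ?orbT.
    + rewrite mem_filter => /andP[nv _] ->; apply/orP; right; move: (allA a) nv; rewrite !inE.
      by repeat (case/orP; first (move/eqP->)); last (move/eqP->);
        rewrite !fE vE // => _; rewrite !gE !fE ?sE ?eqxx ?orbT.
  - move=> b; rewrite !inE; repeat (case/orP; first (move/eqP->)); last (move/eqP->); cbn [fst snd].
    + by have := rel_cong basic x; rewrite !fE !bE !sE !cE !AE.
    + by have := rel_cong basic xi; rewrite !fE !bE !sE !cE !AE.
    + by have := rel_cong basic be; rewrite !fE !bE !sE !cE !AE.
    + by have := rel_cong basic u; rewrite !fE !bE !sE !cE !AE.
    + by have := rel_cong basic ze; rewrite !fE !bE !sE !cE !AE.
    + by have := rel_cong basic ga; rewrite !fE !bE !sE !cE !AE.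
  - move=> z; rewrite !inE; repeat (case/orP; first (move/eqP->)); last (move/eqP->).
    + by have := rel_zero1 (Q := Q) (a := x); rewrite !fE !gE !vE; apply.
    + by have := rel_zero1 (Q := Q) (a := xi); rewrite !fE !gE !sE !vE; apply.
    + by have := rel_zero1 (Q := Q) (a := u); rewrite !fE !gE !sE !vE; apply.
    + by have := rel_zero1 (Q := Q) (a := ze); rewrite !fE !gE !sE !vE; apply.
    + by have := rel_zero2 (Q := Q) (a := xi); rewrite !fE !gE !fE !sE !vE; apply.
    + by have := rel_zero2 (Q := Q) (a := be); rewrite !fE !gE !fE !vE; apply.
    + by have := rel_zero2 (Q := Q) (a := ga); rewrite !fE !gE !fE !vE; apply.
    + by have := rel_zero2 (Q := Q) (a := ze); rewrite !fE !gE !fE !sE !vE; apply.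
have [uT allT] := T_arrows lam; have [uW allW] := T_vertices lam.
refine (@loops_triangle_iso K (LamP Q) (LamP (T_alg lam)) c c1 c2 lam x be u ga xi ze v1 v2 v3
  (inord 0) (inord 1) (inord 2) (inord 3) (inord 4) (inord 5) (inord 0) (inord 1) (inord 2)
  uA allA uV allV uT allT uW allW _ _ (T_sources lam) (T_targets lam) c0 c10 c20 erefl presP (T_presented lam)).
- by rewrite /= sx sbe su sga sxi sze.
- by rewrite /= tx tbe tu tga txi tze.
Qed.
End Case4.
End Rigid.

(** * Non-polynomial growth *)

Section StringRelations.
Variables (K : fieldType) (Q : tqdata K) (rels : seq (kq K (tV Q) (tA Q))).
Let P : pres K := @Pres K (tV Q) (tA Q) (ts Q) (tt Q) rels.
Variables (d : nat) (M : rep K (tV Q) (tA Q) d).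
Hypothesis strM : string_rep (ts Q) (tt Q) (@tbar K Q) (tf Q) (@tN K Q) M.

Lemma string_Apath (a : tA Q) : rep_path (P := P) M (Apath a) = 0.
Proof.
case: strM => _ _ /(_ a) e; rewrite /rep_path; case: ifP => // _.
by rewrite /= -map_comp.
Qed.

Lemma string_f (a : tA Q) l : rep_path (P := P) M (ts Q a, [:: a, tf Q a & l]) = 0.
Proof.
case: strM => _ X0 _; rewrite /rep_path; case: ifP => // _ /=.
by rewrite -mulmxA X0 mulmx0; elim: l => //= b l IH; rewrite mul0mx.
Qed.

Lemma string_gf (a : tA Q) : rep_path (P := P) M (ts Q a, [:: a; tg a; tf Q (tg a)]) = 0.
Proof.
case: strM => _ X0 _; rewrite /rep_path; case: ifP => // _ /=.
by rewrite -mulmxA X0 mulmx0.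
Qed.

Lemma string_Gam r : r \in Gam_rels Q -> rep_eval (P := P) id M r = 0.
Proof.
rewrite mem_cat => /orP[]/mapP[a _ ->]; rewrite /rep_eval big_seq1.
  by rewrite string_f scaler0.
by rewrite string_Apath scaler0.
Qed.

(** Both terms of a binomial vanish separately, and each zero path contains some $\beta
    f(\beta)$. *)
Lemma string_Lam r : r \in Lam_rels Q -> rep_eval (P := P) id M r = 0.
Proof.
rewrite !mem_cat => /or3P[]/mapP[a _ ->]; rewrite /rep_eval ?big_cons big_nil.
- by rewrite string_f string_Apath !scaler0 !addr0.
- by rewrite string_f scaler0 addr0.
- by rewrite string_gf scaler0 addr0.
Qed.
End StringRelations.

Section NonPolynomial.
Variables (K : closedFieldType) (Q : tqdata K).
Hypothesis wsa : is_wsa Q.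
Local Notation bar := (@tbar K Q).
Local Notation N := (@tN K Q).

Lemma branching_not_poly_growth : branching bar (tf Q) N ->
  ~ poly_growth (GamP Q) /\ ~ poly_growth (LamP Q).
Proof.
case/(branching_codes (tbarK wsa) (tf3 wsa) (tN_g wsa) (tN_ge2 wsa)) =>
  a [U [U' [sUU' UU' U0 [clU clU'] runs]]].
have H rels string_rels := @codes_not_poly_growth K _ _ (ts Q) (tt Q) _ _ _ (tbarK wsa) (tbar_neq wsa)
  (ts_eq wsa) (tf3 wsa) (ts_f wsa) (tN_g wsa) rels string_rels a U U' (size U) erefl (esym sUU')
  UU' U0 clU clU' runs.
by split; apply: H => d M strM r; [apply: string_Gam | apply: string_Lam].
Qed.

Lemma rigid_or_branching : branching bar (tf Q) N \/
  (forall a, ~~ broken bar (tf Q) N a) /\ (forall a, good bar N a -> ~~ allowed bar (tf Q) N a).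
Proof.
case: (pickP (broken bar (tf Q) N)) => [a br|nb].
  left; exact: (broken_branching (tbarK wsa) (tbar_neq wsa) (tf3 wsa) (tN_g wsa) (tN_ge2 wsa)
    (@tn_dvd K Q) (@tN_vir3 _ _ wsa) (@tN_vir4 _ _ wsa) br).
have no_broken a : ~~ broken bar (tf Q) N a by rewrite nb.
case: (pickP (fun a => good bar N a && allowed bar (tf Q) N a)) => [a /andP[ga al]|na].
  left; exact: (allowed_nonrigid (tbarK wsa) (tf3 wsa) (tN_g wsa) (tN_ge2 wsa)
    (@tn_dvd K Q) (@tN_vir3 _ _ wsa) no_broken ga al).
by right; split=> // a ga; have := na a; rewrite ga => /negbT.
Qed.
End NonPolynomial.

Theorem theorem6p8 (K : closedFieldType) (Q : tqdata K) :
  is_wsa Q ->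
  (forall lam : K, lam != 0%R ->
     [/\ ~ alg_iso (LamP Q) (LamP (D_alg lam)) /\
         ~ alg_iso (LamP Q) (LamP (D1_alg lam)),
         ~ alg_iso (LamP Q) (LamP (D2_alg lam)),
         ~ alg_iso (LamP Q) (LamP (T_alg lam)),
         ~ alg_iso (LamP Q) (LamP (S_alg lam))
       & ~ alg_iso (LamP Q) (LamP (L_alg lam))]) ->
  ~ poly_growth (GamP Q) /\ ~ poly_growth (LamP Q).
Proof.
move=> wsa not_special.
case: (rigid_or_branching wsa) => [|[no_broken rigid]]; first exact: branching_not_poly_growth.
have [v _] : exists v : tV Q, v \in tV Q.
  by apply/card_gt0P; case: wsa => [[V2 _] _ _ _ _]; apply: leq_trans V2.
have [a0 _] := source_arrow wsa v.
have conn (S : {set tA Q}) a : a \in S -> _ := @arrows_connected K Q wsa S a.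
case: (rigid_dichotomy (tbarK wsa) (tf3 wsa) (tN_g wsa) (tN_ge2 wsa)
  (@tn_dvd K Q) (@tN_vir3 _ _ wsa) conn no_broken rigid a0) => [N3|[x dx]].
  case: (pickP (fun a => tf Q a == a)) => [b /eqP fb|nf].
    by have [lam /not_special[[nD _] _ _ _ _] /nD] := case3_fixed wsa N3 fb.
  have [|lam /not_special[_ _ _ _ nL] /nL //] := case3_free wsa N3 _ a0.
  by move=> a; rewrite nf.
have [Gx|Gx] := eqVneq (gnext (@tbar K Q) (tf Q) (@tN K Q) x) x.
  by have [lam /not_special[_ _ nT _ _] /nT] := case4_triangle wsa no_broken rigid dx Gx.
have [Gb|Gb] := eqVneq (gnext (@tbar K Q) (tf Q) (@tN K Q) x) (tbar x).
  by have [lam /not_special[_ _ nT _ _] /nT] := case4_loops wsa no_broken rigid dx Gb.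
by have [lam /not_special[_ _ _ nS _] /nS] := case4_sphere wsa no_broken rigid dx Gx Gb.
Qed.
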